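(* Let $G$ be a simply connected complex linear algebraic group whose Lie algebra $\mathfrak g$ is semisimple of rank $r$. Let $\varphi_1,\dots,\varphi_r$ be the characters of the fundamental representations of $G$. Then the vector fields $X_1,\dots,X_r$ on $G$ corresponding to $\operatorname{grad}\varphi_1,\dots,\operatorname{grad}\varphi_r$ are a $\mathcal J$-module basis for $\mathfrak X(G)^{\mathrm{Ad}\,G}$. Furthermore, all conjugation-invariant regular vector fields on $G$ are flat.
   Context: $G\subset\mathrm{GL}(N,\mathbf C)$ is connected. $\mathfrak X(G)^{\mathrm{Ad}\,G}$ is the space of regular algebraic vector fields on $G$ invariant under conjugation by $G$. They correspond bijectively to regular conjugation-equivariant maps $\Phi:G\to\mathfrak g$ ($\Phi(xyx^{-1})=\mathrm{Ad}(x)\Phi(y)$ for $x,y\in G$): the vector field corresponding to $\Phi$ is $f\mapsto\big(y\mapsto\frac{d}{dt}f(y+ty\Phi(y))|_{t=0}\big)$ for $f\in\mathbf C[G]$ ($f$ viewed as the restriction to $G$ of a regular function on $\mathrm{GL}(N,\mathbf C)$). $\mathcal J=\mathbf C[G]^{\mathrm{Ad}\,G}$ is the algebra of regular class functions on $G$, acting by pointwise multiplication. For $\varphi\in\mathcal J$, $d\varphi(g)\in\mathfrak g^*$ is $d\varphi(g)(X)=\frac{d}{dt}\varphi(g(1+tX))|_{t=0}$, and $\operatorname{grad}\varphi(g)\in\mathfrak g$ corresponds to $d\varphi(g)$ under the isomorphism $\mathfrak g\cong\mathfrak g^*$ given by a fixed nondegenerate $\mathrm{Ad}\,G$-invariant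 bilinear form on $\mathfrak g$; $\operatorname{grad}\varphi$ is conjugation-equivariant. The conjugation-invariant vector field corresponding to $\Phi$ is called flat if $\mathrm{Ad}(y)\Phi(y)=\Phi(y)$ for all $y\in G$. (This is the notion of flatness for the symmetric space $(G\times G)/G$ with involution $\theta(g,h)=(h,g)$, whose Cartan embedding has image $P=\{(g,g^{-1}):g\in G\}$, identified with $G$ by projection to the first component.) *)

(* Defs.v *)
From HB Require Import structures.
From mathcomp Require Import all_boot all_order all_algebra.
From mathcomp Require Import complex.
From mathcomp Require Import boolp classical_sets functions set_interval reals.
From mathcomp Require Import topology normedtype derive.
From mathcomp Require mpoly.

Set Implicit Arguments.
Unset Strict Implicit.
Unset Printing Implicit Defensive.

Import Order.TTheory GRing.Theory Num.Theory.
Import numFieldNormedType.Exports.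

#[export] Set Warnings "-notation-overridden,-ambiguous-paths,-redundant-canonical-projection".

Local Open Scope classical_set_scope.
Local Open Scope ring_scope.
Local Open Scope complex_scope.

(* The complex numbers over [R : realType] are [R[i]]; this gives them, hence
   also the matrices over them, their usual topology. *)
HB.instance Definition _ (R : realType) := NormedModule.copy R[i] R[i]^o.

(* Paths are parametrized by [0, 1] and are unconstrained outside of it. *)
Definition simply_connected (R : realType) (T : topologicalType) (A : set T) :=
  [/\ A !=set0,
      (forall x y, A x -> A y -> exists p : R -> T,
         [/\ {within `[0, 1], continuous p}, p @` `[0, 1] `<=` A,
             p 0 = x & p 1 = y])
    & (forall p : R -> T, {within `[0, 1], continuous p} ->
         p @` `[0, 1] `<=` A -> p 0 = p 1 ->
         exists H : R * R -> T,
         [/\ {within `[0, 1] `*` `[0, 1], continuous H},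
             H @` (`[0, 1] `*` `[0, 1]) `<=` A,
             {in `[0, 1], forall t, H (0, t) = p t},
             {in `[0, 1], forall t, H (1, t) = p 0}
           & {in `[0, 1], forall s, H (s, 0) = p 0 /\ H (s, 1) = p 0}])].

Definition evalmx (R : realType) (N : nat) (p : mpoly.mpoly (N * N) R[i])
    (g : 'M[R[i]]_N) : R[i] :=
  mpoly.meval (fun k => mxvec g ord0 k) p.

Record linAlgGroup (R : realType) (N : nat) := LinAlgGroup {
  lag_set :> set 'M[R[i]]_N;
  lag_unit : forall g, lag_set g -> g \in unitmx;
  lag_one : lag_set 1%:M;
  lag_mul : forall g h, lag_set g -> lag_set h -> lag_set (g *m h);
  lag_inv : forall g, lag_set g -> lag_set (invmx g);
  lag_closed : exists I : set (mpoly.mpoly (N * N) R[i]),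
    forall g, g \in unitmx ->
      (lag_set g <-> forall p, I p -> evalmx p g = 0) }.

Section Group.
Variables (R : realType) (N : nat) (G : linAlgGroup R N).
Implicit Types (x y g : G) (f phi : G -> R[i]).

Definition oneG : G := exist _ 1%:M (mem_set (lag_one G)).

Definition mulG x y : G :=
  exist _ (val x *m val y) (mem_set (lag_mul (set_valP x) (set_valP y))).

Definition invG x : G :=
  exist _ (invmx (val x)) (mem_set (lag_inv (set_valP x))).

Definition conjG x y : G := mulG (mulG x y) (invG x).

(* The coordinate ring of GL(N, C) is generated by the matrix entries and the
   inverse of the determinant. *)
Definition regularGL (F : 'M[R[i]]_N -> R[i]) :=
  exists (p : mpoly.mpoly (N * N) R[i]) (k : nat),
    forall A, A \in unitmx -> F A = evalmx p A / \det A ^+ k.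

Definition extends (F : 'M[R[i]]_N -> R[i]) f := forall g, F (val g) = f g.

Definition regular f := exists2 F, regularGL F & extends F f.

Definition class_function f := forall x y, f (conjG x y) = f y.

Definition regular_class f := regular f /\ class_function f.

(* An arbitrary regular extension to GL(N, C): the derivatives below, taken in
   directions tangent to G, do not depend on this choice. *)
Definition ext f : 'M[R[i]]_N -> R[i] :=
  xget (fun=> 0) [set F | regularGL F /\ extends F f].

(* The Lie algebra of G, as the Zariski tangent space at the identity. *)
Definition lie : set 'M[R[i]]_N :=
  [set X | forall p, (forall g, evalmx p (val g) = 0) ->
     derive1 (fun t : R[i] => evalmx p (1%:M + t *: X)) 0 = 0].

Definition Ad g (X : 'M[R[i]]_N) : 'M[R[i]]_N := val g *m X *m invmx (val g).

Definition differential f g (X : 'M[R[i]]_N) : R[i] :=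
  derive1 (fun t : R[i] => ext f (val g *m (1%:M + t *: X))) 0.

(* Regular vector fields are the derivations of the coordinate ring; only the
   values of [D] at regular functions are meaningful. *)
Definition vector_field (D : (G -> R[i]) -> G -> R[i]) :=
  [/\ forall f, regular f -> regular (D f),
      forall (a : R[i]) f1 f2, regular f1 -> regular f2 ->
        D (a *: f1 + f2) = a *: D f1 + D f2
    & forall f1 f2, regular f1 -> regular f2 ->
        D (f1 * f2) = D f1 * f2 + f1 * D f2].

Definition inv_vector_field (D : (G -> R[i]) -> G -> R[i]) :=
  vector_field D /\
  forall x f, regular f -> D (f \o conjG x) = D f \o conjG x.

Definition equivariant_map (Phi : G -> 'M[R[i]]_N) :=
  [/\ forall y, lie (Phi y),
      forall i j, regular (fun y => Phi y i j)
    & forall x y, Phi (conjG x y) = Ad x (Phi y)].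

Definition field_of (Phi : G -> 'M[R[i]]_N) (f : G -> R[i]) (y : G) : R[i] :=
  derive1 (fun t : R[i] => ext f (val y + t *: (val y *m Phi y))) 0.

Definition flat (D : (G -> R[i]) -> G -> R[i]) :=
  exists Phi, [/\ equivariant_map Phi,
    forall f, regular f -> D f = field_of Phi f
  & forall y, Ad y (Phi y) = Phi y].

Definition inv_basis (r : nat) (X : 'I_r -> (G -> R[i]) -> G -> R[i]) :=
  [/\ forall i, inv_vector_field (X i),
      forall D, inv_vector_field D ->
        exists2 a : 'I_r -> G -> R[i], forall i, regular_class (a i)
          & forall f, regular f -> D f = \sum_i a i * X i f
    & forall a : 'I_r -> G -> R[i], (forall i, regular_class (a i)) ->
        (forall f, regular f -> \sum_i a i * X i f = 0) ->
        forall i, a i = 0].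

(* Only the restriction of [B] to the Lie algebra matters. *)
Definition invariant_form (B : 'M[R[i]]_N -> 'M[R[i]]_N -> R[i]) :=
  [/\ forall (a : R[i]) X Y Z, lie X -> lie Y -> lie Z ->
        B (a *: X + Y) Z = a * B X Z + B Y Z,
      forall (a : R[i]) X Y Z, lie X -> lie Y -> lie Z ->
        B Z (a *: X + Y) = a * B Z X + B Z Y,
      forall X, lie X -> (forall Y, lie Y -> B X Y = 0) -> X = 0
    & forall g X Y, lie X -> lie Y -> B (Ad g X) (Ad g Y) = B X Y].

Definition grad (B : 'M[R[i]]_N -> 'M[R[i]]_N -> R[i]) phi (g : G) :
    'M[R[i]]_N :=
  xget 0 [set Y | lie Y /\ forall X, lie X -> B Y X = differential phi g X].

Definition representation (n : nat) (rho : G -> 'M[R[i]]_n) :=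
  [/\ forall i j, regular (fun g => rho g i j),
      rho oneG = 1%:M
    & forall x y, rho (mulG x y) = rho x *m rho y].

Definition irreducible (n : nat) (rho : G -> 'M[R[i]]_n) :=
  (0 < n)%N /\
  forall U : {vspace 'cV[R[i]]_n},
    (forall g v, v \in U -> rho g *m v \in U) -> U = 0%VS \/ U = fullv.

Definition character (n : nat) (rho : G -> 'M[R[i]]_n) : G -> R[i] :=
  fun g => \tr (rho g).

Definition drep (n : nat) (rho : G -> 'M[R[i]]_n) (X : 'M[R[i]]_N) :
    'M[R[i]]_n :=
  \matrix_(i, j) differential (fun g => rho g i j) oneG X.

End Group.

Section Lie.
Variables (R : realType) (N : nat).
Implicit Types (U V h : {vspace 'M[R[i]]_N}) (L : set 'M[R[i]]_N).

Definition lieb (X Y : 'M[R[i]]_N) : 'M[R[i]]_N := X *m Y - Y *m X.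

Definition liebv U V : {vspace 'M[R[i]]_N} :=
  <<[seq lieb X Y | X <- vbasis U, Y <- vbasis V]>>%VS.

Definition lie_solvable U := exists k, iter k (fun V => liebv V V) U = 0%VS.

Definition lie_nilpotent U := exists k, iter k (liebv U) U = 0%VS.

Definition lie_ideal L U :=
  (forall X, X \in U -> L X) /\
  (forall X Y, L X -> Y \in U -> lieb X Y \in U).

Definition lie_semisimple L :=
  forall U, lie_ideal L U -> lie_solvable U -> U = 0%VS.

Definition cartan L h :=
  [/\ forall X, X \in h -> L X,
      forall X Y, X \in h -> Y \in h -> lieb X Y \in h,
      lie_nilpotent h
    & forall X, L X -> (forall Y, Y \in h -> lieb X Y \in h) -> X \in h].

Variables (L : set 'M[R[i]]_N) (h : {vspace 'M[R[i]]_N}).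

Definition weight := 'Hom(subvs_of h, R[i]^o).

Implicit Types (beta : weight).

Definition root_space beta : set 'M[R[i]]_N :=
  [set X | L X /\ forall H : subvs_of h,
     lieb (vsval H) X = (beta H : R[i]) *: X].

Definition is_root beta :=
  beta != 0 /\ exists2 X, root_space beta X & X != 0.

Variables (r : nat) (Delta : r.-tuple weight).

Definition nonneg_comb beta :=
  exists c : 'I_r -> nat, beta = \sum_i tnth Delta i *+ c i.

Definition root_base :=
  [/\ basis_of fullv Delta,
      forall i, is_root (tnth Delta i)
    & forall beta, is_root beta -> nonneg_comb beta \/ nonneg_comb (- beta)].

Definition is_coroot beta (H : subvs_of h) :=
  beta H = 2 /\
  exists X Y, [/\ root_space beta X, root_space (- beta) Y
    & vsval H = lieb X Y].

Definition fundamental_weight (i : 'I_r) (omega : weight) :=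
  forall j H, is_coroot (tnth Delta j) H -> omega H = (i == j)%:R.

End Lie.

Section Fundamental.
Variables (R : realType) (N : nat) (G : linAlgGroup R N).
Variables (h : {vspace 'M[R[i]]_N}) (r : nat) (Delta : r.-tuple (weight h)).

Definition highest_weight (n : nat) (rho : G -> 'M[R[i]]_n)
    (lambda : weight h) :=
  exists v : 'cV[R[i]]_n,
    [/\ v != 0,
        forall H : subvs_of h,
          drep rho (vsval H) *m v = (lambda H : R[i]) *: v
      & forall beta X, is_root (lie G) beta -> nonneg_comb Delta beta ->
          root_space (lie G) beta X -> drep rho X *m v = 0].

Definition fundamental_rep (i : 'I_r) (n : nat) (rho : G -> 'M[R[i]]_n) :=
  [/\ representation rho, irreducible rho
    & exists2 omega, fundamental_weight (lie G) Delta i omega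
        & highest_weight rho omega].

End Fundamental.

(* Main.v *)
Require Import Defs.
From HB Require Import structures.
From mathcomp Require Import all_boot all_order all_algebra.
From mathcomp Require Import complex.
From mathcomp Require Import boolp classical_sets functions set_interval reals.
From mathcomp Require Import topology normedtype derive.
From mathcomp Require Import (canonicals) mpoly.
From mathcomp Require Import perm.
From mathcomp Require Import ring lra zify.

Set Implicit Arguments.
Unset Strict Implicit.
Unset Printing Implicit Defensive.

Import Order.TTheory GRing.Theory Num.Theory.
Import numFieldNormedType.Exports.

Local Open Scope ring_scope.

(** Flatness is immediate: [y] commutes with itself, so an equivariant map satisfies Ad(y) Phi(y) =
    Phi(y y y^-1) = Phi(y).

    An equivariant map F sends T into the Cartan subalgebra [h], and its restriction to T determines
    it because the conjugates of T are Zariski dense ([torus_conj_dense], [equivariant_expr_torus]).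
    Pairing with the coroots turns this restriction into a row of r Laurent polynomials in u, on
    which a simple reflection acts by a matrix of determinant -1 ([eta_srefl], [det_reflmx]). For
    the gradients of the fundamental characters chi_i, the rows form the matrix of derivatives of
    chi_i along H_j. Its determinant J changes sign under simple reflections, and its leading
    monomial is u_1 ... u_r with coefficient 1, because chi_i has leading monomial u_i
    ([character_torus], [J_top], [J_anti]).

    Cramer's rule gives J F = sum_i D_i grad chi_i on T, where each D_i again changes sign under
    simple reflections. Every such Laurent polynomial is J times a polynomial in the chi_i
    ([anti_divisible]): an exponent m of maximal height has all coordinates at least 1, so J times
    the product of the chi_i^(m_i - 1) has leading monomial m and can be subtracted. Thus D_i = J
    a_i, where a_i is a polynomial in the characters and so a class function on all of G. Laurent
    polynomials form a domain and J is not zero, hence F = sum_i a_i grad chi_i on T, and then on G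
    by density ([gradients_span]). The same cancellation of J gives independence ([gradients_free]).

    Density rests on [taylor_principle]: a regular function vanishes on G as soon as all its
    iterated left-invariant derivatives vanish at one point. Indeed the Lie algebra is spanned by
    nilpotents, regular functions are polynomial along their exponentials, and the Zariski closure
    of the group that these generate is open ([G1_open]), hence everything by connectedness. For a
    function vanishing on the conjugates of T, derivatives along T are derivatives of a zero Laurent
    polynomial, while the derivative in a root direction of character m differs from a conjugation
    derivative by the factor u^(-m) - 1, which cancels.

    The structure theory is obtained inside matrices. The Lie algebra of an algebraic group contains
    nilpotent Jordan parts ([jordan_lie]), so the elements of [h] are diagonalizable
    ([cartan_diag]); the invariant form yields sl2-triples ([coroot_triple]), which give integral
    weights, the signs of the Cartan matrix and representatives of the simple reflections
    ([weyl_element]). Positivity of the trace form on coroots provides the height function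
    ([height_exists]). *)

(** * Regular functions on GL_N as formal expressions, and their differentials *)

Section RegularExpressions.
Variables (C : fieldType) (N : nat).

(* Regular functions on GL_N are represented by formal expressions in the
   entries of a matrix [PX] and of its inverse [PV]. *)
Inductive rexp :=
  | PC of C
  | PX of 'I_N & 'I_N
  | PV of 'I_N & 'I_N
  | PAdd of rexp & rexp
  | PMul of rexp & rexp
  | PScale of C & rexp.

Implicit Types (e : rexp) (A V X Y : 'M[C]_N).

Fixpoint pev e A : C :=
  match e with
  | PC c => c
  | PX i j => A i j
  | PV i j => invmx A i j
  | PAdd e1 e2 => pev e1 A + pev e2 A
  | PMul e1 e2 => pev e1 A * pev e2 A
  | PScale c e1 => c * pev e1 A
  end.

(** The differential of [pev e] at [A] in the direction [V], computed on syntax; the [PV] clause is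
    the formula d(A^-1) = - A^-1 dA A^-1. *)
Fixpoint pdir e A V : C :=
  match e with
  | PC c => 0
  | PX i j => V i j
  | PV i j => - (invmx A *m V *m invmx A) i j
  | PAdd e1 e2 => pdir e1 A V + pdir e2 A V
  | PMul e1 e2 => pdir e1 A V * pev e2 A + pev e1 A * pdir e2 A V
  | PScale c e1 => c * pdir e1 A V
  end.

Definition psum (I : Type) (s : seq I) (F : I -> rexp) : rexp :=
  foldr (fun i => PAdd (F i)) (PC 0) s.

Lemma pev_sum I (s : seq I) F A : pev (psum s F) A = \sum_(i <- s) pev (F i) A.
Proof. by elim: s => [|i s ih] /=; rewrite ?big_nil ?big_cons ?ih. Qed.

Lemma pdir_sum I (s : seq I) F A V :
  pdir (psum s F) A V = \sum_(i <- s) pdir (F i) A V.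
Proof. by elim: s => [|i s ih] /=; rewrite ?big_nil ?big_cons ?ih. Qed.

Lemma pdirD e A V W : pdir e A (V + W) = pdir e A V + pdir e A W.
Proof.
elim: e => [c|i j|i j|e1 ih1 e2 ih2|e1 ih1 e2 ih2|c e ih] /=.
- by rewrite addr0.
- by rewrite mxE.
- by rewrite mulmxDr mulmxDl mxE opprD.
- by rewrite ih1 ih2 addrACA.
- by rewrite ih1 ih2 mulrDl mulrDr addrACA.
- by rewrite ih mulrDr.
Qed.

Lemma pdirZ e A c V : pdir e A (c *: V) = c * pdir e A V.
Proof.
elim: e => [d|i j|i j|e1 ih1 e2 ih2|e1 ih1 e2 ih2|d e ih] /=.
- by rewrite mulr0.
- by rewrite mxE.
- by rewrite -scalemxAr -scalemxAl mxE mulrN.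
- by rewrite ih1 ih2 mulrDr.
- by rewrite ih1 ih2; ring.
- by rewrite ih; ring.
Qed.

Lemma pdir0 e A : pdir e A 0 = 0.
Proof. by rewrite -[X in pdir _ _ X](scale0r 0) pdirZ mul0r. Qed.

Lemma pdirN e A V : pdir e A (- V) = - pdir e A V.
Proof. by rewrite -scaleN1r pdirZ mulN1r. Qed.

Lemma pdirB e A V W : pdir e A (V - W) = pdir e A V - pdir e A W.
Proof. by rewrite pdirD pdirN. Qed.

Lemma pdir_sumr e A I (s : seq I) (V : I -> 'M[C]_N) :
  pdir e A (\sum_(i <- s) V i) = \sum_(i <- s) pdir e A (V i).
Proof. by elim: s => [|i s ih]; rewrite ?big_nil ?pdir0 // !big_cons pdirD ih. Qed.

(* The derivation along the vector field [A |-> Y *m A + A *m X]. *)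
Fixpoint dd Y X e : rexp :=
  match e with
  | PC c => PC 0
  | PX i j => PAdd (psum (index_enum 'I_N) (fun k => PScale (Y i k) (PX k j)))
                   (psum (index_enum 'I_N) (fun k => PScale (X k j) (PX i k)))
  | PV i j => PAdd (psum (index_enum 'I_N) (fun k => PScale (- Y k j) (PV i k)))
                   (psum (index_enum 'I_N) (fun k => PScale (- X i k) (PV k j)))
  | PAdd e1 e2 => PAdd (dd Y X e1) (dd Y X e2)
  | PMul e1 e2 => PAdd (PMul (dd Y X e1) e2) (PMul e1 (dd Y X e2))
  | PScale c e1 => PScale c (dd Y X e1)
  end.

Lemma pev_dd Y X e A : A \in unitmx ->
  pev (dd Y X e) A = pdir e A (Y *m A + A *m X).
Proof.
move=> uA; elim: e => [d|i j|i j|e1 ih1 e2 ih2|e1 ih1 e2 ih2|d e ih] //=.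
- rewrite !pev_sum /= !mxE; congr (_ + _); apply: eq_bigr => k _ //.
  by rewrite mulrC.
- rewrite mulmxDr mulmxDl mulmxA (mulmxA (invmx A) A) mulVmx // mul1mx.
  rewrite -!mulmxA mulmxV // mulmx1 !pev_sum /= mxE opprD; congr (_ + _).
    by rewrite mxE -sumrN; apply: eq_bigr => k _; rewrite mulNr mulrC.
  by rewrite mxE -sumrN; apply: eq_bigr => k _; rewrite mulNr.
- by rewrite ih1 ih2.
- by rewrite ih1 ih2.
- by rewrite ih.
Qed.

(** Equality as functions on GL_N. Since [pdir] and [dd] are defined on syntax, their compatibility
    with it has to be proved ([pdir_unique], [eqv_dd]). *)
Definition eqv e1 e2 := forall A, A \in unitmx -> pev e1 A = pev e2 A.

Lemma eqv_sym e1 e2 : eqv e1 e2 -> eqv e2 e1.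
Proof. by move=> h A uA; rewrite h. Qed.

Lemma eqv_trans e2 e1 e3 : eqv e1 e2 -> eqv e2 e3 -> eqv e1 e3.
Proof. by move=> h h' A uA; rewrite h // h'. Qed.

(* Substitution: [S'] must stand for the inverse of [S]. *)
Fixpoint psub (S S' : 'I_N -> 'I_N -> rexp) e : rexp :=
  match e with
  | PC c => PC c
  | PX i j => S i j
  | PV i j => S' i j
  | PAdd e1 e2 => PAdd (psub S S' e1) (psub S S' e2)
  | PMul e1 e2 => PMul (psub S S' e1) (psub S S' e2)
  | PScale c e1 => PScale c (psub S S' e1)
  end.

Definition mev (m n : nat) (S : 'I_m -> 'I_n -> rexp) A : 'M[C]_(m, n) :=
  \matrix_(i, j) pev (S i j) A.
Definition mdir (m n : nat) (S : 'I_m -> 'I_n -> rexp) A V : 'M[C]_(m, n) :=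
  \matrix_(i, j) pdir (S i j) A V.

Definition mulE (m n p : nat) (S : 'I_m -> 'I_n -> rexp)
    (T : 'I_n -> 'I_p -> rexp) i j : rexp :=
  psum (index_enum 'I_n) (fun k => PMul (S i k) (T k j)).
Definition cstE (m n : nat) (M : 'M[C]_(m, n)) i j : rexp := PC (M i j).

Lemma mev_mul m n p (S : 'I_m -> 'I_n -> rexp) (T : 'I_n -> 'I_p -> rexp) A :
  mev (mulE S T) A = mev S A *m mev T A.
Proof.
by apply/matrixP => i j; rewrite !mxE pev_sum; apply: eq_bigr => k _; rewrite !mxE.
Qed.

Lemma mdir_mul m n p (S : 'I_m -> 'I_n -> rexp) (T : 'I_n -> 'I_p -> rexp) A V :
  mdir (mulE S T) A V = mdir S A V *m mev T A + mev S A *m mdir T A V.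
Proof.
apply/matrixP => i j; rewrite !mxE pdir_sum -big_split.
by apply: eq_bigr => k _; rewrite !mxE.
Qed.

Lemma mev_cst m n (M : 'M[C]_(m, n)) A : mev (cstE M) A = M.
Proof. by apply/matrixP => i j; rewrite mxE. Qed.

Lemma mdir_cst m n (M : 'M[C]_(m, n)) A V : mdir (cstE M) A V = 0.
Proof. by apply/matrixP => i j; rewrite !mxE. Qed.

Lemma mev_X A : mev PX A = A.
Proof. by apply/matrixP => i j; rewrite mxE. Qed.
Lemma mev_V A : mev PV A = invmx A.
Proof. by apply/matrixP => i j; rewrite mxE. Qed.
Lemma mdir_X A V : mdir PX A V = V.
Proof. by apply/matrixP => i j; rewrite mxE. Qed.
Lemma mdir_V A V : mdir PV A V = - (invmx A *m V *m invmx A).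
Proof. by apply/matrixP => i j; rewrite [LHS]mxE [RHS]mxE. Qed.

Definition mevE := (mev_mul, mev_cst, mev_X, mev_V).
Definition mdirE := (mdir_mul, mdir_cst, mdir_X, mdir_V, mevE).

Lemma pev_sub S S' e A : mev S' A = invmx (mev S A) ->
  pev (psub S S' e) A = pev e (mev S A).
Proof.
move=> hS; elim: e => [d|i j|i j|e1 ih1 e2 ih2|e1 ih1 e2 ih2|d e ih] //=.
- by rewrite mxE.
- by rewrite -hS mxE.
- by rewrite ih1 ih2.
- by rewrite ih1 ih2.
- by rewrite ih.
Qed.

(** Chain rule; the hypothesis on [mdir S'] is what differentiating the inverse of [S] must give. *)
Lemma pdir_sub S S' e A V : mev S' A = invmx (mev S A) ->
  mdir S' A V = - (mev S' A *m mdir S A V *m mev S' A) ->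
  pdir (psub S S' e) A V = pdir e (mev S A) (mdir S A V).
Proof.
move=> hS hd; elim: e => [d|i j|i j|e1 ih1 e2 ih2|e1 ih1 e2 ih2|d e ih] //=.
- by rewrite mxE.
- by rewrite -hS; move/matrixP: hd => /(_ i j); rewrite !mxE => ->.
- by rewrite ih1 ih2.
- by rewrite ih1 ih2 !pev_sub.
- by rewrite ih.
Qed.

(* The expression of [A |-> e (g *m A *m k)]. *)
Definition ptrans g k : rexp -> rexp :=
  psub (mulE (mulE (cstE g) PX) (cstE k))
       (mulE (mulE (cstE (invmx k)) PV) (cstE (invmx g))).

Lemma invmxM (g k : 'M[C]_N) : g \in unitmx -> k \in unitmx ->
  invmx (g *m k) = invmx k *m invmx g.
Proof.
move=> ug uk; have ugk : g *m k \in unitmx by rewrite unitmx_mul ug.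
apply: (@row_full_inj _ _ _ _ (g *m k)); first by rewrite row_full_unit.
by rewrite mulmxV // mulmxA -(mulmxA g) mulmxV // mulmx1 mulmxV.
Qed.

Lemma pev_trans g k e A : g \in unitmx -> k \in unitmx -> A \in unitmx ->
  pev (ptrans g k e) A = pev e (g *m A *m k).
Proof.
move=> ug uk uA; rewrite pev_sub ?mevE //.
by rewrite !invmxM ?unitmx_mul ?ug ?uA // mulmxA.
Qed.

Lemma pdir_trans g k e A V : g \in unitmx -> k \in unitmx -> A \in unitmx ->
  pdir (ptrans g k e) A V = pdir e (g *m A *m k) (g *m V *m k).
Proof.
move=> ug uk uA; rewrite pdir_sub ?mdirE ?mulmx0 ?mul0mx ?addr0 ?add0r //.
  by rewrite !invmxM ?unitmx_mul ?ug ?uA // mulmxA.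
rewrite !mulmxA !mulmxN !mulNmx !mulmxA; congr (- _).
by rewrite mulmxKV // -!mulmxA (mulmxA k) mulmxV // mul1mx.
Qed.

End RegularExpressions.

Arguments PX {C N}.
Arguments PV {C N}.
Arguments PC {C N}.
Arguments cstE {C N m n}.

(** * Entrywise norm and invertibility near an invertible matrix *)

Section MatrixNorm.
Variable C : numFieldType.

Definition nrm (m n : nat) (A : 'M[C]_(m, n)) : C := \sum_i \sum_j `|A i j|.

Lemma nrm_ge0 m n (A : 'M[C]_(m, n)) : 0 <= nrm A.
Proof. by apply: sumr_ge0 => i _; apply: sumr_ge0 => j _. Qed.

Lemma entry_le_nrm m n (A : 'M[C]_(m, n)) i j : `|A i j| <= nrm A.
Proof.
rewrite /nrm (bigD1 i) //= (bigD1 j) //= -addrA lerDl.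
by rewrite addr_ge0 ?sumr_ge0 // => k _; rewrite sumr_ge0.
Qed.

Lemma nrm_eq0 m n (A : 'M[C]_(m, n)) : nrm A = 0 -> A = 0.
Proof.
move=> h; apply/matrixP => i j; rewrite mxE; apply/normr0_eq0/le_anti.
by rewrite -{1}h entry_le_nrm normr_ge0.
Qed.

Lemma nrmD m n (A B : 'M[C]_(m, n)) : nrm (A + B) <= nrm A + nrm B.
Proof.
rewrite /nrm -big_split; apply: ler_sum => i _; rewrite -big_split.
by apply: ler_sum => j _; rewrite mxE ler_normD.
Qed.

Lemma nrmZ m n c (A : 'M[C]_(m, n)) : nrm (c *: A) = `|c| * nrm A.
Proof.
rewrite /nrm mulr_sumr; apply: eq_bigr => i _; rewrite mulr_sumr.
by apply: eq_bigr => j _; rewrite mxE normrM.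
Qed.

Lemma nrmN m n (A : 'M[C]_(m, n)) : nrm (- A) = nrm A.
Proof. by rewrite -scaleN1r nrmZ normrN1 mul1r. Qed.

Lemma nrm0 m n : nrm (0 : 'M[C]_(m, n)) = 0.
Proof. by rewrite -(scale0r 0) nrmZ normr0 mul0r. Qed.

Lemma nrm_sum m n (I : Type) (s : seq I) (F : I -> 'M[C]_(m, n)) :
  nrm (\sum_(i <- s) F i) <= \sum_(i <- s) nrm (F i).
Proof.
elim: s => [|i s ih]; first by rewrite !big_nil nrm0.
by rewrite !big_cons (le_trans (nrmD _ _)) // lerD2l.
Qed.

Lemma nrmM m n p (A : 'M[C]_(m, n)) (B : 'M[C]_(n, p)) :
  nrm (A *m B) <= nrm A * nrm B.
Proof.
have le_row (k : 'I_n) : \sum_j `|B k j| <= nrm B.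
  rewrite /nrm (bigD1 k) //= lerDl sumr_ge0 // => l _; exact: sumr_ge0.
rewrite {2}/nrm mulr_suml; apply: ler_sum => i _; rewrite mulr_suml.
apply: (@le_trans _ _ (\sum_j \sum_k `|A i k| * `|B k j|)).
  apply: ler_sum => j _; rewrite mxE (le_trans (ler_norm_sum _ _ _)) //.
  by apply: ler_sum => k _; rewrite normrM.
rewrite exchange_big; apply: ler_sum => k _ /=.
by rewrite -mulr_sumr ler_wpM2l.
Qed.

(** When [nrm (invmx A) * nrm V] is at most 1/2, a term [x *m V *m invmx A] costs at most half of
    [nrm x] and is absorbed. This is applied to the kernel of [A + V], then to its inverse. *)
Lemma unitmx_near n (A V : 'M[C]_n) : A \in unitmx ->
  2 * nrm (invmx A) * nrm V <= 1 ->
  A + V \in unitmx /\ nrm (invmx (A + V)) <= 2 * nrm (invmx A).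
Proof.
move=> uA hV; have half0 m (x : 'M[C]_(m, n)) a : nrm x <= a + nrm (x *m V *m invmx A) ->
    nrm x <= 2 * a.
  move=> h; have : nrm (x *m V *m invmx A) <= nrm x * nrm V * nrm (invmx A).
    by rewrite (le_trans (nrmM _ _)) // ler_wpM2r ?nrm_ge0 // nrmM.
  have -> : nrm x * nrm V * nrm (invmx A) = nrm x * (2 * nrm (invmx A) * nrm V) / 2.
    by field.
  move=> h'; have := ler_wpM2l (nrm_ge0 x) hV; rewrite mulr1 => h2.
  have {}h2 : nrm x * (2 * nrm (invmx A) * nrm V) / 2 <= nrm x / 2.
    by rewrite ler_pM2r ?invr_gt0 ?ltr0n.
  have h3 : nrm x - nrm x / 2 <= a.
    by rewrite lerBlDr (le_trans h) // lerD2l (le_trans h').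
  have : 2 * (nrm x - nrm x / 2) <= 2 * a by rewrite ler_pM2l ?ltr0n.
  by have -> : 2 * (nrm x - nrm x / 2) = nrm x by field.
have uAV : A + V \in unitmx.
  rewrite -row_free_unit -kermx_eq0; apply/eqP/nrm_eq0/le_anti.
  rewrite nrm_ge0 andbT -[X in _ <= X](mulr0 2); apply: half0; rewrite add0r.
  have := mulmx_ker (A + V); rewrite mulmxDr => /eqP.
  rewrite addrC addr_eq0 => /eqP ->.
  by rewrite mulNmx nrmN mulmxK.
split=> //; apply: half0.
have -> : nrm (invmx A) = nrm (invmx (A + V) *m (A + V) *m invmx A).
  by rewrite mulVmx // mul1mx.
rewrite mulmxDr mulmxDl mulmxK //.
rewrite -{1}(addrK (invmx (A + V) *m V *m invmx A) (invmx (A + V))).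
by rewrite (le_trans (nrmD _ _)) // nrmN.
Qed.

(** * First-order Taylor expansion of regular functions *)

Section Taylor.
Variable N : nat.
Implicit Types (e : rexp C N) (A V : 'M[C]_N).

(** One constant serves as inverse radius, bound of the differential and bound of the quadratic
    remainder. It may be enlarged freely, which lets the bounds of subexpressions be combined. *)
Definition taylor_bound e A M :=
  [/\ 0 <= M, A \in unitmx & forall V, M * nrm V <= 1 ->
    [/\ A + V \in unitmx, nrm V <= 1, `|pdir e A V| <= M * nrm V
      & `|pev e (A + V) - pev e A - pdir e A V| <= M * nrm V ^+ 2]].

Lemma taylor_bound_le e A M M' : M <= M' -> taylor_bound e A M -> taylor_bound e A M'.
Proof.
move=> le_M [M0 uA h]; split=> [|//|V hV]; first exact: le_trans le_M.
have [|uV V1 h1 h2] := h V; first by apply: le_trans hV; rewrite ler_wpM2r ?nrm_ge0.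
split=> //; [apply: le_trans h1 _|apply: le_trans h2 _].
  by rewrite ler_wpM2r ?nrm_ge0.
by rewrite ler_wpM2r ?exprn_ge0 ?nrm_ge0.
Qed.

Lemma taylor e A : A \in unitmx -> exists M, taylor_bound e A M.
Proof.
move=> uA; pose i0 := 2 * nrm (invmx A) + 1.
have i0_ge0 : 0 <= i0 by rewrite addr_ge0 ?mulr_ge0 ?nrm_ge0.
have i0P M V : 0 <= M -> (i0 + M) * nrm V <= 1 ->
    [/\ A + V \in unitmx, nrm (invmx (A + V)) <= 2 * nrm (invmx A) & nrm V <= 1].
  move=> M0 h.
  have [||u1 h1] := @unitmx_near N A V => //.
    by rewrite (le_trans _ h) // ler_wpM2r ?nrm_ge0 // -addrA lerDl addr_ge0.
  split=> //; rewrite (le_trans _ h) // -[X in X <= _]mul1r ler_wpM2r ?nrm_ge0 //.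
  by rewrite /i0 -addrA addrCA lerDl addr_ge0 ?mulr_ge0 ?nrm_ge0.
have leaf M e0 : 0 <= M ->
    (forall V, A + V \in unitmx -> nrm (invmx (A + V)) <= 2 * nrm (invmx A) ->
       `|pdir e0 A V| <= M * nrm V
       /\ `|pev e0 (A + V) - pev e0 A - pdir e0 A V| <= M * nrm V ^+ 2) ->
    taylor_bound e0 A (i0 + M).
  move=> M0 h; split=> [|//|V hV]; first exact: addr_ge0.
  have [u1 n1 V1] := i0P _ _ M0 hV; have [h1 h2] := h V u1 n1.
  split=> //; [apply: le_trans h1 _|apply: le_trans h2 _].
    by rewrite ler_wpM2r ?nrm_ge0 // lerDr.
  by rewrite ler_wpM2r ?exprn_ge0 ?nrm_ge0 // lerDr.
elim: e => [d|i j|i j|e1 [M1 h1] e2 [M2 h2]|e1 [M1 h1] e2 [M2 h2]|d e [M h]].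
- exists (i0 + 0); apply: leaf => // V _ _ /=.
  by rewrite !subrr normr0 !mul0r lexx.
- exists (i0 + 1); apply: leaf => // V _ _ /=; rewrite mul1r mxE.
  rewrite entry_le_nrm; split=> //.
  by rewrite [_ + V i j]addrC addrK subrr normr0 mul1r exprn_ge0 ?nrm_ge0.
- pose q := nrm (invmx A).
  have q0 : 0 <= q := nrm_ge0 _.
  exists (i0 + (q ^+ 2 + 2 * q ^+ 3)); apply: leaf => [|V u1 n1] /=.
    by rewrite addr_ge0 ?mulr_ge0 ?exprn_ge0.
  split.
    rewrite normrN (le_trans (entry_le_nrm _ _ _)) //.
    apply: le_trans (nrmM _ _) _; apply: le_trans (ler_wpM2r (nrm_ge0 _) (nrmM _ _)) _.
    have -> : nrm (invmx A) * nrm V * nrm (invmx A) = q ^+ 2 * nrm V by rewrite /q; ring.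
    by rewrite ler_wpM2r ?nrm_ge0 // lerDl mulr_ge0 ?exprn_ge0.
  set W := invmx (A + V).
  have eW : W = invmx A - invmx A *m V *m W.
    have : invmx A *m ((A + V) *m W) = invmx A by rewrite mulmxV // mulmx1.
    by rewrite mulmxDl mulmxDr !mulmxA mulVmx // mul1mx => /(canRL (addrK _)).
  have tW : invmx A *m V *m W = invmx A - W by move/eqP: eW; rewrite eq_sym subr_eq addrC -subr_eq => /eqP <-.
  (* The first-order remainder of the inverse is exactly A^-1 V A^-1 V (A + V)^-1, visibly quadratic
     in [V]. *)
  have -> : W i j - invmx A i j - - (invmx A *m V *m invmx A) i j =
      (invmx A *m V *m invmx A *m V *m W) i j.
    rewrite -(mulmxA _ (invmx A)) -(mulmxA _ _ W) tW mulmxBr tW.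
    have mxB (P Q : 'M[C]_N) : (P - Q) i j = P i j - Q i j by rewrite !mxE.
    by rewrite !mxB; ring.
  rewrite (le_trans (entry_le_nrm _ _ _)) //.
  apply: (@le_trans _ _ (q * nrm V * q * nrm V * (2 * q))).
    do 4 (apply: (le_trans (nrmM _ _)); apply: ler_pM; rewrite ?nrm_ge0 //).
  have -> : q * nrm V * q * nrm V * (2 * q) = 2 * q ^+ 3 * nrm V ^+ 2 by ring.
  by rewrite ler_wpM2r ?exprn_ge0 ?nrm_ge0 // lerDr exprn_ge0.
- case: h1 => M1_ge0 _ h1; case: h2 => M2_ge0 _ h2.
  exists (M1 + M2); split=> [|//|V hV]; first exact: addr_ge0.
  have t0 := nrm_ge0 V.
  have [|uV V1 a1 b1] := h1 V.
    by rewrite (le_trans _ hV) // ler_wpM2r // lerDl.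
  have [|_ _ a2 b2] := h2 V.
    by rewrite (le_trans _ hV) // ler_wpM2r // lerDr.
  split=> //=; rewrite mulrDl; first by rewrite (le_trans (ler_normD _ _)) // lerD.
  rewrite [X in `|X|](_ : _ = (pev e1 (A + V) - pev e1 A - pdir e1 A V) +
    (pev e2 (A + V) - pev e2 A - pdir e2 A V)); last by ring.
  by rewrite (le_trans (ler_normD _ _)) // lerD.
- case: h1 => M1_ge0 _ h1; case: h2 => M2_ge0 _ h2.
  pose x1 := `|pev e1 A|; pose x2 := `|pev e2 A|.
  have x1_ge0 : 0 <= x1 := normr_ge0 _; have x2_ge0 : 0 <= x2 := normr_ge0 _.
  pose K1 := M1 * x2 + x1 * M2; pose K2 := M1 * M2 + x1 * M2 + M2 + M1 * (x2 + 2).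
  have K1_ge0 : 0 <= K1 by rewrite addr_ge0 ?mulr_ge0.
  have K2_ge0 : 0 <= K2 by rewrite ?(addr_ge0, mulr_ge0).
  have M_ge0 := addr_ge0 M1_ge0 M2_ge0; have K_ge0 := addr_ge0 K1_ge0 K2_ge0.
  exists (M1 + M2 + (K1 + K2)); split=> [|//|V hV]; first exact: addr_ge0.
  have t0 := nrm_ge0 V; set t := nrm V in hV t0 *.
  have [l1 l2] : M1 * t <= 1 /\ M2 * t <= 1.
    split; apply: le_trans hV; rewrite ler_wpM2r // -addrA.
      by rewrite lerDl (addr_ge0 M2_ge0 K_ge0).
    by rewrite addrCA lerDl (addr_ge0 M1_ge0 K_ge0).
  have [//|uV V1 a1 b1] := h1 V; have [//|_ _ a2 b2] := h2 V.
  rewrite -/t in V1 a1 a2 b1 b2 *.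
  set d1 := pdir e1 A V in a1 b1 *; set d2 := pdir e2 A V in a2 b2 *.
  set r1 := pev e1 (A + V) - _ - _ in b1; set r2 := pev e2 (A + V) - _ - _ in b2.
  split=> //=; rewrite -/d1 -/d2.
    apply: (@le_trans _ _ (K1 * t)); last first.
      by rewrite ler_wpM2r // addrCA lerDl (addr_ge0 M_ge0 K2_ge0).
    rewrite (le_trans (ler_normD _ _)) // !normrM /K1 mulrDl lerD //.
      by rewrite mulrAC ler_wpM2r.
    by rewrite -mulrA ler_wpM2l.
  apply: (@le_trans _ _ (K2 * t ^+ 2)); last first.
    by rewrite ler_wpM2r ?exprn_ge0 // addrA lerDr (addr_ge0 M_ge0 K1_ge0).
  have -> : pev e1 (A + V) * pev e2 (A + V) - pev e1 A * pev e2 A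
      - (d1 * pev e2 A + pev e1 A * d2) =
      d1 * d2 + pev e1 A * r2 + d1 * r2 + r1 * (pev e2 A + (d2 + r2)).
    by rewrite /r1 /r2; ring.
  have Mt2 : M2 * t ^+ 2 <= 1.
    apply: le_trans l2; rewrite expr2 mulrA -[X in _ <= X]mulr1 ler_wpM2l //.
    exact: mulr_ge0.
  rewrite (_ : K2 * t ^+ 2 = M1 * M2 * t ^+ 2 + x1 * M2 * t ^+ 2 + M2 * t ^+ 2
    + M1 * (x2 + 2) * t ^+ 2); last by rewrite /K2; ring.
  rewrite (le_trans (ler_normD _ _)) // lerD //.
    rewrite (le_trans (ler_normD _ _)) // lerD //.
      rewrite (le_trans (ler_normD _ _)) // lerD //.
        rewrite normrM expr2 mulrACA ler_pM //.
      by rewrite normrM -mulrA ler_wpM2l.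
    rewrite normrM -[X in _ <= X]mul1r ler_pM //.
    exact: le_trans l1.
  rewrite normrM mulrAC ler_pM //.
  rewrite (le_trans (ler_normD _ _)) // lerD2l (le_trans (ler_normD _ _)) //.
  by rewrite -[2]/(1 + 1) lerD ?(le_trans a2 l2) ?(le_trans b2 Mt2).
- case: h => M_ge0 _ h; exists (M + `|d| * M); split=> [|//|V hV].
    by rewrite addr_ge0 ?mulr_ge0.
  have t0 := nrm_ge0 V.
  have [|uV V1 a b] := h V.
    by rewrite (le_trans _ hV) // ler_wpM2r // lerDl mulr_ge0.
  split=> //=; rewrite ?mulrDl -?mulrBr normrM -?(mulrA `|d|).
    by rewrite ler_wpDl ?mulr_ge0 // ler_wpM2l.
  by rewrite ler_wpDl ?mulr_ge0 ?exprn_ge0 // ler_wpM2l.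
Qed.

(* Two regular functions that agree near a point have the same differential there. *)
Lemma pdir_unique e1 e2 A V : eqv e1 e2 -> A \in unitmx ->
  pdir e1 A V = pdir e2 A V.
Proof.
move=> e12 uA; apply/eqP; rewrite -subr_eq0; apply/eqP.
have [M1 [M1_ge0 _ h1]] := taylor e1 uA; have [M2 [M2_ge0 _ h2]] := taylor e2 uA.
set d := _ - _; pose v := nrm V; have v_ge0 : 0 <= v := nrm_ge0 V.
pose K := (M1 + M2) * (v ^+ 2 + v); have M_ge0 := addr_ge0 M1_ge0 M2_ge0.
have K_ge0 : 0 <= K by rewrite mulr_ge0 ?addr_ge0 ?exprn_ge0.
have key (t : C) : 0 < t -> K * t <= 1 -> `|d| <= K * t.
  move=> t0 Kt; have nt : nrm (t *: V) = t * v by rewrite nrmZ gtr0_norm.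
  have Kt' : (M1 + M2) * nrm (t *: V) <= 1.
    apply: le_trans Kt; rewrite nt /K mulrCA (mulrC t).
    by rewrite ler_pM2r // ler_wpM2l // lerDr exprn_ge0.
  have [|uV _ _ b1] := h1 (t *: V).
    by apply: le_trans Kt'; rewrite ler_wpM2r ?nrm_ge0 // lerDl.
  have [|_ _ _ b2] := h2 (t *: V).
    by apply: le_trans Kt'; rewrite ler_wpM2r ?nrm_ge0 // lerDr.
  have dE : t * d = (pev e2 (A + t *: V) - pev e2 A - pdir e2 A (t *: V))
      - (pev e1 (A + t *: V) - pev e1 A - pdir e1 A (t *: V)).
    by rewrite !e12 // !pdirZ /d; ring.
  have : `|t * d| <= (M1 + M2) * nrm (t *: V) ^+ 2.
    by rewrite dE (le_trans (ler_normB _ _)) // addrC mulrDl lerD.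
  rewrite normrM gtr0_norm // nt => h.
  rewrite -(ler_pM2l t0) (le_trans h) // /K.
  have -> : t * ((M1 + M2) * (v ^+ 2 + v) * t) =
     (M1 + M2) * (t * v) ^+ 2 + (M1 + M2) * v * t ^+ 2 by ring.
  by rewrite lerDl !mulr_ge0 ?exprn_ge0 // ltW.
apply/normr0_eq0/eqP; rewrite eq_le normr_ge0 andbT.
have K1 : 0 < K + 1 by rewrite ltr_wpDl.
case: (eqVneq `|d| 0) => [->//|d0].
have {}d0 : 0 < `|d| by rewrite lt_neqAle eq_sym d0 normr_ge0.
have D0 : 0 < `|d| + 2 by rewrite addr_gt0.
(* This value of t makes K t at most 1, as [key] requires, and also at most [|d| / 2], so that [key]
   yields [|d| <= |d| / 2]. *)
have t0 : 0 < `|d| / ((K + 1) * (`|d| + 2)) by rewrite divr_gt0 ?mulr_gt0.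
have := key _ t0.
have -> : K * (`|d| / ((K + 1) * (`|d| + 2))) = K / (K + 1) * (`|d| / (`|d| + 2)).
  by field; rewrite !gt_eqF.
have k1 : K / (K + 1) <= 1 by rewrite ler_pdivrMr // mul1r lerDl.
have k0 : 0 <= K / (K + 1) by rewrite divr_ge0 // ltW.
have d1 : `|d| / (`|d| + 2) <= 1 by rewrite ler_pdivrMr // mul1r lerDl.
have d2 : `|d| / (`|d| + 2) <= `|d| / 2.
  by rewrite ler_pM2l // lef_pV2 ?posrE // lerDr ltW.
have d3 : 0 <= `|d| / (`|d| + 2) by rewrite divr_ge0 ?ltW.
move=> /(_ (mulr_ile1 k0 d3 k1 d1)) h.
have {}h : `|d| <= `|d| / 2.
  rewrite (le_trans h) // (le_trans _ d2) // -[X in _ <= X]mul1r.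
  by rewrite ler_wpM2r.
have : `|d| - `|d| / 2 <= 0 by rewrite subr_le0.
have -> : `|d| - `|d| / 2 = `|d| / 2 by field.
by rewrite pmulr_lle0 // invr_gt0.
Qed.

Lemma eqv_dd Y X e1 e2 : eqv e1 e2 -> eqv (dd Y X e1) (dd Y X e2).
Proof. by move=> e12 A uA; rewrite !pev_dd //; apply: pdir_unique. Qed.

End Taylor.
End MatrixNorm.

(** * Brackets of left- and right-invariant vector fields *)

Section Commutators.
Variables (C : fieldType) (N : nat).
Implicit Types (e : rexp C N) (A V X Y Z : 'M[C]_N).

Lemma mdir_ddX Y X A V : mdir (fun i j => dd Y X (PX i j)) A V = Y *m V + V *m X.
Proof.
apply/matrixP => i j; rewrite !mxE /= !pdir_sum /=; congr (_ + _).
by apply: eq_bigr => k _; rewrite mulrC.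
Qed.

Lemma mdir_ddV Y X A V : mdir (fun i j => dd Y X (PV i j)) A V =
  invmx A *m V *m invmx A *m Y + X *m (invmx A *m V *m invmx A).
Proof.
apply/matrixP => i j; rewrite [LHS]mxE [RHS]mxE /= !pdir_sum /=; congr (_ + _).
  by rewrite mxE; apply: eq_bigr => k _; rewrite mulrNN mulrC.
by rewrite mxE; apply: eq_bigr => k _; rewrite mulrNN.
Qed.

(* The fields [A |-> Y *m A + A *m X] bracket like [Y] on the left, with the
   opposite sign, and like [X] on the right. *)
Lemma dd_comm Y X Y' X' e A : A \in unitmx ->
  pev (dd Y X (dd Y' X' e)) A =
  pev (dd Y' X' (dd Y X e)) A + pev (dd (Y' *m Y - Y *m Y') (X *m X' - X' *m X) e) A.
Proof.
move=> uA; have invV (U W : 'M[C]_N) : invmx A *m (U *m A + A *m W) *m invmx A =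
    invmx A *m U + W *m invmx A.
  by rewrite mulmxDr mulmxDl !mulmxA mulmxK // mulVmx // mul1mx.
have mxD (P Q : 'M[C]_N) i j : P i j + Q i j = (P + Q) i j by rewrite mxE.
have mxN (P : 'M[C]_N) i j : - P i j = (- P) i j by rewrite mxE.
elim: e => [d|i j|i j|e1 ih1 e2 ih2|e1 ih1 e2 ih2|d e ih].
- by rewrite /= addr0.
- have E (U W U' W' : 'M[C]_N) : pev (dd U W (dd U' W' (PX i j))) A =
      (U' *m (U *m A + A *m W) + (U *m A + A *m W) *m W') i j.
    by rewrite pev_dd //; move/matrixP: (mdir_ddX U' W' A (U *m A + A *m W)) =>
      /(_ i j); rewrite mxE.
  rewrite !E pev_dd //= mxD; congr (fun_of_matrix _ i j).
  rewrite !(mulmxDr, mulmxDl, mulmxN, mulNmx, mulmxA).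
  move: (Y' *m Y *m A) (Y' *m A *m X) (Y *m A *m X') (A *m X *m X').
  move: (Y *m Y' *m A) (A *m X' *m X) => a b c d f k.
  by apply/matrixP => l m; rewrite !mxE; ring.
- have E (U W U' W' : 'M[C]_N) : pev (dd U W (dd U' W' (PV i j))) A =
      ((invmx A *m U + W *m invmx A) *m U' + W' *m (invmx A *m U + W *m invmx A)) i j.
    rewrite pev_dd //; move/matrixP: (mdir_ddV U' W' A (U *m A + A *m W)) =>
      /(_ i j); rewrite mxE => ->; by rewrite invV.
  rewrite !E pev_dd //= invV mxN mxD; congr (fun_of_matrix _ i j).
  rewrite !(mulmxDr, mulmxDl, mulmxN, mulNmx, mulmxA).
  move: (invmx A *m Y *m Y') (X *m invmx A *m Y') (X' *m invmx A *m Y).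
  move: (invmx A *m Y' *m Y) (X *m X' *m invmx A) (X' *m X *m invmx A) => a b c d f k.
  by apply/matrixP => l m; rewrite !mxE; ring.
- by rewrite /= ih1 ih2; ring.
- by rewrite /= ih1 ih2; ring.
- by rewrite /= ih; ring.
Qed.

End Commutators.

(** * Zariski closed subgroups of GL_N and their Lie algebras *)

Section AlgebraicGroups.
Variables (C : numFieldType) (N : nat) (Gs : 'M[C]_N -> Prop).
Implicit Types (e : rexp C N) (g X Y Z : 'M[C]_N).

Definition vanish e := forall g, Gs g -> pev e g = 0.

(** The Zariski tangent space at 1, with the ideal taken in the whole coordinate ring of GL_N rather
    than in the polynomial ring; [lie_lieA] compares it with [lie]. *)
Definition lieA X := forall e, vanish e -> pdir e 1%:M X = 0.

Record alg_group : Prop := AlgGroup {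
  ag_unit : forall g, Gs g -> g \in unitmx;
  ag_one : Gs 1%:M;
  ag_mul : forall g k, Gs g -> Gs k -> Gs (g *m k);
  ag_inv : forall g, Gs g -> Gs (invmx g);
  ag_closed : forall g, g \in unitmx -> (forall e, vanish e -> pev e g = 0) -> Gs g }.

Hypothesis GsG : alg_group.

Let Gu := ag_unit GsG.
Let G1 := ag_one GsG.

Lemma lieA0 : lieA 0. Proof. by move=> e _; rewrite pdir0. Qed.
Lemma lieAD X Y : lieA X -> lieA Y -> lieA (X + Y).
Proof. by move=> hX hY e he; rewrite pdirD hX ?hY ?addr0. Qed.
Lemma lieAZ c X : lieA X -> lieA (c *: X).
Proof. by move=> hX e he; rewrite pdirZ hX ?mulr0. Qed.
Lemma lieAN X : lieA X -> lieA (- X).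
Proof. by move=> hX; rewrite -scaleN1r; apply: lieAZ. Qed.
Lemma lieA_sum I (s : seq I) (P : pred I) (F : I -> 'M[C]_N) :
  (forall i, P i -> lieA (F i)) -> lieA (\sum_(i <- s | P i) F i).
Proof. by move=> h; apply: big_ind => //; [exact: lieA0|exact: lieAD]. Qed.

Lemma vanish_trans g k e : Gs g -> Gs k -> vanish e -> vanish (ptrans g k e).
Proof.
move=> gG kG he x xG; rewrite pev_trans ?Gu // he //.
by do 2! (apply: (ag_mul GsG) => //).
Qed.

Lemma vanish_pdir e g X : vanish e -> Gs g -> lieA X -> pdir e g (g *m X) = 0.
Proof.
move=> he gG hX; have := hX _ (vanish_trans gG G1 he).
by rewrite pdir_trans ?Gu ?unitmx1 // !mulmx1.
Qed.

Lemma vanish_L X e : lieA X -> vanish e -> vanish (dd 0 X e).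
Proof. by move=> hX he g gG; rewrite pev_dd ?Gu // mul0mx add0r vanish_pdir. Qed.

(** The left-invariant derivations of elements of the Lie algebra preserve the vanishing ideal,
    hence so does their commutator, which by [dd_comm] is the derivation of the bracket. *)
Lemma lieA_bracket X Y : lieA X -> lieA Y -> lieA (X *m Y - Y *m X).
Proof.
move=> hX hY e he; have := dd_comm 0 X 0 Y e (unitmx1 C N).
rewrite !(vanish_L _ (vanish_L _ _)) // add0r pev_dd ?unitmx1 //.
by rewrite !mulmx0 subrr mul0mx add0r mul1mx => <-.
Qed.

Lemma lieA_Ad g X : Gs g -> lieA X -> lieA (g *m X *m invmx g).
Proof.
move=> gG hX e he; have := hX _ (vanish_trans gG (ag_inv GsG gG) he).
by rewrite pdir_trans ?unitmx_inv ?Gu ?unitmx1 // mulmx1 mulmxV // Gu.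
Qed.

(** Iterated left-invariant derivatives; the head of [s] is applied last. *)
Definition Lw (s : seq 'M[C]_N) e := foldr (fun X => dd 0 X) e s.

Lemma vanish_Lw s e : (forall X, X \in s -> lieA X) -> vanish e -> vanish (Lw s e).
Proof.
elim: s => //= X s ih hs he; apply: vanish_L; first by apply: hs; rewrite inE eqxx.
by apply: ih => // Y Ys; apply: hs; rewrite inE Ys orbT.
Qed.

Lemma vanish_iter m X e : lieA X -> vanish e -> vanish (iter m (dd 0 X) e).
Proof. by move=> hX he; elim: m => //= m ih; apply: vanish_L. Qed.

End AlgebraicGroups.

(** * Exponentials of nilpotent matrices as polynomial curves *)

Section PolynomialCurves.
Variables (C : numFieldType) (N : nat).
Implicit Types (e : rexp C N) (P Q : 'M[{poly C}]_N) (Z : 'M[C]_N).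

(** The restriction of [e] to the curve with entries [P]; [Q] stands for the inverse curve, which is
    also polynomial for the exponential of a nilpotent matrix. *)
Fixpoint ppol P Q e : {poly C} :=
  match e with
  | PC c => c%:P
  | PX i j => P i j
  | PV i j => Q i j
  | PAdd e1 e2 => ppol P Q e1 + ppol P Q e2
  | PMul e1 e2 => ppol P Q e1 * ppol P Q e2
  | PScale c e1 => c *: ppol P Q e1
  end.

Definition hmx (m n : nat) (z : C) (P : 'M[{poly C}]_(m, n)) : 'M[C]_(m, n) :=
  map_mx (horner^~ z) P.
Definition dmx (m n : nat) (P : 'M[{poly C}]_(m, n)) : 'M[{poly C}]_(m, n) :=
  map_mx (@deriv _) P.

Lemma ppol_horner P Q e z : hmx z Q = invmx (hmx z P) ->
  (ppol P Q e).[z] = pev e (hmx z P).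
Proof.
move=> h; elim: e => [d|i j|i j|e1 ih1 e2 ih2|e1 ih1 e2 ih2|d e ih] /=.
- by rewrite hornerC.
- by rewrite mxE.
- by rewrite -h mxE.
- by rewrite hornerD ih1 ih2.
- by rewrite hornerM ih1 ih2.
- by rewrite hornerZ ih.
Qed.

Lemma ppol_sum P Q I (s : seq I) F :
  ppol P Q (psum s F) = \sum_(i <- s) ppol P Q (F i).
Proof. by elim: s => [|i s ih] /=; rewrite ?big_nil ?big_cons ?ih. Qed.

Lemma ppol_deriv P Q Z e : dmx P = P *m map_mx polyC Z ->
  dmx Q = - (map_mx polyC Z *m Q) -> (ppol P Q e)^`() = ppol P Q (dd 0 Z e).
Proof.
move=> hP hQ; elim: e => [d|i j|i j|e1 ih1 e2 ih2|e1 ih1 e2 ih2|d e ih] /=.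
- by rewrite derivC.
- move/matrixP: hP => /(_ i j); rewrite !mxE !ppol_sum /= => ->.
  rewrite [X in _ = X + _]big1 ?add0r => [|k _]; last by rewrite mxE scale0r.
  by apply: eq_bigr => k _; rewrite mxE mulrC mul_polyC.
- move/matrixP: hQ => /(_ i j); rewrite !mxE !ppol_sum /= => ->.
  rewrite [X in _ = X + _]big1 ?add0r => [|k _]; last by rewrite mxE oppr0 scale0r.
  by rewrite -sumrN; apply: eq_bigr => k _; rewrite mxE mul_polyC scaleNr.
- by rewrite derivD ih1 ih2.
- by rewrite derivM ih1 ih2.
- by rewrite derivZ ih.
Qed.

Lemma poly_deriv0 (p : {poly C}) : p^`() = 0 -> p = (p.[0])%:P.
Proof.
move=> h; apply/polyP => i; rewrite coefC horner_coef0; case: i => [//|i].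
have := coef_deriv p i; rewrite h coef0 => /esym/eqP.
by rewrite mulrn_eq0 /= => /eqP ->.
Qed.

Lemma poly_derivn0 (p : {poly C}) : (forall m, p^`(m).[0] = 0) -> p = 0.
Proof.
move=> h; apply/polyP => i; have := h i.
rewrite horner_coef0 coef_derivn coef0 addn0 ffactnn => /eqP.
by rewrite mulrn_eq0 -[_ == 0%N]negbK -lt0n fact_gt0 => /eqP.
Qed.

Section Exponential.
Variables (M : nat) (Z : 'M[C]_N).
Hypothesis ZM : Z ^+ M.+1 = 0.

Definition expP (s : C) : 'M[{poly C}]_N :=
  \sum_(m < M.+1) (((s ^+ m) / m`!%:R) *: 'X^m) *: map_mx polyC (Z ^+ m).

Definition expm (z : C) : 'M[C]_N := \sum_(m < M.+1) (z ^+ m / m`!%:R) *: Z ^+ m.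

Lemma hmx_expP s z : hmx z (expP s) = expm (s * z).
Proof.
apply/matrixP => i j; rewrite mxE !summxE horner_sum.
apply: eq_bigr => m _; rewrite !mxE hornerM hornerC hornerZ hornerXn exprMn.
by congr (_ * _); rewrite mulrAC.
Qed.

Lemma dmx_expP s : dmx (expP s) = s%:P *: (expP s *m map_mx polyC Z).
Proof.
have -> : dmx (expP s) = \sum_(m < M.+1)
    ((s ^+ m / m`!%:R) *: ('X^(m.-1) *+ m)) *: map_mx polyC (Z ^+ m).
  apply/matrixP => i j; rewrite mxE !summxE raddf_sum; apply: eq_bigr => m _ /=.
  by rewrite !mxE derivM derivC mulr0 addr0 derivZ derivXn.
rewrite big_ord_recl /= mulr0n scaler0 scale0r add0r.
rewrite /expP big_ord_recr /= mulmxDl -scalemxAl -map_mxM -[_ *m Z]exprSr ZM.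
rewrite map_mx0 scaler0 addr0 mulmx_suml scaler_sumr; apply: eq_bigr => m _.
rewrite -scalemxAl -map_mxM -[_ *m Z]exprSr scalerA /bump /= add1n; congr (_ *: _).
rewrite -['X^_ *+ _]scaler_nat mul_polyC !scalerA add0n; congr (_ *: _).
rewrite factS natrM exprS.
field; have -> : 1 + m%:R = m.+1%:R :> C by rewrite mulrS.
by rewrite !pnatr_eq0 -lt0n fact_gt0.
Qed.

Lemma expm0 : expm 0 = 1%:M.
Proof.
rewrite /expm big_ord_recl expr0 fact0 divr1 scale1r.
by rewrite big1 ?addr0 // => i _; rewrite expr0n mul0r scale0r.
Qed.

Lemma dmxM (m n p : nat) (P : 'M[{poly C}]_(m, n)) (Q : 'M[{poly C}]_(n, p)) :
  dmx (P *m Q) = dmx P *m Q + P *m dmx Q.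
Proof.
apply/matrixP => i j; rewrite !mxE raddf_sum -big_split /=.
by apply: eq_bigr => k _; rewrite derivM !mxE.
Qed.

Lemma hmxM (m n p : nat) z (P : 'M[{poly C}]_(m, n)) (Q : 'M[{poly C}]_(n, p)) :
  hmx z (P *m Q) = hmx z P *m hmx z Q.
Proof.
apply/matrixP => i j; rewrite !mxE horner_sum.
by apply: eq_bigr => k _; rewrite hornerM !mxE.
Qed.

Lemma hmxC (m n : nat) z (A : 'M[C]_(m, n)) : hmx z (map_mx polyC A) = A.
Proof. by apply/matrixP => i j; rewrite !mxE hornerC. Qed.

Lemma dmxC (m n : nat) (A : 'M[C]_(m, n)) : dmx (map_mx polyC A) = 0.
Proof. by apply/matrixP => i j; rewrite !mxE derivC. Qed.

Lemma expP_comm s : map_mx polyC Z *m expP s = expP s *m map_mx polyC Z.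
Proof.
rewrite /expP mulmx_suml mulmx_sumr; apply: eq_bigr => m _.
by rewrite -scalemxAl -scalemxAr -!map_mxM -[Z *m _]exprS -[_ *m Z]exprSr.
Qed.

Lemma expm_mulN z : expm z *m expm (- z) = 1%:M.
Proof.
have dE : dmx (expP 1 *m expP (-1)) = 0.
  rewrite dmxM !dmx_expP polyCN polyC1 scale1r scaleN1r mulmxN -(expP_comm (-1)).
  by rewrite mulmxA subrr.
have cE := hmxM z (expP 1) (expP (-1)).
have c0 := hmxM 0 (expP 1) (expP (-1)).
rewrite !hmx_expP ?mul1r ?mulN1r in cE; rewrite -cE.
rewrite !hmx_expP ?mulr0 expm0 mulmx1 in c0; rewrite -c0.
apply/matrixP => i j; rewrite mxE [RHS]mxE.
rewrite [X in X.[z]]poly_deriv0 ?hornerC //.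
by move/matrixP: dE => /(_ i j); rewrite !mxE.
Qed.

Lemma expm_unit z : expm z \in unitmx.
Proof. by case/mulmx1_unit: (expm_mulN z). Qed.

Lemma invmx_expm z : invmx (expm z) = expm (- z).
Proof. by rewrite -[LHS]mulmx1 -(expm_mulN z) mulKmx // expm_unit. Qed.

(* Taylor's formula along the curve [g *m expm z], whose restriction of [e] is
   a polynomial in [z]. *)
Lemma pev_expm0 e (g : 'M[C]_N) : g \in unitmx ->
  (forall m, pev (iter m (dd 0 Z) e) g = 0) -> forall z, pev e (g *m expm z) = 0.
Proof.
move=> ug h z.
pose P := map_mx polyC g *m expP 1; pose Q := expP (-1) *m map_mx polyC (invmx g).
have PE w : hmx w P = g *m expm w by rewrite hmxM hmxC hmx_expP mul1r.
have QE w : hmx w Q = invmx (hmx w P).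
  by rewrite PE hmxM hmxC hmx_expP mulN1r invmxM ?expm_unit // invmx_expm.
have dP : dmx P = P *m map_mx polyC Z.
  by rewrite dmxM dmxC mul0mx add0r dmx_expP polyC1 scale1r mulmxA.
have dQ : dmx Q = - (map_mx polyC Z *m Q).
  rewrite dmxM dmxC mulmx0 addr0 dmx_expP polyCN polyC1 scaleN1r mulNmx.
  by rewrite -expP_comm mulmxA.
have dn m e' : (ppol P Q e')^`(m) = ppol P Q (iter m (dd 0 Z) e').
  by elim: m => [//|m ih]; rewrite derivnS ih (ppol_deriv _ dP dQ).
rewrite -PE -(ppol_horner e (QE z)) (@poly_derivn0 (ppol P Q e)) ?horner0 // => m.
by rewrite dn (ppol_horner _ (QE 0)) PE expm0 mulmx1.
Qed.

End Exponential.
End PolynomialCurves.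

(** * Polynomials in an operator, Chinese remainders and interpolation *)

Section Umbral.
Variable C : fieldType.
Implicit Types (c : nat -> C) (p q : {poly C}).

(* The linear functional ['X^i |-> c i]: it turns polynomial identities into
   identities for powers of an operator. *)
Definition umb c q : C := \sum_(i < size q) q`_i * c i.

Lemma umb_wide c q n : (size q <= n)%N -> umb c q = \sum_(i < n) q`_i * c i.
Proof.
move=> h; rewrite /umb (big_ord_widen n (fun i => q`_i * c i)) // big_mkcond /=.
by apply: eq_bigr => i _; case: ltnP => // hi; rewrite nth_default ?mul0r.
Qed.

Lemma umbD c p q : umb c (p + q) = umb c p + umb c q.
Proof.
pose n := maxn (size p) (size q).
rewrite !(@umb_wide c _ n) ?leq_maxl ?leq_maxr ?(leq_trans (size_polyD _ _)) //.
by rewrite -big_split; apply: eq_bigr => i _; rewrite coefD mulrDl.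
Qed.

Lemma umbZ c a q : umb c (a *: q) = a * umb c q.
Proof.
rewrite !(@umb_wide c _ (size q)) ?size_scale_leq // mulr_sumr.
by apply: eq_bigr => i _; rewrite coefZ mulrA.
Qed.

Lemma umbXsubC c a q : umb c (('X - a%:P) * q) = umb (fun i => c i.+1 - a * c i) q.
Proof.
rewrite mulrBl umbD -scaleN1r umbZ mul_polyC umbZ.
rewrite (@umb_wide c ('X * q) (size q).+1); last by rewrite (leq_trans (size_polyMleq _ _)) ?size_polyX.
rewrite big_ord_recl coefXM mul0r add0r /umb mulN1r mulr_sumr -sumrB.
apply: eq_bigr => i _; rewrite coefXM /= /bump /= add1n; ring.
Qed.

Lemma umb1 c : umb c 1 = c 0.
Proof. by rewrite /umb size_poly1 big_ord1 coef1 mul1r. Qed.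

Lemma umb_sumr (I : finType) (c : I -> nat -> C) q :
  umb (fun n => \sum_i c i n) q = \sum_i umb (c i) q.
Proof.
rewrite /umb exchange_big; apply: eq_bigr => i _.
by rewrite mulr_sumr.
Qed.

Lemma eq_umb c c' q : c =1 c' -> umb c q = umb c' q.
Proof. by move=> h; apply: eq_bigr => i _; rewrite h. Qed.

Lemma umb0 q : umb (fun=> 0) q = 0.
Proof. by apply: big1 => i _; rewrite mulr0. Qed.

Lemma umb_geom c a q : (forall n, c n.+1 = a * c n) -> umb c q = q.[a] * c 0.
Proof.
move=> h; have cn n : c n = a ^+ n * c 0.
  by elim: n => [|n ih]; rewrite ?mul1r // h ih exprS mulrA.
rewrite horner_coef mulr_suml; apply: eq_bigr => i _.
by rewrite cn mulrA.
Qed.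

Lemma poly_crt (M : nat) (s : seq C) (f : C -> {poly C}) : uniq s ->
  exists q, forall x, x \in s -> ('X - x%:P) ^+ M %| q - f x.
Proof.
elim: s => [|x s ih] /=; first by exists 0.
case/andP=> xs /ih[q hq].
pose p := \prod_(y <- s) ('X - y%:P) ^+ M.
have /Bezout_eq1_coprimepP[[u v] /= uv] : coprimep p (('X - x%:P) ^+ M).
  rewrite /p; elim: (s) xs => [|y s' ih']; first by rewrite big_nil coprime1p.
  rewrite inE negb_or => /andP[xy xs']; rewrite big_cons coprimepMl ih' // andbT.
  apply: coprimep_expl; apply: coprimep_expr.
  by rewrite coprimep_XsubC root_XsubC.
exists (q + (f x - q) * (u * p)) => y; rewrite inE => /predU1P[->|ys].
  have -> : q + (f x - q) * (u * p) - f x = (q - f x) * v * ('X - x%:P) ^+ M.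
    have -> : u * p = 1 - v * ('X - x%:P) ^+ M by rewrite -uv addrK.
    ring.
  by rewrite dvdp_mull.
rewrite addrAC dvdp_add ?hq // !mulrA dvdp_mull //.
by rewrite /p (big_rem y) //= dvdp_mulr.
Qed.

Lemma interpolation (I : finType) (x y : I -> C) :
  (forall i j, x i = x j -> y i = y j) -> exists q, forall i, q.[x i] = y i.
Proof.
move=> h; pose f (a : C) := if [pick i | x i == a] is Some i then (y i)%:P else 0.
have [q hq] := @poly_crt 1 (undup [seq x i | i : I]) f (undup_uniq _).
exists q => i.
have /hq : x i \in undup [seq x i | i : I] by rewrite mem_undup map_f ?mem_enum.
rewrite expr1 dvdp_XsubCl /root hornerD hornerN subr_eq0 => /eqP ->.
rewrite /f; case: pickP => [j /eqP/h ->|/(_ i)]; last by rewrite eqxx.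
by rewrite hornerC.
Qed.

End Umbral.

(** * Splitting regular functions into weight vectors *)

Section Decomposition.
Variables (C : fieldType) (N : nat) (L : zmodType) (K : L -> rexp C N -> Prop).
Implicit Types (e : rexp C N) (A X : 'M[C]_N).

Definition decomposable e := exists (I : finType) (l : I -> L) (f : I -> rexp C N),
  (forall i, K (l i) (f i)) /\
  forall A, A \in unitmx -> pev e A = \sum_i pev (f i) A.

(** Read [K l e] as: [e] is a weight vector of weight [l], possibly in a generalized sense. Weights
    add under products, so it is enough to split the coordinate functions [PX] and [PV]. *)
Lemma decomposition :
  (forall c, K 0 (PC c)) ->
  (forall l l' e e', K l e -> K l' e' -> K (l + l') (PMul e e')) ->
  (forall l c e, K l e -> K l (PScale c e)) ->
  (forall i j, decomposable (PX i j)) -> (forall i j, decomposable (PV i j)) ->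
  forall e, decomposable e.
Proof.
move=> K0 KM KZ KX KV; elim=> [c|//|//|e1 ih1 e2 ih2|e1 ih1 e2 ih2|c e ih].
- by exists unit, (fun=> 0), (fun=> PC c); split=> // A _; rewrite sumr_const card_unit.
- have [I1 [l1 [f1 [h1 d1]]]] := ih1; have [I2 [l2 [f2 [h2 d2]]]] := ih2.
  exists (I1 + I2)%type, (fun x => match x with inl i => l1 i | inr i => l2 i end).
  exists (fun x => match x with inl i => f1 i | inr i => f2 i end).
  split=> [[i|i] //|A uA]; rewrite /= d1 // d2 // big_sumType /=.
  by congr (_ + _); apply: eq_bigr.
- have [I1 [l1 [f1 [h1 d1]]]] := ih1; have [I2 [l2 [f2 [h2 d2]]]] := ih2.
  exists (I1 * I2)%type, (fun x => l1 x.1 + l2 x.2).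
  exists (fun x => PMul (f1 x.1) (f2 x.2)); split=> [[i j]|A uA]; first exact: KM.
  by rewrite /= d1 // d2 // big_distrlr pair_big /=.
- have [I [l [f [h d]]]] := ih; exists I, l, (fun i => PScale c (f i)).
  split=> [i|A uA]; first exact: KZ.
  by rewrite /= d // mulr_sumr.
Qed.

End Decomposition.

(** * Iterated derivations of coordinate functions *)

Section Iterates.
Variables (C : numFieldType) (N : nat).
Implicit Types (e : rexp C N) (A X Y : 'M[C]_N).

Lemma iter_ddD m Y X e1 e2 :
  iter m (dd Y X) (PAdd e1 e2) = PAdd (iter m (dd Y X) e1) (iter m (dd Y X) e2).
Proof. by elim: m => //= m ->. Qed.

Lemma iter_ddZ m Y X c e : iter m (dd Y X) (PScale c e) = PScale c (iter m (dd Y X) e).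
Proof. by elim: m => //= m ->. Qed.

Lemma iter_dd_sum m Y X I (s : seq I) F :
  iter m (dd Y X) (psum s F) = psum s (fun i => iter m (dd Y X) (F i)).
Proof.
elim: s => [|i s ih] /=; first by elim: m => //= m ->.
by rewrite iter_ddD ih.
Qed.

Lemma eqv_iter m Y X e e' : eqv e e' -> eqv (iter m (dd Y X) e) (iter m (dd Y X) e').
Proof. by move=> h; elim: m => //= m ih; apply: eqv_dd. Qed.

Lemma eqv_refl e : eqv e e. Proof. by []. Qed.

Lemma dd_mulX X (Q : 'M[C]_N) i j :
  eqv (dd 0 X (mulE PX (cstE Q) i j)) (mulE PX (cstE (X *m Q)) i j).
Proof.
move=> A uA; rewrite pev_dd // mul0mx add0r.
transitivity (mdir (mulE PX (cstE Q)) A (A *m X) i j); first by rewrite mxE.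
transitivity (mev (mulE PX (cstE (X *m Q))) A i j); last by rewrite mxE.
by rewrite !mdirE mulmx0 addr0 mulmxA.
Qed.

Lemma dd_mulV X (Q : 'M[C]_N) i j :
  eqv (dd 0 X (mulE (cstE Q) PV i j)) (mulE (cstE (- (Q *m X))) PV i j).
Proof.
move=> A uA; rewrite pev_dd // mul0mx add0r.
transitivity (mdir (mulE (cstE Q) PV) A (A *m X) i j); first by rewrite mxE.
transitivity (mev (mulE (cstE (- (Q *m X))) PV) A i j); last by rewrite mxE.
by rewrite !mdirE mul0mx add0r mulmxA mulVmx // mul1mx mulmxN mulNmx mulmxA.
Qed.

Lemma pev_mulX (Q : 'M[C]_N) i j A : pev (mulE PX (cstE Q) i j) A = (A *m Q) i j.
Proof. by transitivity (mev (mulE PX (cstE Q)) A i j); [rewrite mxE|rewrite !mevE]. Qed.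

Lemma pev_mulV (Q : 'M[C]_N) i j A :
  pev (mulE (cstE Q) PV i j) A = (Q *m invmx A) i j.
Proof. by transitivity (mev (mulE (cstE Q) PV) A i j); [rewrite mxE|rewrite !mevE]. Qed.

End Iterates.

(** * Primary decomposition of a matrix *)

Section PrimaryDecomposition.
Variable C : closedFieldType.

Lemma dvdp_prod_coprime (M : nat) (s : seq C) (p : {poly C}) : uniq s ->
  (forall x, x \in s -> ('X - x%:P) ^+ M %| p) ->
  \prod_(x <- s) ('X - x%:P) ^+ M %| p.
Proof.
elim: s => [|x s ih] /=; first by rewrite big_nil dvd1p.
case/andP=> xs us h; rewrite big_cons Gauss_dvdp.
  rewrite h ?inE ?eqxx //= ih // => y ys; apply: h; by rewrite inE ys orbT.
elim: (s) xs => [|y s' ih']; first by rewrite big_nil coprimep1.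
rewrite inE negb_or => /andP[xy xs']; rewrite big_cons coprimepMr ih' // andbT.
apply: coprimep_expl; apply: coprimep_expr.
by rewrite coprimep_XsubC root_XsubC eq_sym.
Qed.

(** The projections are polynomials in [H], so they commute with everything that commutes with [H].
    By Chinese remainders the i-th polynomial is 1 modulo the N-th power of ['X - a i] and 0 modulo
    the other N-th powers; identities between them hold at [H] because the characteristic polynomial
    divides the product of these powers. *)
Lemma primary_projections (N : nat) (H : 'M[C]_N) :
  exists n (a : 'I_n -> C) (Pi : 'I_n -> 'M[C]_N),
  [/\ injective a, \sum_i Pi i = 1%:M,
      forall i j, i != j -> Pi i *m Pi j = 0,
      forall X, X *m H = H *m X -> forall i, X *m Pi i = Pi i *m X
    & forall i, (H - (a i)%:M) ^+ N *m Pi i = 0].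
Proof.
case: N H => [|N] H.
  by exists 0%N, (fun=> 0), (fun=> 0); split=> [[]//||[]//|X _ []//|[]//]; apply/matrixP => -[].
have [rs rsE] := closed_field_poly_normal (char_poly H).
rewrite (monicP (char_poly_monic H)) scale1r in rsE.
have size_rs : size rs = N.+1.
  by have := size_char_poly H; rewrite rsE size_prod_XsubC => -[].
pose s := undup rs; pose n := size s; pose a (i : 'I_n) := s`_i.
have us : uniq s := undup_uniq _.
have a_inj : injective a.
  by move=> i j /eqP; rewrite nth_uniq // => /eqP/val_inj.
have aP x : x \in s -> exists i, x = a i.
  by move=> xs; have := xs; rewrite -index_mem => h; exists (Ordinal h); rewrite /a nth_index.
have kill p : (forall i, ('X - (a i)%:P) ^+ N.+1 %| p) -> horner_mx H p = 0.
  move=> h; apply/mxminpoly_minP; apply: (dvdp_trans (mxminpoly_dvd_char H)).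
  apply: (@dvdp_trans _ (\prod_(x <- s) ('X - x%:P) ^+ N.+1)); last first.
    by apply: dvdp_prod_coprime => // x /aP[i ->].
  rewrite rsE prodrXl -size_rs.
  have : all [in s] rs by apply/allP => x; rewrite /= mem_undup.
  elim: (rs) => [|x rs' ih] /=; first by rewrite big_nil dvd1p.
  case/andP=> xs /ih{}ih; rewrite big_cons exprS dvdp_mul //.
  by rewrite (big_rem x) //= dvdp_mulr.
have /fin_all_exists[pi piP] (i : 'I_n) : exists q, forall x, x \in s ->
    ('X - x%:P) ^+ N.+1 %| q - (if x == a i then 1 else 0).
  exact: poly_crt.
have piE i j : ('X - (a j)%:P) ^+ N.+1 %| pi i - (j == i)%:R.
  have /(piP i) : a j \in s by apply: mem_nth.
  by rewrite (inj_eq a_inj); case: eqP.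
exists n, a, (fun i => horner_mx H (pi i)); split=> //.
- apply/eqP; rewrite -subr_eq0 -[1%:M](rmorph1 (horner_mx H)) -rmorph_sum -rmorphB.
  apply/eqP/kill => j.
  have -> : \sum_i pi i - 1 = \sum_i (pi i - (j == i)%:R).
    rewrite sumrB; congr (_ - _).
    by rewrite (bigD1 j) //= eqxx big1 ?addr0 // => i /negPf; rewrite eq_sym => ->.
  apply: (big_ind (fun q => ('X - (a j)%:P) ^+ N.+1 %| q)) => [|p q hp hq|i _ //].
    exact: dvdp0.
  exact: dvdp_add.
- move=> i j ij; rewrite mulmxE -rmorphM /= kill // => k.
  have [->|ki] := eqVneq k j; last first.
    by have := piE j k; rewrite (negPf ki) subr0 => h; rewrite dvdp_mull.
  by have := piE i j; rewrite eq_sym (negPf ij) subr0 => h; rewrite dvdp_mulr.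
- move=> X XH i; exact: comm_mx_horner.
move=> i; have -> : H - (a i)%:M = horner_mx H ('X - (a i)%:P).
  by rewrite rmorphB /= horner_mx_X horner_mx_C.
rewrite mulmxE -rmorphXn -rmorphM /= kill // => k.
have [->|ki] := eqVneq k i; first exact: dvdp_mulIl.
by have := piE i k; rewrite (negPf ki) subr0 => h; rewrite dvdp_mull.
Qed.

End PrimaryDecomposition.

(** * Nilpotent Jordan parts stay in the Lie algebra *)

Section JordanInLie.
Variables (C : numClosedFieldType) (N : nat) (Gs : 'M[C]_N -> Prop).
Hypothesis GsG : alg_group Gs.
Implicit Types (e : rexp C N) (A X : 'M[C]_N).

Lemma iter_dd0 m X : iter m (dd 0 X) (PC 0) = PC 0 :> rexp C N.
Proof. by elim: m => //= m ->. Qed.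

Definition dd_nilpotent X e := exists M, eqv (iter M (dd 0 X) e) (PC 0).

Lemma eqv_iter0 X e m : eqv e (PC 0) -> eqv (iter m (dd 0 X) e) (PC 0).
Proof. by move=> h; rewrite -(iter_dd0 m X); apply: eqv_iter. Qed.

Lemma dd_nilpotentM X e e' :
  dd_nilpotent X e -> dd_nilpotent X e' -> dd_nilpotent X (PMul e e').
Proof.
case=> M hM [M' hM']; exists (M + M')%N.
suff {M M' e e' hM hM'} main k a b e e' : eqv (iter a (dd 0 X) e) (PC 0) ->
    eqv (iter b (dd 0 X) e') (PC 0) -> (a + b <= k)%N ->
    eqv (iter k (dd 0 X) (PMul e e')) (PC 0) by exact: (main _ M M').
elim: k a b e e' => [|k ih] [|a] [|b] e e' ha hb //.
- by move=> _ A uA /=; rewrite ha ?mul0r.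
- by move=> _; apply: eqv_iter0 => A uA /=; rewrite ha ?mul0r.
- by move=> _; apply: eqv_iter0 => A uA /=; rewrite ha ?mul0r.
- by move=> _; apply: eqv_iter0 => A uA /=; rewrite hb ?mulr0.
rewrite iterSr /= iter_ddD.
rewrite addSn ltnS => le_k A uA /=.
rewrite (ih a b.+1 (dd 0 X e) e') ?(ih a.+1 b e (dd 0 X e')) //= ?addr0 //;
  first [by rewrite -iterSr | by rewrite addSnnS].
Qed.

Section NilpotentPart.
Variables (H : 'M[C]_N) (n : nat) (a : 'I_n -> C) (Pi : 'I_n -> 'M[C]_N).
Hypotheses (Pi1 : \sum_i Pi i = 1%:M)
  (PiO : forall i j, i != j -> Pi i *m Pi j = 0)
  (PiC : forall X, X *m H = H *m X -> forall i, X *m Pi i = Pi i *m X)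
  (PiN : forall i, (H - (a i)%:M) ^+ N *m Pi i = 0).

(** The nilpotent part of the additive Jordan decomposition of [H]. *)
Definition nilpart := \sum_i (H - (a i)%:M) *m Pi i.

Lemma HPi i : H *m Pi i = Pi i *m H. Proof. exact: PiC. Qed.

Lemma nilpart_comm X : X *m H = H *m X -> X *m nilpart = nilpart *m X.
Proof.
move=> XH; rewrite mulmx_sumr mulmx_suml; apply: eq_bigr => i _.
rewrite -[RHS]mulmxA -PiC // !mulmxA; congr (_ *m _).
by rewrite mulmxBr mulmxBl XH scalar_mxC.
Qed.

Lemma PiPi i : Pi i *m Pi i = Pi i.
Proof.
rewrite -[RHS]mulmx1 -Pi1 mulmx_sumr (bigD1 i) //= big1 ?addr0 // => j ji.
by rewrite PiO // eq_sym.
Qed.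

Lemma nilpartPi i : nilpart *m Pi i = (H - (a i)%:M) *m Pi i.
Proof.
rewrite /nilpart mulmx_suml (bigD1 i) //= -mulmxA PiPi big1 ?addr0 // => j ji.
by rewrite -mulmxA PiO // mulmx0.
Qed.

Lemma nilpartXPi k i : nilpart ^+ k *m Pi i = (H - (a i)%:M) ^+ k *m Pi i.
Proof.
elim: k => [//|k ih]; rewrite !exprS -![_ * _]/(_ *m _) -mulmxA ih.
have hc : (H - (a i)%:M) ^+ k *m Pi i = Pi i *m (H - (a i)%:M) ^+ k.
  apply/PiC/esym; rewrite !mulmxE; apply: commrX.
  by apply: commrB => //; rewrite /GRing.comm -!mulmxE scalar_mxC.
by rewrite hc mulmxA nilpartPi -!mulmxA ?hc.
Qed.

Lemma nilpart_nilp : nilpart ^+ N = 0.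
Proof.
rewrite -[LHS]mulmx1 -Pi1 mulmx_sumr big1 // => i _.
by rewrite nilpartXPi PiN.
Qed.

(** Generalized eigenvectors of [dd 0 H], on which the nilpotent part of this operator is
    [dd 0 nilpart]. *)
Let K (l : C) e := eqv (dd 0 H e) (PAdd (PScale l e) (dd 0 nilpart e))
                   /\ dd_nilpotent nilpart e.

Lemma jordan_decomposition e : decomposable K e.
Proof.
have HE i : H *m Pi i = a i *: Pi i + nilpart *m Pi i.
  by rewrite nilpartPi mulmxBl mul_scalar_mx addrC subrK.
apply: decomposition => [c|l l' e1 e2 [h1 n1] [h2 n2]|l c e1 [h1 [M n1]]|i j|i j].
- by split=> [A uA|]; [rewrite /= mul0r addr0|exists 1%N].
- split; last exact: dd_nilpotentM.
  by move=> A uA; rewrite /= h1 // h2 //=; ring.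
- split=> [A uA|]; first by rewrite /= h1 //=; ring.
  by exists M => A uA; rewrite iter_ddZ /= n1 // mulr0.
- exists 'I_n, a, (fun k => mulE PX (cstE (Pi k)) i j); split=> [k|A uA]; last first.
    under eq_bigr do rewrite pev_mulX.
    by rewrite -summxE -mulmx_sumr Pi1 mulmx1.
  split=> [A uA|].
    rewrite dd_mulX //= dd_mulX // !pev_mulX HE mulmxDr -scalemxAr.
    by rewrite [LHS]mxE [X in X + _]mxE.
  have it m : eqv (iter m (dd 0 nilpart) (mulE PX (cstE (Pi k)) i j))
      (mulE PX (cstE (nilpart ^+ m *m Pi k)) i j).
    elim: m => [|m ih] A uA; first by rewrite /= [_ *m Pi k]mul1mx.
    by rewrite /= (eqv_dd _ _ ih) // dd_mulX // mulmxA exprS.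
  by exists N => A uA; rewrite it // pev_mulX nilpartXPi PiN mulmx0 mxE.
exists 'I_n, (fun k => - a k), (fun k => mulE (cstE (Pi k)) PV i j).
split=> [k|A uA]; last first.
  under eq_bigr do rewrite pev_mulV.
  by rewrite -summxE -mulmx_suml Pi1 mul1mx.
have nPi : Pi k *m nilpart = nilpart *m Pi k by rewrite nilpart_comm // HPi.
split=> [A uA|].
  rewrite dd_mulV //= dd_mulV // !pev_mulV -HPi HE nPi opprD mulmxDl -scaleNr -scalemxAl.
  by rewrite [LHS]mxE [X in X + _]mxE.
have it m : eqv (iter m (dd 0 nilpart) (mulE (cstE (Pi k)) PV i j))
    (mulE (cstE ((-1) ^+ m *: (Pi k *m nilpart ^+ m))) PV i j).
  elim: m => [|m ih] A uA; first by rewrite /= expr0 scale1r [Pi k *m _]mulmx1.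
  rewrite /= (eqv_dd _ _ ih) // dd_mulV // !pev_mulV -scalemxAl -mulmxA.
  by rewrite exprSr [_ ^+ m.+1]exprSr mulrN1 scaleNr.
by exists N => A uA; rewrite it // nilpart_nilp mulmx0 scaler0 pev_mulV mul0mx mxE.
Qed.

(** Choose a polynomial q congruent to X - l modulo a high power of X - l, for each weight l
    occurring in [e]. Then q, applied to the operator [dd 0 H], acts on [e] as [dd 0 nilpart] does.
    Powers of [dd 0 H] preserve the vanishing ideal, so the derivative of [e] along [nilpart] at 1
    is zero. The functional [umb] expresses this through the values of the iterates at 1. *)
Lemma lieA_nilpart : lieA Gs H -> lieA Gs nilpart.
Proof.
move=> hH e he.
have [I [l [f [hf fE]]]] := jordan_decomposition e.
have /fin_all_exists[Mf hM] i : exists M, eqv (iter M (dd 0 nilpart) (f i)) (PC 0).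
  by have [_ [M hM]] := hf i; exists M.
pose M := \max_i Mf i.
have hM' i : eqv (iter M (dd 0 nilpart) (f i)) (PC 0).
  rewrite -(subnK (leq_bigmax i : (Mf i <= M)%N)) iterD.
  exact: eqv_iter0.
have [q hq] := @poly_crt _ M (undup [seq l i | i : I]) (fun x => 'X - x%:P) (undup_uniq _).
have {}hq i : exists r, q = ('X - (l i)%:P) + r * ('X - (l i)%:P) ^+ M.
  have /hq/dvdpP[r rE] : l i \in undup [seq l i | i : I].
    by rewrite mem_undup map_f ?mem_enum.
  by exists r; rewrite -rE addrC subrK.
pose s := index_enum I.
have eE : eqv e (psum s f) by move=> A uA; rewrite pev_sum fE.
have u1 := unitmx1 C N.
pose c i k m := pev (iter m (dd 0 H) (iter k (dd 0 nilpart) (f i))) 1%:M.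
have umb0e : umb (fun m => \sum_i c i 0%N m) q = 0.
  rewrite -[RHS](umb0 q); apply: eq_umb => m.
  rewrite /c -[RHS](vanish_iter GsG m hH he (ag_one GsG)).
  by rewrite (eqv_iter _ _ _ eE) // iter_dd_sum pev_sum.
have HE i k : eqv (dd 0 H (iter k (dd 0 nilpart) (f i)))
    (PAdd (PScale (l i) (iter k (dd 0 nilpart) (f i))) (iter k.+1 (dd 0 nilpart) (f i))).
  elim: k => [|k ih]; first by have [] := hf i.
  move=> A uA; rewrite [iter k.+1 _ _]/= dd_comm // (eqv_dd _ _ ih) // [X in _ + X]pev_dd //.
  by rewrite nilpart_comm // !mulmx0 !subrr mul0mx mulmx0 addr0 pdir0 addr0.
have cS i k m : c i k m.+1 - l i * c i k m = c i k.+1 m.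
  rewrite /c iterSr (eqv_iter _ _ _ (HE i k)) // iter_ddD iter_ddZ /=.
  by rewrite addrC addKr.
have cX i k r : umb (c i 0%N) (('X - (l i)%:P) ^+ k * r) = umb (c i k) r.
  elim: k r => [|k ih] r; first by rewrite mul1r.
  by rewrite exprSr -mulrA ih umbXsubC; apply: eq_umb => m; rewrite cS.
have key i : umb (c i 0%N) q = pev (dd 0 nilpart (f i)) 1%:M.
  have [r ->] := hq i; rewrite umbD (mulrC r) cX.
  have := cX i 1%N 1; rewrite mulr1 expr1 umb1 => ->.
  rewrite [X in _ + X](_ : _ = 0) ?addr0 //.
  rewrite -[RHS](umb0 r); apply: eq_umb => m.
  by rewrite /c (eqv_iter _ _ _ (hM' i)) // iter_dd0.
have <- : pev (dd 0 nilpart e) 1%:M = pdir e 1%:M nilpart.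
  by rewrite pev_dd // mul0mx add0r mul1mx.
rewrite (eqv_dd _ _ eE) //.
rewrite -[dd 0 nilpart (psum s f)]/(iter 1 (dd 0 nilpart) _) iter_dd_sum pev_sum.
by rewrite -[RHS]umb0e umb_sumr; apply: eq_bigr => i _; rewrite key.
Qed.

Lemma nilpart0_diag : injective a -> nilpart = 0 -> diagonalizable H.
Proof.
move=> a_inj n0; have hPi i : (H - (a i)%:M) *m Pi i = 0.
  by rewrite -nilpartPi n0 mul0mx.
move: H Pi hPi Pi1; case: N => [|N'] H' Pi' hPi Pi1'.
  exists 1%:M; rewrite ?unitmx1 //; apply/diagonalizable_forP; rewrite ?unitmx1 //.
  by case.
apply/diagonalizableP; exists [seq a i | i : 'I_n].
  by rewrite map_inj_uniq ?enum_uniq.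
apply: mxminpoly_min; rewrite -[LHS]mulmx1 -Pi1' mulmx_sumr big1 // => i _.
have /dvdpP[q ->] : ('X - (a i)%:P) %| \prod_(x <- [seq a i | i : 'I_n]) ('X - x%:P).
  have ai : a i \in [seq a i | i : 'I_n] by apply: map_f; rewrite mem_enum.
  by rewrite (big_rem _ ai) dvdp_mulr.
rewrite rmorphM /=.
by rewrite rmorphB /= horner_mx_X horner_mx_C -mulmxA hPi mulmx0.
Qed.

End NilpotentPart.
Lemma jordan_lie H : lieA Gs H -> exists Nn,
  [/\ lieA Gs Nn, Nn ^+ N = 0, forall X, X *m H = H *m X -> X *m Nn = Nn *m X
    & Nn = 0 -> diagonalizable H].
Proof.
move=> hH; have [n [a [Pi [a_inj Pi1 PiO PiC PiN]]]] := primary_projections H.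
exists (nilpart H a Pi); split.
- exact: lieA_nilpart.
- exact: nilpart_nilp.
- by move=> X; apply: nilpart_comm.
- exact: (@nilpart0_diag _ _ a Pi).
Qed.

End JordanInLie.

Section Monomials.
Variables (C : numFieldType) (r : nat).
Implicit Types (u v : 'I_r -> C) (m : 'rV[int]_r).

Definition unitv u := forall j, u j != 0.

Definition mon u m : C := \prod_j u j ^ m 0 j.

Lemma mon0 u : mon u 0 = 1.
Proof. by apply: big1 => j _; rewrite mxE expr0z. Qed.

Lemma monD u m1 m2 : unitv u -> mon u (m1 + m2) = mon u m1 * mon u m2.
Proof.
by move=> hu; rewrite -big_split; apply: eq_bigr => j _; rewrite mxE expfzDr.
Qed.

Lemma mon_neq0 u m : unitv u -> mon u m != 0.
Proof. by move=> hu; rewrite prodf_seq_neq0; apply/allP => j _; rewrite expfz_neq0. Qed.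

Lemma monN u m : unitv u -> mon u (- m) = (mon u m)^-1.
Proof.
move=> hu; apply: (mulfI (mon_neq0 m hu)).
by rewrite -monD // subrr mon0 divff ?mon_neq0.
Qed.

Lemma monMl u v m : mon (fun j => u j * v j) m = mon u m * mon v m.
Proof. by rewrite -big_split; apply: eq_bigr => j _; rewrite expfzMl. Qed.

Lemma mon1 m : mon (fun=> 1) m = 1.
Proof. by apply: big1 => j _; rewrite exp1rz. Qed.

Definition upd (j : 'I_r) (z : C) : 'I_r -> C := fun k => if k == j then z else 1.

Lemma upd_unit j z : z != 0 -> unitv (upd j z).
Proof. by move=> hz k; rewrite /upd; case: ifP; rewrite ?oner_neq0. Qed.

Lemma mon_upd j z m : mon (upd j z) m = z ^ m 0 j.
Proof.
rewrite /mon (bigD1 j) //= /upd eqxx big1 ?mulr1 // => k /negPf ->.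
by rewrite exp1rz.
Qed.

Lemma expz2_inj : injective (fun k : int => (2 : C) ^ k).
Proof.
have pw (n : nat) : (2 : C) ^+ n = 1 -> n = 0%N.
  case: n => // n h; have : 1 < (2 : C) ^+ n.+1 by rewrite exprn_egt1 // ltr1n.
  by rewrite h ltxx.
have n2 : (2 : C) != 0 by rewrite pnatr_eq0.
move=> k l kl; apply/eqP; rewrite -subr_eq0; apply/eqP.
have : (2 : C) ^ (k - l) = 1 by rewrite expfzDr // kl -expfzDr // subrr.
case: (k - l) => n; first by move/pw ->.
by rewrite NegzE -exprnN => /eqP; rewrite invr_eq1 => /eqP/pw.
Qed.

Lemma poly_eq0_values (p : {poly C}) : (forall z, z != 0 -> p.[z] = 0) -> p = 0.
Proof.
move=> h; apply/eqP; apply: contraT => p0.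
have := max_poly_roots p0 (rs := [seq i.+1%:R | i <- iota 0 (size p)]).
rewrite size_map size_iota ltnn => -> //.
  by apply/allP => _ /mapP[i _ ->]; rewrite /root h // pnatr_eq0.
rewrite map_inj_uniq ?iota_uniq // => i j /eqP.
by rewrite eqr_nat => /eqP[].
Qed.

Lemma umb_sum (I : finType) (c : nat -> C) (b : I -> C) (k : I -> nat) :
  umb c (\sum_i b i *: 'X^(k i)) = \sum_i b i * c (k i).
Proof.
elim: index_enum => [|i s ih]; first by rewrite !big_nil /umb size_poly0 big_ord0.
rewrite !big_cons umbD ih umbZ; congr (_ * _ + _).
elim: (k i) (c) => [|n ihn] c'; first by rewrite expr0 umb1.
have := umbXsubC c' 0 'X^n; rewrite subr0 exprS => ->.
by rewrite ihn mul0r subr0.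
Qed.

(** Linear independence of the powers of z: in a relation between them, z^k may be replaced by an
    arbitrary function of k. The identity function of k gives differentiation, an indicator function
    extracts a coefficient. *)
Lemma laurent_poly_twist (I : finType) (b : I -> C) (k : I -> int) (phi : int -> C) :
  (forall z, z != 0 -> \sum_i b i * z ^ k i = 0) -> \sum_i b i * phi (k i) = 0.
Proof.
move=> h; pose K := (\max_i absz (k i))%N.
have kK i : exists n : nat, k i + K%:Z = n%:Z.
  exists (absz (k i + K%:Z)); rewrite gez0_abs //.
  have : (absz (k i) <= K)%N by exact: leq_bigmax.
  by case: (k i) => n //=; lia.
have /fin_all_exists[n nE] := kK.
pose p := \sum_i b i *: 'X^(n i).
have p0 : p = 0.
  apply: poly_eq0_values => z z0; rewrite horner_sum.
  rewrite -[RHS](mulr0 (z ^ K%:Z)) -[X in _ * X](h z z0) mulr_sumr.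
  apply: eq_bigr => i _; rewrite hornerZ hornerXn mulrCA -expfzDr //.
  by rewrite addrC nE.
have := umb_sum (fun q : nat => phi (q%:Z - K%:Z)) b n.
rewrite -/p p0 /umb size_poly0 big_ord0 => H0; rewrite [RHS]H0.
by apply: eq_bigr => i _; rewrite -nE addrK.
Qed.

Section Twist.
Variables (I : finType) (l : I -> 'rV[int]_r).

Lemma mon_twist1 (c : I -> C) (j : 'I_r) (phi : int -> C) :
  (forall u, unitv u -> \sum_i c i * mon u (l i) = 0) ->
  forall u, unitv u -> \sum_i c i * phi (l i 0 j) * mon u (l i) = 0.
Proof.
move=> h u hu.
have := @laurent_poly_twist I (fun i => c i * mon u (l i)) (fun i => l i 0 j) phi.
move=> H; rewrite -[RHS]H => [|z z0].
  by apply: eq_bigr => i _; rewrite mulrAC.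
rewrite -[RHS](h (fun k => u k * upd j z k)) => [|k]; last first.
  by rewrite mulf_neq0 ?upd_unit.
by apply: eq_bigr => i _; rewrite monMl mon_upd mulrA.
Qed.

Lemma mon_indep (c : I -> C) : (forall u, unitv u -> \sum_i c i * mon u (l i) = 0) ->
  forall m, \sum_(i | l i == m) c i = 0.
Proof.
move=> h m; pose phi j (x : int) : C := (x == m 0 j)%:R.
have key (s : seq 'I_r) u : unitv u ->
    \sum_i (c i * \prod_(j <- s) phi j (l i 0 j)) * mon u (l i) = 0.
  elim: s u => [|j s ih] u hu.
    by rewrite -[RHS](h u hu); apply: eq_bigr => i _; rewrite big_nil mulr1.
  rewrite -[RHS](mon_twist1 j (phi j) ih hu); apply: eq_bigr => i _.
  by rewrite big_cons; congr (_ * _); ring.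
have u1 : unitv (fun=> 1) by move=> j; apply: oner_neq0.
rewrite -[RHS](key (index_enum 'I_r) _ u1) big_mkcond; apply: eq_bigr => i _.
rewrite mon1 mulr1; case: eqP => [->|ne].
  by rewrite big1 ?mulr1 // => j _; rewrite /phi eqxx.
have [j hj] : exists j, l i 0 j != m 0 j.
  apply/existsP; apply: contraT; rewrite negb_exists => /forallP e; case: ne.
  by apply/rowP => j; apply/eqP; move: (e j); rewrite negbK.
have phij : phi j (l i 0 j) = 0.
  by rewrite /phi; case: eqP => // E; rewrite E eqxx in hj.
by rewrite (bigD1 j) //= phij mul0r mulr0.
Qed.

End Twist.

(** The exponents [l] may repeat, which makes sums and products trivial to form; the coefficient of
    a monomial is then a sum over a fibre of [l], as in [mon_indep]. *)
Definition laurent (f : ('I_r -> C) -> C) := exists (I : finType) (l : I -> 'rV[int]_r)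
  (c : I -> C), forall u, unitv u -> f u = \sum_i c i * mon u (l i).

Lemma laurentC c : laurent (fun=> c).
Proof.
exists unit, (fun=> 0), (fun=> c) => u _.
by rewrite sumr_const card_unit mulr1n mon0 mulr1.
Qed.

Lemma laurent_mon m : laurent (fun u => mon u m).
Proof.
exists unit, (fun=> m), (fun=> 1) => u _.
by rewrite sumr_const card_unit mulr1n mul1r.
Qed.

Lemma laurentD f g : laurent f -> laurent g -> laurent (fun u => f u + g u).
Proof.
case=> I1 [l1 [c1 h1]] [I2 [l2 [c2 h2]]].
exists (I1 + I2)%type, (fun x => match x with inl i => l1 i | inr i => l2 i end).
exists (fun x => match x with inl i => c1 i | inr i => c2 i end) => u hu.
by rewrite h1 // h2 // big_sumType.
Qed.

Lemma laurentM f g : laurent f -> laurent g -> laurent (fun u => f u * g u).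
Proof.
case=> I1 [l1 [c1 h1]] [I2 [l2 [c2 h2]]].
exists (I1 * I2)%type, (fun x => l1 x.1 + l2 x.2), (fun x => c1 x.1 * c2 x.2) => u hu.
rewrite h1 // h2 // big_distrlr pair_big /=; apply: eq_bigr => -[i j] _.
by rewrite monD // mulrACA.
Qed.

Lemma laurent_sum (J : Type) (s : seq J) (P : pred J) (F : J -> ('I_r -> C) -> C) :
  (forall j, laurent (F j)) -> laurent (fun u => \sum_(j <- s | P j) F j u).
Proof.
move=> h; elim: s => [|j s ih].
  by case: (laurentC 0) => I [l [c E]]; exists I, l, c => u hu; rewrite big_nil; apply: E.
case Pj: (P j); last first.
  by case: ih => I [l [c E]]; exists I, l, c => u hu; rewrite big_cons Pj E.
case: (laurentD (h j) ih) => I [l [c E]]; exists I, l, c => u hu.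
by rewrite big_cons Pj E.
Qed.

Lemma eq_laurent f g : (forall u, unitv u -> f u = g u) -> laurent f -> laurent g.
Proof. by move=> fg [I [l [c h]]]; exists I, l, c => u hu; rewrite -fg ?h. Qed.

Lemma laurent_prod (J : Type) (s : seq J) (F : J -> ('I_r -> C) -> C) :
  (forall j, laurent (F j)) -> laurent (fun u => \prod_(j <- s) F j u).
Proof.
move=> h; elim: s => [|j s ih].
  by apply: eq_laurent (laurentC 1) => u _; rewrite big_nil.
by apply: eq_laurent (laurentM (h j) ih) => u _; rewrite big_cons.
Qed.

Lemma eq_mon u v m : u =1 v -> mon u m = mon v m.
Proof. by move=> uv; apply: eq_bigr => j _; rewrite uv. Qed.

Lemma laurent_ext f u v : laurent f -> unitv u -> u =1 v -> f u = f v.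
Proof.
move=> [I [l [c h]]] hu uv; rewrite !h // => [|j]; last by rewrite -uv.
by apply: eq_bigr => i _; rewrite (eq_mon _ uv).
Qed.

(* Along the line through [u0] and [u1] a Laurent polynomial becomes, up to a
   power of the coordinates, a polynomial in one variable. *)
Lemma laurent_line f u0 u1 : laurent f -> exists (p : {poly C}) K, forall s,
  let u := fun j => u0 j + s * (u1 j - u0 j) in
  unitv u -> p.[s] = f u * \prod_j u j ^+ K.
Proof.
case=> I [l [c h]]; pose K := (\max_i \max_j absz (l i 0%R j))%N.
pose w j : {poly C} := (u0 j)%:P + (u1 j - u0 j) *: 'X.
exists (\sum_i c i *: \prod_j w j ^+ absz (l i 0 j + K%:Z)), K => s u hu.
rewrite h // mulr_suml horner_sum; apply: eq_bigr => i _.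
rewrite hornerZ -mulrA; congr (_ * _); rewrite horner_prod -big_split.
apply: eq_bigr => j _; rewrite horner_exp hornerD hornerC hornerZ hornerX.
rewrite (mulrC _ s) -/(u j) [LHS]exprnP gez0_abs ?expfzDr //.
have h1 : (absz (l i 0%R j) <= \max_k absz (l i 0%R k))%N by exact: leq_bigmax.
have h2 := @leq_bigmax _ (fun i => \max_k absz (l i 0%R k))%N i.
have := leq_trans h1 h2; rewrite -/K.
by case: (l i 0 j) => n //=; lia.
Qed.

(** Restrict to the line joining a point where [f] is nonzero to a point where [g] is nonzero.
    Multiplied by powers of the coordinates, both become nonzero polynomials in one variable. Their
    product with the coordinates themselves vanishes everywhere on the line, also where a coordinate
    is 0, which is absurd. *)
Lemma laurent_domain f g : laurent f -> laurent g ->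
  (forall u, unitv u -> f u * g u = 0) ->
  (exists2 u, unitv u & g u != 0) -> forall u, unitv u -> f u = 0.
Proof.
move=> hf hg fg [u1 hu1 g1] u0 hu0; apply/eqP; apply: contraT => f0.
have [p [K pE]] := laurent_line u0 u1 hf; have [q [K' qE]] := laurent_line u0 u1 hg.
pose w j : {poly C} := (u0 j)%:P + (u1 j - u0 j) *: 'X.
have wE j s : (w j).[s] = u0 j + s * (u1 j - u0 j).
  by rewrite hornerD hornerC hornerZ hornerX mulrC.
have Eu0 j : u0 j + 0 * (u1 j - u0 j) = u0 j by rewrite mul0r addr0.
have Eu1 j : u0 j + 1 * (u1 j - u0 j) = u1 j by rewrite mul1r addrC subrK.
have p0 : p != 0.
  apply: contraTneq isT => p0; have := pE 0; rewrite p0 horner0 => /(_ _)/esym/eqP.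
  rewrite mulf_eq0 (laurent_ext hf _ Eu0) ?(negPf f0) => [/(_ _)/prodf_eq0|j].
    case=> [j|j _]; first by rewrite Eu0.
    by rewrite Eu0 expf_eq0 (negPf (hu0 j)) andbF.
  by rewrite Eu0.
have q0 : q != 0.
  apply: contraTneq isT => q0; have := qE 1; rewrite q0 horner0 => /(_ _)/esym/eqP.
  rewrite mulf_eq0 (laurent_ext hg _ Eu1) ?(negPf g1) => [/(_ _)/prodf_eq0|j].
    case=> [j|j _]; first by rewrite Eu1.
    by rewrite Eu1 expf_eq0 (negPf (hu1 j)) andbF.
  by rewrite Eu1.
have w0 : \prod_j w j != 0.
  rewrite prodf_seq_neq0; apply/allP => j _ /=; apply: contraTneq (hu0 j) => w0.
  by rewrite -Eu0 -wE w0 horner0 eqxx.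
have /negP[] := mulf_neq0 (mulf_neq0 p0 q0) w0; apply/eqP/poly_eq0_values => s _.
rewrite !hornerM horner_prod; have [/forallP hs|] := boolP [forall j, (w j).[s] != 0].
  have hu : unitv (fun j => u0 j + s * (u1 j - u0 j)) by move=> j; rewrite -wE.
  by rewrite pE // qE // mulrACA fg // !mul0r.
rewrite negb_forall => /existsP[j]; rewrite negbK => /eqP wj.
by rewrite [X in _ * X](bigD1 j) //= wj mul0r mulr0.
Qed.

End Monomials.

(** * Tori with integral weights and the functions on them *)

Section Torus.
Variables (C : numFieldType) (N r : nat) (P : 'M[C]_N) (w : 'I_N -> 'rV[int]_r).
Hypothesis uP : P \in unitmx.
Implicit Types (e : rexp C N) (A X : 'M[C]_N) (u : 'I_r -> C).

(* The matrix with eigenvalues [d] in the basis given by the columns of the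
   inverse of [P]. *)
Definition cd (d : 'I_N -> C) : 'M[C]_N := invmx P *m diag_mx (\row_a d a) *m P.

Lemma cdM d d' : cd d *m cd d' = cd (fun a => d a * d' a).
Proof.
rewrite /cd !mulmxA mulmxK // -!mulmxA; congr (_ *m _); rewrite !mulmxA.
by rewrite mulmx_diag; congr (diag_mx _ *m _); apply/rowP => a; rewrite !mxE.
Qed.

Lemma eq_cd d d' : d =1 d' -> cd d = cd d'.
Proof. by move=> dd'; congr (_ *m diag_mx _ *m _); apply/rowP => a; rewrite !mxE. Qed.

Lemma cd1 : cd (fun=> 1) = 1%:M.
Proof.
rewrite /cd (_ : \row_a _ = const_mx 1) ?diag_const_mx ?mulmx1 ?mulVmx //.
by apply/rowP => a; rewrite !mxE.
Qed.

Lemma cdD d d' : cd d + cd d' = cd (fun a => d a + d' a).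
Proof.
rewrite /cd -mulmxDl -mulmxDr -raddfD /=; congr (_ *m diag_mx _ *m _).
by apply/rowP => a; rewrite !mxE.
Qed.

Lemma cdZ c d : c *: cd d = cd (fun a => c * d a).
Proof.
rewrite /cd scalemxAl scalemxAr; congr (_ *m _ *m _).
by apply/matrixP => a b; rewrite !mxE mulrnAr.
Qed.

Lemma cd_inj d d' : cd d = cd d' -> d =1 d'.
Proof.
move=> h a; have := congr1 (fun X => P *m X *m invmx P) h.
rewrite /cd !mulmxA mulmxV // !mul1mx !mulmxK //.
by move/matrixP/(_ a a); rewrite !mxE eqxx !mulr1n.
Qed.

Lemma cd_unit d : (forall a, d a != 0) -> cd d \in unitmx.
Proof.
move=> hd; have [] // := @mulmx1_unit _ _ (cd d) (cd (fun a => (d a)^-1)).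
by rewrite cdM -cd1; apply: eq_cd => a; rewrite divff.
Qed.

Lemma invmx_cd d : (forall a, d a != 0) -> invmx (cd d) = cd (fun a => (d a)^-1).
Proof.
move=> hd; apply: (@row_full_inj _ _ _ _ (cd d)); first by rewrite row_full_unit cd_unit.
by rewrite mulmxV ?cd_unit // cdM -cd1; apply: eq_cd => a; rewrite divff.
Qed.

Lemma cd_eigen d (v : 'cV[C]_N) a : (P *m cd d *m v) a 0 = d a * (P *m v) a 0.
Proof.
rewrite /cd !mulmxA mulmxV // mul1mx -mulmxA.
by rewrite mul_diag_mx !mxE.
Qed.

Lemma mulPI (m : nat) (X Y : 'M[C]_(N, m)) : P *m X = P *m Y -> X = Y.
Proof. by move=> h; rewrite -[X](mulKmx uP) h mulKmx. Qed.

(** The a-th eigenvalue is the character of exponent [w a]; [Hj] is the infinitesimal generator of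
    the j-th coordinate subgroup. *)
Definition tor u := cd (fun a => mon u (w a)).
Definition Hj (j : 'I_r) := cd (fun a => (w a 0 j)%:~R).

Lemma tor_unit u : unitv u -> tor u \in unitmx.
Proof. by move=> hu; apply: cd_unit => a; apply: mon_neq0. Qed.

Lemma torM u v : tor u *m tor v = tor (fun j => u j * v j).
Proof. by rewrite cdM; apply: eq_cd => a; rewrite monMl. Qed.

Lemma eq_tor u v : u =1 v -> tor u = tor v.
Proof. by move=> uv; apply: eq_cd => a; apply: eq_mon. Qed.

Lemma tor1 : tor (fun=> 1) = 1%:M.
Proof. by rewrite -cd1; apply: eq_cd => a; rewrite mon1. Qed.

Definition tor_weight (m : 'rV[int]_r) e :=
  (forall j, eqv (dd 0 (Hj j) e) (PScale (m 0 j)%:~R e)) /\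
  (forall u A, unitv u -> A \in unitmx -> pev e (A *m tor u) = mon u m * pev e A).

Lemma tor_decomposition e : decomposable tor_weight e.
Proof.
pose E a := cd (fun b => (b == a)%:R).
have EE d a : cd d *m E a = d a *: E a.
  by rewrite cdM cdZ; apply: eq_cd => b; case: eqP => [->|]; rewrite ?mulr1 ?mulr0.
have EE' d a : E a *m cd d = d a *: E a.
  by rewrite cdM cdZ; apply: eq_cd => b; case: eqP => [->|]; rewrite ?mulr1 ?mul1r ?mul0r ?mulr0.
have E1 : \sum_a E a = 1%:M.
  rewrite -cd1 /E /cd -mulmx_suml -mulmx_sumr -raddf_sum; congr (_ *m diag_mx _ *m _).
  apply/rowP => b; rewrite summxE !mxE (bigD1 b) //= big1 ?addr0 ?mxE ?eqxx // => a.
  by rewrite mxE eq_sym => /negPf ->.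
apply: decomposition => [c|m m' e1 e2 [h1 t1] [h2 t2]|m c e1 [h1 t1]|i j|i j].
- split=> [j A uA|u A hu uA] /=; first by rewrite mxE mul0r.
  by rewrite mon0 mul1r.
- split=> [j A uA|u A hu uA] /=.
    by rewrite h1 // h2 //= mxE intrD; ring.
  by rewrite t1 // t2 // monD // mulrACA.
- split=> [j A uA|u A hu uA] /=; first by rewrite h1 //=; ring.
  by rewrite t1 // mulrCA.
- exists 'I_N, w, (fun a => mulE PX (cstE (E a)) i j); split=> [a|A uA]; last first.
    under eq_bigr do rewrite pev_mulX.
    by rewrite -summxE -mulmx_sumr E1 mulmx1.
  split=> [k A uA|u A hu uA].
    by rewrite dd_mulX //= !pev_mulX EE -scalemxAr mxE.
  by rewrite !pev_mulX -mulmxA EE -scalemxAr mxE.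
exists 'I_N, (fun a => - w a), (fun a => mulE (cstE (E a)) PV i j).
split=> [a|A uA]; last first.
  under eq_bigr do rewrite pev_mulV.
  by rewrite -summxE -mulmx_suml E1 mul1mx.
split=> [k A uA|u A hu uA].
  by rewrite dd_mulV //= !pev_mulV EE' -scaleNr -scalemxAl [LHS]mxE [(- w a) 0 k]mxE mulrNz.
rewrite !pev_mulV invmxM // ?tor_unit // invmx_cd => [|b]; last exact: mon_neq0.
by rewrite mulmxA EE' -scalemxAl mxE monN.
Qed.

(** On a translate of the torus a regular function is a Laurent polynomial, and [dd 0 (Hj j)] acts
    on it as the j-th Euler operator. Both statements use the same exponents and coefficients. *)
Lemma pev_tor e A : A \in unitmx -> exists (I : finType) (l : I -> 'rV[int]_r) (c : I -> C),
  (forall u, unitv u -> pev e (A *m tor u) = \sum_i c i * mon u (l i)) /\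
  (forall j u, unitv u ->
     pev (dd 0 (Hj j) e) (A *m tor u) = \sum_i c i * (l i 0 j)%:~R * mon u (l i)).
Proof.
move=> uA; have [I [l [f [hf fE]]]] := tor_decomposition e.
have uAt u : unitv u -> A *m tor u \in unitmx.
  by move=> hu; rewrite unitmx_mul uA tor_unit.
exists I, l, (fun i => pev (f i) A); split=> [u hu|j u hu].
  rewrite fE ?uAt //; apply: eq_bigr => i _; have [_ t] := hf i.
  by rewrite t // mulrC.
have eE : eqv e (psum (index_enum I) f) by move=> B uB; rewrite pev_sum fE.
rewrite (eqv_dd _ _ eE) ?uAt // -[dd 0 _ _]/(iter 1 (dd 0 (Hj j)) _).
rewrite iter_dd_sum pev_sum; apply: eq_bigr => i _ /=; have [h t] := hf i.
by rewrite h ?uAt //= t //; ring.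
Qed.

(* Interpolating [k |-> z ^ k] at the finitely many weights of [e] expresses
   [e (g *m tor u)] through the iterated derivatives of [e] at [g]. *)
Lemma tor_in (Gs : 'M[C]_N -> Prop) : alg_group Gs -> (forall j, lieA Gs (Hj j)) ->
  forall u, unitv u -> Gs (tor u).
Proof.
move=> GsG hH u hu.
have step g j z : Gs g -> z != 0 -> Gs (g *m tor (upd j z)).
  move=> gG z0; have ug := ag_unit GsG gG; have hz := upd_unit j z0.
  apply: (ag_closed GsG) => [|e he]; first by rewrite unitmx_mul ug tor_unit.
  have [I [l [f [hf fE]]]] := tor_decomposition e.
  have [q qE] : exists q : {poly C}, forall i, q.[(l i 0 j)%:~R] = z ^ l i 0 j.
    by apply: interpolation => a b /eqP; rewrite eqr_int => /eqP ->.
  have eE : eqv e (psum (index_enum I) f) by move=> B uB; rewrite pev_sum fE.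
  rewrite fE; last by rewrite unitmx_mul ug tor_unit.
  pose c i n := pev (iter n (dd 0 (Hj j)) (f i)) g.
  have cS i n : c i n.+1 = (l i 0 j)%:~R * c i n.
    by rewrite /c iterSr; have [h _] := hf i; rewrite (eqv_iter _ _ _ (h j)) // iter_ddZ.
  rewrite -[RHS](umb0 q); transitivity (umb (fun n => \sum_i c i n) q).
    rewrite umb_sumr; apply: eq_bigr => i _; have [_ t] := hf i.
    by rewrite t // mon_upd (umb_geom _ (cS i)) qE.
  apply: eq_umb => n; rewrite -[RHS](vanish_iter GsG n (hH j) he gG).
  by rewrite (eqv_iter _ _ _ eE) // iter_dd_sum pev_sum.
pose uk k (j : 'I_r) : C := if (j < k)%N then u j else 1.
have uk_in k : (k <= r)%N -> Gs (tor (uk k)).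
  elim: k => [_|k ih hk].
    by rewrite (@eq_tor _ (fun=> 1)) // tor1; apply: (ag_one GsG).
  pose j0 := Ordinal hk; have := step _ j0 (u j0) (ih (ltnW hk)) (hu j0).
  rewrite torM; congr (Gs _); apply: eq_tor => i; rewrite /uk /upd ltnS.
  have [->|ne] := eqVneq i j0; first by rewrite /= ltnn leqnn mul1r.
  have ne' : i != k :> nat by apply: contra ne => /eqP ik; apply/eqP/val_inj.
  by rewrite mulr1 [in RHS]leq_eqVlt (negPf ne').
rewrite (@eq_tor u (uk r)); first exact: uk_in.
by move=> j; rewrite /uk ltn_ord.
Qed.

End Torus.

(** * Subspaces given by predicates, and norms of vectorized matrices *)

Section SubspacePredicates.
Variables (K : fieldType) (V : vectType K) (P : V -> Prop).
Hypotheses (P0 : P 0) (PD : forall a u v, P u -> P v -> P (a *: u + v)).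

(** A subspace inside [P] is enlarged by a missing vector as long as there is one; the dimension
    bounds the number of enlargements. *)
Lemma vspace_of_pred : exists U : {vspace V}, forall v, P v <-> v \in U.
Proof.
have PU (U : {vspace V}) v : (forall u, u \in U -> P u) -> P v ->
    forall u, u \in (U + <[v]>)%VS -> P u.
  move=> hU hv u /memv_addP[u1 /hU hu1 [_ /vlineP[a ->] ->]].
  by rewrite addrC; apply: PD.
have grow k : (exists U : {vspace V}, forall v, P v <-> v \in U) \/
    exists U : {vspace V}, (forall u, u \in U -> P u) /\ (k <= \dim U)%N.
  elim: k => [|k [|[U [hU kU]]]]; [right|by left|].
    by exists 0%VS; split=> // u; rewrite memv0 => /eqP ->.
  have [hP|/existsNP[v /not_implyP[Pv vU]]] := pselect (forall v, P v -> v \in U).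
    by left; exists U => v; split; [apply: hP|apply: hU].
  right; exists (U + <[v]>)%VS; split; first exact: PU.
  rewrite (leq_ltn_trans kU) // ltnNge; apply/negP => h.
  have /eqP E : (U == U + <[v]>)%VS by rewrite eqEdim addvSl h.
  by apply: vU; rewrite E (subvP (addvSr U _)) ?memv_line.
have [//|[U [_ h]]] := grow (\dim {:V}).+1.
by have := leq_trans h (dimvS (subvf U)); rewrite ltnn.
Qed.

End SubspacePredicates.

Section RowNorms.
Variable C : numFieldType.

Lemma nrm_le_entries m n (A : 'M[C]_(m, n)) b :
  (forall i j, `|A i j| <= b) -> nrm A <= (m * n)%:R * b.
Proof.
move=> h; apply: (@le_trans _ _ (\sum_(i < m) \sum_(j < n) b)).
  by apply: ler_sum => i _; apply: ler_sum => j _.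
by rewrite !sumr_const !card_ord -mulrnA mulnC mulr_natl.
Qed.

Lemma nrm_mxvec m n (A : 'M[C]_(m, n)) : nrm (mxvec A) <= (m * n)%:R * nrm A.
Proof.
have := @nrm_le_entries 1 (m * n) (mxvec A) (nrm A); rewrite mul1n; apply=> i k; rewrite ord1.
by case/mxvec_indexP: k => a b; rewrite mxvecE entry_le_nrm.
Qed.

Lemma nrm_vec_mx m n (v : 'rV[C]_(m * n)) : nrm (vec_mx v : 'M_(m, n)) <= (m * n)%:R * nrm v.
Proof. by apply: nrm_le_entries => i j; rewrite mxE entry_le_nrm. Qed.

End RowNorms.

(** * The closure of the group generated by unipotents is open *)

Section Density.
Variables (C : numFieldType) (N : nat) (Gs : 'M[C]_N -> Prop).
Hypothesis GsG : alg_group Gs.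
Implicit Types (e : rexp C N) (A X Z g x : 'M[C]_N).

Inductive unip : 'M[C]_N -> Prop :=
  | unip1 : unip 1%:M
  | unipM g M Z z : unip g -> lieA Gs Z -> Z ^+ M.+1 = 0 -> unip (g *m expm M Z z).

Lemma expm_in M Z z : lieA Gs Z -> Z ^+ M.+1 = 0 -> Gs (expm M Z z).
Proof.
move=> hZ ZM; apply: (ag_closed GsG); first exact: expm_unit.
move=> e he; rewrite -[expm _ _ _]mul1mx; apply: pev_expm0 => // [|m].
  exact: unitmx1.
by apply: (vanish_iter GsG _ hZ he); apply: (ag_one GsG).
Qed.

Lemma unip_in x : unip x -> Gs x.
Proof.
elim=> [|g M Z z _ gG hZ ZM]; first exact: (ag_one GsG).
by apply: (ag_mul GsG) => //; apply: expm_in.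
Qed.

Lemma unip_mul x y : unip x -> unip y -> unip (x *m y).
Proof.
move=> hx; elim=> [|g M Z z _ ih hZ ZM]; first by rewrite mulmx1.
by rewrite mulmxA; apply: unipM.
Qed.

Lemma unip_inv x : unip x -> unip (invmx x).
Proof.
elim=> [|g M Z z hg ih hZ ZM]; first by rewrite invmx1; apply: unip1.
have ug := ag_unit GsG (unip_in hg).
rewrite invmxM ?expm_unit // invmx_expm //; apply: unip_mul ih.
by rewrite -[expm _ _ _]mul1mx; apply: unipM => //; apply: unip1.
Qed.

Definition vanishU e := forall x, unip x -> pev e x = 0.

(* The Zariski closure of the subgroup generated by the unipotent one-parameter
   subgroups; the point of this section is that it is open in [Gs]. *)
Definition G1 g := Gs g /\ forall e, vanishU e -> pev e g = 0.

(** The usual two steps for the closure of a subgroup: first the left factor is in [unip] and the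
    right one varies in the closure, then the right factor is fixed and the left one varies. *)
Lemma G1_mul g k : G1 g -> G1 k -> G1 (g *m k).
Proof.
move=> [gG hg] [kG hk]; split; first exact: (ag_mul GsG).
have ug := ag_unit GsG gG; have uk := ag_unit GsG kG; have u1 := unitmx1 C N.
have shift e y : Gs y -> (forall x, unip x -> pev e (x *m y) = 0) ->
    vanishU (ptrans 1%:M y e).
  move=> yG h x hx; have ux := ag_unit GsG (unip_in hx).
  by rewrite pev_trans ?(ag_unit GsG yG) // mul1mx h.
move=> e he; rewrite -[g *m k]mul1mx mulmxA -(pev_trans e u1 uk ug).
apply: hg; apply: shift => // x hx; have ux := ag_unit GsG (unip_in hx).
rewrite -[x *m k]mulmx1 -(pev_trans e ux u1 uk); apply: hk => y hy.
have uy := ag_unit GsG (unip_in hy).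
by rewrite pev_trans // mulmx1 he //; apply: unip_mul.
Qed.

Lemma G1_inv g : G1 g -> G1 (invmx g).
Proof.
move=> [gG hg]; split; first exact: (ag_inv GsG).
move=> e he; rewrite -(mev_V g) -(@pev_sub _ _ PV PX) ?mev_X ?mev_V ?invmxK //.
apply: hg => x hx; rewrite pev_sub ?mev_X ?mev_V ?invmxK //.
by apply: he; apply: unip_inv.
Qed.

Definition expE M Z (c : rexp C N) (i j : 'I_N) : rexp C N :=
  psum (index_enum 'I_M.+1) (fun m => PMul (iter m (PMul c) (PC 1))
    (PC ((m`!%:R)^-1 * (Z ^+ m) i j))).

Lemma mev_expE M Z c A : mev (expE M Z c) A = expm M Z (pev c A).
Proof.
apply/matrixP => i j; rewrite mxE pev_sum summxE; apply: eq_bigr => m _ /=.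
rewrite !mxE mulrA; congr (_ / _ * _).
by elim: (nat_of_ord m) => [|k ih]; rewrite ?expr0 //= ih exprS.
Qed.

Lemma mdir_expE M Z c A V : Z ^+ M.+1 = 0 -> pev c A = 0 ->
  mdir (expE M Z c) A V = pdir c A V *: Z.
Proof.
move=> ZM c0; apply/matrixP => i j; rewrite !mxE pdir_sum.
have E m : pdir (iter m (PMul c) (PC 1)) A V = if m == 1%N then pdir c A V else 0.
  case: m => [//|[|m]] /=; first by rewrite c0 mul0r addr0 mulr1.
  by rewrite c0 !mul0r mulr0 addr0.
have E2 m a : pdir (PMul (iter m (PMul c) (PC 1)) (PC a)) A V =
    (if m == 1%N then pdir c A V else 0) * a by rewrite -E /= mulr0 addr0.
under eq_bigr do rewrite E2.
case: M ZM => [|M'] ZM'.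
  by rewrite big_ord1 mul0r; move: ZM'; rewrite expr1 => ->; rewrite mxE mulr0.
rewrite (bigD1 (Ordinal (isT : (1 < M'.+2)%N))) //= big1 => [|m hm].
  by rewrite invr1 mul1r addr0 expr1.
by move: hm; rewrite -val_eqE /= => /negPf ->; rewrite mul0r.
Qed.

Section Spanning.
Variables (n : nat) (Z : 'I_n -> 'M[C]_N) (M : 'I_n -> nat).
Hypotheses (Zlie : forall i, lieA Gs (Z i)) (ZM : forall i, Z i ^+ (M i).+1 = 0)
  (Zspan : forall X, lieA Gs X -> exists c : 'I_n -> C, X = \sum_i c i *: Z i).

Let Zm : 'M[C]_(n, N * N) := \matrix_i mxvec (Z i).
Let Kr := cokermx Zm.

Lemma Zm_sub X : lieA Gs X -> (mxvec X <= Zm)%MS.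
Proof.
case/Zspan => c ->; rewrite linear_sum summx_sub // => i _.
rewrite linearZ scalemx_sub //=; have <- : row i Zm = mxvec (Z i) by rewrite rowK.
exact: row_sub.
Qed.

(** The differentials at 1 of functions vanishing on [Gs] form a space of functionals. A matrix
    killed by all of them is in the Lie algebra, hence in the span of the [Z i], hence killed by
    [phi]; by double annihilators [phi] belongs to the space. *)
Lemma dual_lie (phi : 'cV[C]_(N * N)) : Zm *m phi = 0 ->
  exists2 e, vanish Gs e & forall X, pdir e 1%:M X = (mxvec X *m phi) 0 0.
Proof.
move=> hphi.
pose F (f : 'rV[C]_(N * N)) :=
  exists2 e, vanish Gs e & forall X, pdir e 1%:M X = (mxvec X *m f^T) 0 0.
have [|a f1 f2 [e1 v1 h1] [e2 v2 h2]|U hU] := @vspace_of_pred _ _ F.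
- by exists (PC 0) => // X /=; rewrite trmx0 mulmx0 mxE.
- exists (PAdd (PScale a e1) e2) => [x xG|X] /=; first by rewrite v1 // v2 // mulr0 addr0.
  by rewrite h1 h2 linearD linearZ /= mulmxDr -scalemxAr [RHS]mxE [X in _ = X + _]mxE.
pose B : 'M[C]_(\dim U, N * N) := \matrix_i (vbasis U)`_i.
have BF i : F (row i B) by rewrite rowK; apply/hU/vbasis_mem/mem_nth; rewrite size_tuple.
have subB f : (f <= B)%MS -> F f.
  move=> /submxP[D ->]; rewrite mulmx_sum_row; apply/hU/memv_suml => i _.
  by apply/memvZ/hU.
suff /subB[e he eE] : (phi^T <= B)%MS by exists e => // X; rewrite eE trmxK.
rewrite submxE; apply/eqP/rowP => k; rewrite [RHS]mxE.
set y := col k (cokermx B); have yE : y = cokermx B *m delta_mx k 0 := colE _ _.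
have -> : (phi^T *m cokermx B) 0 k = (y^T *m phi) 0 0.
  transitivity ((phi^T *m y) 0 0); first by rewrite yE (mulmxA phi^T (cokermx B)) -(colE k (_ *m cokermx B)) [RHS]mxE.
  by rewrite -[phi in RHS]trmxK -trmx_mul [RHS]mxE.
pose X : 'M[C]_N := vec_mx y^T.
have yX : y^T = mxvec X by rewrite vec_mxK.
have hX : lieA Gs X.
  move=> e he; pose f : 'rV[C]_(N * N) := \row_l pdir e 1%:M (vec_mx (delta_mx 0 l)).
  have Ff : F f.
    exists e => // Y; rewrite -[Y in LHS]mxvecK.
    rewrite {1}(row_sum_delta (mxvec Y)) linear_sum pdir_sumr mxE.
    by apply: eq_bigr => l _; rewrite linearZ pdirZ !mxE.
  have fB : (f <= B)%MS.
    move/hU: Ff => /coord_vbasis ->; apply: summx_sub => i _; apply: scalemx_sub.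
    by rewrite -(rowK (fun i : 'I_(\dim U) => (vbasis U)`_i) i) row_sub.
  have f0 : f *m y = 0 by rewrite yE (mulmxA f (cokermx B)); move: fB; rewrite submxE => /eqP ->; rewrite mul0mx.
  have [e' he' eE'] := Ff.
  move/matrixP/(_ 0 0): f0; rewrite [RHS]mxE => <-.
  have -> : pdir e 1%:M X = (mxvec X *m f^T) 0 0.
    rewrite -[X in pdir _ _ X]mxvecK {1}(row_sum_delta (mxvec X)) linear_sum pdir_sumr mxE.
    by apply: eq_bigr => l _; rewrite linearZ pdirZ !mxE.
  by rewrite -yX -trmx_mul mxE.
by rewrite yX; have /submxP[D ->] := Zm_sub hX; rewrite -mulmxA hphi mulmx0 mxE.
Qed.

Let R := pinvmx Kr.
Let D : 'M[C]_(N * N, n) := (1%:M - Kr *m R) *m pinvmx Zm.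
Let cf X i : C := (mxvec X *m D) 0 i.

Lemma cfD a X Y i : cf (a *: X + Y) i = a * cf X i + cf Y i.
Proof. by rewrite /cf linearP mulmxDl -scalemxAl mxE [X in X + _]mxE. Qed.

(** [cf X] is a choice of coordinates on the [Z i], linear in [X]; the defect depends only on
    [mxvec X *m Kr], the component of [X] transverse to the Lie algebra. *)
Lemma cfE X : X - \sum_i cf X i *: Z i = vec_mx (mxvec X *m Kr *m R).
Proof.
have DZ : D *m Zm = 1%:M - Kr *m R.
  rewrite /D mulmxKpV // submxE -/Kr mulmxBl mul1mx mulmxKpV ?subrr //.
rewrite -[LHS]mxvecK; congr vec_mx; rewrite linearB linear_sum /=.
have -> : \sum_i mxvec (cf X i *: Z i) = mxvec X *m D *m Zm.
  rewrite mulmx_sum_row; apply: eq_bigr => i _; rewrite linearZ /=; congr (_ *: _).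
  by rewrite rowK.
by rewrite -mulmxA DZ mulmxBr mulmx1 opprB addrC subrK mulmxA.
Qed.

Definition cexp i : rexp C N := psum (index_enum 'I_N) (fun a =>
  psum (index_enum 'I_N) (fun b =>
    PScale (- cf (delta_mx a b) i) (PAdd (PX a b) (PC (- (a == b)%:R))))).

Lemma cf_sum X i : cf X i = \sum_a \sum_b X a b * cf (delta_mx a b) i.
Proof.
have cf0 : cf 0 i = 0 by rewrite /cf linear0 mul0mx mxE.
have cf_big (J : finType) (F : J -> 'M[C]_N) (c : J -> C) :
    cf (\sum_j c j *: F j) i = \sum_j c j * cf (F j) i.
  by elim: index_enum => [|j s ih]; rewrite ?big_nil // !big_cons cfD ih.
rewrite {1}[X]matrix_sum_delta.
transitivity (cf (\sum_a 1 *: \sum_b X a b *: delta_mx a b) i).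
  by under [in RHS]eq_bigr do rewrite scale1r.
by rewrite cf_big; apply: eq_bigr => a _; rewrite mul1r cf_big.
Qed.

Lemma pev_cexp i A : pev (cexp i) A = - cf (A - 1%:M) i.
Proof.
rewrite pev_sum cf_sum -sumrN; apply: eq_bigr => a _.
rewrite pev_sum -sumrN; apply: eq_bigr => b _ /=.
by rewrite !mxE mulNr mulrC.
Qed.

Lemma pdir_cexp i A V : pdir (cexp i) A V = - cf V i.
Proof.
rewrite pdir_sum cf_sum -sumrN; apply: eq_bigr => a _.
rewrite pdir_sum -sumrN; apply: eq_bigr => b _ /=.
by rewrite addr0 mulNr mulrC.
Qed.

(** The product of the exponentials of - [cf (A - 1%:M) i] times [Z i]: a unipotent factor that
    cancels, to first order, the part of [A - 1%:M] along the Lie algebra. *)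
Definition corr : 'I_N -> 'I_N -> rexp C N :=
  foldr (fun i acc => mulE (expE (M i) (Z i) (cexp i)) acc) (cstE 1%:M) (enum 'I_n).

Lemma corr_unip A : unip (mev corr A).
Proof.
rewrite /corr; elim: (enum 'I_n) => [|i s ih] /=; first by rewrite mev_cst; apply: unip1.
rewrite mev_mul; apply: unip_mul ih; rewrite mev_expE -[expm _ _ _]mul1mx.
by apply: unipM => //; apply: unip1.
Qed.

Lemma corr1 V : mev corr 1%:M = 1%:M /\ mdir corr 1%:M V = - \sum_i cf V i *: Z i.
Proof.
rewrite -big_enum /= /corr; elim: (enum 'I_n) => [|i s [ih1 ih2]] /=.
  by rewrite mev_cst mdir_cst big_nil oppr0.
have c0 : pev (cexp i) 1%:M = 0 by rewrite pev_cexp subrr /cf linear0 mul0mx mxE oppr0.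
rewrite mev_mul mdir_mul ih1 ih2 mev_expE c0 expm0 // !mulmx1 mul1mx.
by rewrite mdir_expE // pdir_cexp big_cons opprD scaleNr.
Qed.

(** A Newton step. The differential at 1 of A |-> A corr(A) sees only the transverse component of
    [g - 1%:M]; for [g] in the group this component is itself of second order, because by [dual_lie]
    each of its coordinates is the differential of a function vanishing on the group. *)
Lemma quadratic_step : exists2 K : C, 0 <= K & forall g, Gs g -> K * nrm (g - 1%:M) <= 1 ->
  exists2 x, unip x & nrm (g *m x - 1%:M) <= K * nrm (g - 1%:M) ^+ 2.
Proof.
have u1 := unitmx1 C N.
pose W := mulE PX corr.
have W1 : mev W 1%:M = 1%:M by rewrite mev_mul mev_X mul1mx; case: (corr1 0).
have dW V : mdir W 1%:M V = vec_mx (mxvec V *m Kr *m R).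
  rewrite mdir_mul mdir_X mev_X -cfE; case: (corr1 V) => -> ->.
  by rewrite mulmx1 mul1mx.
have /fin_all_exists[T1 hT1] (ij : 'I_N * 'I_N) :
    exists K, taylor_bound (W ij.1 ij.2) 1%:M K by apply: taylor.
have /fin_all_exists[T2 hT2] (k : 'I_(N * N)) : exists K, 0 <= K /\
    forall g, Gs g -> K * nrm (g - 1%:M) <= 1 ->
    `|(mxvec (g - 1%:M) *m Kr) 0 k| <= K * nrm (g - 1%:M) ^+ 2.
  have [|e he eE] := @dual_lie (col k Kr).
    by rewrite colE mulmxA mulmx_coker mul0mx.
  have [K [K0 _ hK]] := taylor e u1; exists K; split=> // g gG hg.
  have gE : 1%:M + (g - 1%:M) = g by rewrite addrC subrK.
  have [_ _ _] := hK _ hg; rewrite gE (he _ gG) (he _ (ag_one GsG)) subrr sub0r.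
  by rewrite normrN eE colE (mulmxA _ Kr) -(colE k (_ *m Kr)) mxE.
have T1_ge0 ij : 0 <= T1 ij by case: (hT1 ij).
have T2_ge0 k : 0 <= T2 k by case: (hT2 k).
pose K1 := \sum_ij T1 ij; pose K2 := \sum_k T2 k.
have K1_ge0 : 0 <= K1 by apply: sumr_ge0 => ij _.
have K2_ge0 : 0 <= K2 by apply: sumr_ge0 => k _.
have T1K ij : T1 ij <= K1 by rewrite /K1 (bigD1 ij) //= lerDl sumr_ge0.
have T2K k : T2 k <= K2 by rewrite /K2 (bigD1 k) //= lerDl sumr_ge0.
pose K3 : C := (N * N)%:R * ((N * N)%:R * K2 * nrm R).
have R0 := nrm_ge0 R.
have K3_ge0 : 0 <= K3 by rewrite ?mulr_ge0.
have K12 := addr_ge0 K1_ge0 K2_ge0.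
exists ((K1 + K2) + ((N * N)%:R * K1 + K3)) => [|g gG hg].
  by apply: addr_ge0 => //; apply: addr_ge0 => //; apply: mulr_ge0.
exists (mev corr g); first exact: corr_unip.
set V := g - 1%:M in hg *; set t := nrm V in hg *.
have t0 : 0 <= t := nrm_ge0 V.
have gE : g = 1%:M + V by rewrite /V addrC subrK.
have hK12 : (K1 + K2) * t <= 1.
  apply: le_trans hg; rewrite ler_wpM2r // lerDl addr_ge0 // mulr_ge0 //.
have hK1 ij : T1 ij * t <= 1.
  apply: le_trans hK12; rewrite ler_wpM2r // (le_trans (T1K ij)) // lerDl //.
have hK2 k : T2 k * t <= 1.
  apply: le_trans hK12; rewrite ler_wpM2r // (le_trans (T2K k)) // lerDr //.
have -> : g *m mev corr g - 1%:M = (mev W g - mev W 1%:M - mdir W 1%:M V) + mdir W 1%:M V.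
  by rewrite subrK W1 mev_mul mev_X.
apply: le_trans (nrmD _ _) _.
have b1 : nrm (mev W g - mev W 1%:M - mdir W 1%:M V) <= (N * N)%:R * K1 * t ^+ 2.
  rewrite -mulrA; apply: nrm_le_entries => i j; rewrite !mxE.
  have [_ _ /(_ V (hK1 (i, j)))[_ _ _]] := hT1 (i, j).
  rewrite -gE /= => h; apply: le_trans h _.
  by rewrite ler_wpM2r ?exprn_ge0.
have b2 : nrm (mdir W 1%:M V) <= K3 * t ^+ 2.
  rewrite dW; apply: le_trans (nrm_vec_mx _) _.
  rewrite /K3 -!mulrA ler_wpM2l //; apply: le_trans (nrmM _ _) _.
  rewrite (mulrA _ (nrm R)) [X in _ <= X](_ : _ = (N * N)%:R * (K2 * t ^+ 2) * nrm R); last by ring.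
  rewrite ler_wpM2r //; have := @nrm_le_entries _ 1 (N * N) (mxvec V *m Kr) (K2 * t ^+ 2).
  rewrite mul1n; apply=> i k; rewrite ord1; have [_ h] := hT2 k.
  by apply: le_trans (h g gG (hK2 k)) _; rewrite ler_wpM2r ?exprn_ge0.
apply: le_trans (lerD b1 b2) _; rewrite -mulrDl ler_wpM2r ?exprn_ge0 // lerDr //.
Qed.

Hypothesis archi : forall x : C, 0 < x -> exists n : nat, (2 ^- n : C) < x.

(** Iterating [quadratic_step] at least halves the distance to 1 each time, so there are unipotent
    products x with g x arbitrarily close to 1. Then x tends to g^-1, and a function vanishing on
    all x vanishes at g^-1 by continuity. *)
Lemma G1_open : exists2 K : C, 0 < K & forall g, Gs g -> K * nrm (g - 1%:M) <= 1 -> G1 g.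
Proof.
have [K0 K0_ge0 hK0] := quadratic_step.
exists (2 * K0 + 1) => [|g gG hg]; first by rewrite ltr_wpDl ?mulr_ge0.
suff : G1 (invmx g).
  by move/G1_inv; rewrite invmxK.
set t := nrm (g - 1%:M) in hg; have t0 : 0 <= t := nrm_ge0 _.
have hK : 2 * K0 * t <= 1 by rewrite (le_trans _ hg) // ler_wpM2r // lerDl.
have t1 : t <= 1 by rewrite (le_trans _ hg) // -[X in X <= _]mul1r ler_wpM2r // lerDr mulr_ge0.
have approx k : exists2 x, unip x & nrm (g *m x - 1%:M) <= t / 2 ^+ k.
  elim: k => [|k [x hx nx]].
    by exists 1%:M; [exact: unip1|rewrite mulmx1 expr0 divr1].
  set s := nrm _ in nx; have s0 : 0 <= s := nrm_ge0 _.
  have st : s <= t.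
    by rewrite (le_trans nx) // ler_pdivrMr ?exprn_gt0 // ler_peMr // exprn_ege1 // ler1n.
  have hs : 2 * K0 * s <= 1.
    by rewrite (le_trans _ hK) // ler_wpM2l // mulr_ge0.
  have gx : Gs (g *m x) by apply: (ag_mul GsG) => //; apply: unip_in.
  have [|y hy ny] := hK0 _ gx.
    by rewrite -/s (le_trans _ hs) // ler_wpM2r // ler_peMl // ler1n.
  exists (x *m y); first exact: unip_mul.
  rewrite mulmxA (le_trans ny) // -/s [2 ^+ k.+1]exprS invfM (mulrCA t).
  apply: (@le_trans _ _ (2^-1 * s)); last by rewrite ler_wpM2l ?invr_ge0.
  have -> : K0 * s ^+ 2 = 2 * K0 * s * (2^-1 * s) by field.
  by rewrite ler_piMl // mulr_ge0 ?invr_ge0.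
have ug := ag_unit GsG gG; split; first exact: (ag_inv GsG).
have ui : invmx g \in unitmx by rewrite unitmx_inv.
move=> e he; have [K [K_ge0 _ hTK]] := taylor e ui.
have q0 : 0 <= nrm (invmx g) := nrm_ge0 _; set q := nrm (invmx g) in q0.
apply/eqP; apply: contraT => e0; have {}e0 : 0 < `|pev e (invmx g)|.
  by rewrite normr_gt0.
have Q0 : 0 <= q * K * 2 + 1 by rewrite ?(addr_ge0, mulr_ge0).
have QK : 0 < (q * K * 2 + 1) * (`|pev e (invmx g)| + 1).
  by rewrite mulr_gt0 ?ltr_wpDl ?mulr_ge0 // ltW.
have e1 : 0 < `|pev e (invmx g)| / (`|pev e (invmx g)| + 1).
  by rewrite divr_gt0 // ltr_wpDl // ltW.
have Q1 : 0 < q * K * 2 + 1 by rewrite ltr_wpDl ?mulr_ge0.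
(* [k] is so large that within distance [q * 2 ^- k] of the inverse of [g] the function cannot pass
   from its value there to 0. *)
have [k hk] := archi (divr_gt0 e1 Q1).
have b_lt : (q * K * 2 + 1) * 2 ^- k < `|pev e (invmx g)| / (`|pev e (invmx g)| + 1).
  by rewrite mulrC -ltr_pdivlMr.
have b_small : (q * K + q * K + 1) * 2 ^- k < 1.
  have -> : q * K + q * K + 1 = q * K * 2 + 1 by ring.
  rewrite (lt_le_trans b_lt) // ler_pdivrMr ?mul1r ?lerDl //.
  by rewrite ltr_wpDl // ltW.
have [x hx nx] := approx k; set V := x - invmx g.
have VE : V = invmx g *m (g *m x - 1%:M) by rewrite mulmxBr mulmxA mulVmx // mul1mx mulmx1.
have b0 : 0 <= 2 ^- k :> C by rewrite invr_ge0 exprn_ge0.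
have nV : nrm V <= q * 2 ^- k.
  rewrite VE (le_trans (nrmM _ _)) // ler_wpM2l // (le_trans nx) //.
  by rewrite ler_piMl.
have small : (q * K * 2 + 1) * 2 ^- k < `|pev e (invmx g)|.
  rewrite (lt_le_trans b_lt) // ler_pdivrMr; last by rewrite ltr_wpDl // ltW.
  by rewrite mulrDr mulr1 lerDr mulr_ge0 // ltW.
have x_inv : invmx g + V = x by rewrite /V addrC subrK.
have KV : K * nrm V <= 1.
  have hb := b_small.
  rewrite (le_trans (ler_wpM2l K_ge0 nV)) // mulrA (mulrC K).
  apply: le_trans (ltW hb); rewrite ler_wpM2r //.
  by rewrite -addrA lerDl addr_ge0 // mulr_ge0.
have [_ V1 h1 h2] := hTK V KV.
rewrite x_inv he // sub0r in h2.
have : `|pev e (invmx g)| <= K * nrm V ^+ 2 + K * nrm V.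
  have -> : pev e (invmx g) = - (- pev e (invmx g) - pdir e (invmx g) V) - pdir e (invmx g) V.
    by rewrite opprB opprK addrAC subrr add0r.
  by rewrite (le_trans (ler_normB _ _)) // normrN lerD.
have hV2 : K * nrm V ^+ 2 + K * nrm V <= 2 * (K * nrm V).
  by rewrite mulr_natl mulr2n lerD2r ler_wpM2l // expr2 ler_piMl ?nrm_ge0.
move=> hh; have := le_lt_trans (le_trans hh hV2) _.
have -> : false = (`|pev e (invmx g)| < `|pev e (invmx g)|) by rewrite ltxx.
apply; apply: le_lt_trans small.
apply: (@le_trans _ _ ((q * K * 2) * 2 ^- k)).
  have -> : q * K * 2 * 2 ^- k = 2 * (K * (q * 2 ^- k)) by ring.
  by rewrite ler_wpM2l // ler_wpM2l.
by rewrite ler_wpM2r // ler_wpDr ?ler01.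
Qed.

End Spanning.
End Density.

(** * Functions determined by their derivatives at a point *)

Section TaylorPrinciple.
Variables (C : numFieldType) (N : nat) (Gs : 'M[C]_N -> Prop).
Hypothesis GsG : alg_group Gs.
Implicit Types (e : rexp C N) (A X Y Z g x : 'M[C]_N).

(** Connectedness in the form of propagation of locally constant properties. *)
Definition connectedA := forall (Q : 'M[C]_N -> Prop) g, Gs g -> Q 1%:M ->
  (forall x, Gs x -> exists2 d : C, 0 < d &
     forall y, Gs y -> nrm (y - x) <= d -> (Q x <-> Q y)) -> Q g.

Definition nilpotent_span := exists n (Z : 'I_n -> 'M[C]_N) (M : 'I_n -> nat),
  [/\ forall i, lieA Gs (Z i), forall i, Z i ^+ (M i).+1 = 0
    & forall X, lieA Gs X -> exists c : 'I_n -> C, X = \sum_i c i *: Z i].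

(** An open subgroup of a connected group is everything: [G1] is locally constant, since its
    translates are open too. *)
Lemma G1_all : (forall x : C, 0 < x -> exists n : nat, (2 ^- n : C) < x) ->
  connectedA -> nilpotent_span -> forall g, Gs g -> G1 Gs g.
Proof.
move=> archi conn [n [Z [M [Zlie ZM Zspan]]]] g gG.
have [K K0 hK] := G1_open GsG Zlie ZM Zspan archi.
apply: conn => // [|x xG].
  by split; [apply: (ag_one GsG)|move=> e he; apply: he; apply: unip1].
have ux := ag_unit GsG xG; have xiG := ag_inv GsG xG.
pose q := nrm (invmx x) + 1.
have q0 : 0 < q by rewrite ltr_wpDl ?nrm_ge0.
have K1 : 0 < K * q by rewrite mulr_gt0.
exists (K * q)^-1; first by rewrite invr_gt0.
move=> y yG hy; have yx : Gs (y *m invmx x) by apply: (ag_mul GsG).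
have g1 : G1 Gs (y *m invmx x).
  apply: hK => //; have -> : y *m invmx x - 1%:M = (y - x) *m invmx x.
    by rewrite mulmxBl mulmxV.
  rewrite (le_trans (ler_wpM2l (ltW K0) (nrmM _ _))) //.
  rewrite -(divff (lt0r_neq0 K1)) -mulrA ler_pM2l //.
  rewrite mulrC; apply: ler_pM; rewrite ?nrm_ge0 //.
  by rewrite /q lerDl.
split=> h.
  by rewrite -[y](mulmxKV ux); apply: G1_mul.
have -> : x = invmx (y *m invmx x) *m y.
  have uy := ag_unit GsG yG; rewrite invmxM ?unitmx_inv // invmxK.
  by rewrite mulmxKV.
by apply: G1_mul => //; apply: G1_inv.
Qed.

(** Along one nilpotent exponential the function and all its iterated derivatives are polynomials in
    the parameter, so their vanishing propagates from one end to the other; hence it reaches all of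
    [g0] times [unip], and the value of [e] then vanishes on the Zariski closure. *)
Lemma taylor_principle : (forall g, Gs g -> G1 Gs g) -> forall e g0, Gs g0 ->
  (forall s, (forall X, X \in s -> lieA Gs X) -> pev (Lw s e) g0 = 0) -> vanish Gs e.
Proof.
move=> hG1 e g0 g0G h0; have u0 := ag_unit GsG g0G; have u1 := unitmx1 C N.
have key x : unip Gs x -> forall s, (forall X, X \in s -> lieA Gs X) ->
    pev (Lw s e) (g0 *m x) = 0.
  elim=> [s hs|g M Z z hg ih hZ ZM s hs]; first by rewrite mulmx1 h0.
  have ug := ag_unit GsG (unip_in GsG hg).
  rewrite mulmxA; apply: pev_expm0 => // [|m]; first by rewrite unitmx_mul u0.
  have -> : iter m (dd 0 Z) (Lw s e) = Lw (nseq m Z ++ s) e.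
    by elim: m => //= m ->.
  by apply: ih => X; rewrite mem_cat => /orP[/nseqP[->]|/hs].
move=> y yG; have uy := ag_unit GsG yG; have uiy : invmx g0 *m y \in unitmx.
  by rewrite unitmx_mul unitmx_inv u0.
have -> : y = g0 *m (invmx g0 *m y) *m 1%:M by rewrite mulmx1 mulKVmx.
rewrite -(pev_trans e u0 u1 uiy).
have [_] : G1 Gs (invmx g0 *m y) by apply: hG1; apply: (ag_mul GsG) => //; apply: (ag_inv GsG).
apply=> x hx; rewrite pev_trans ?(ag_unit GsG (unip_in GsG hx)) // mulmx1.
exact: (key x hx [::]).
Qed.

End TaylorPrinciple.

(** * Zariski density of the conjugates of the torus *)

Section TorusConjugates.
Variables (C : numFieldType) (N r : nat) (Gs : 'M[C]_N -> Prop).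
Variables (P : 'M[C]_N) (w : 'I_N -> 'rV[int]_r).
Hypotheses (GsG : alg_group Gs) (uP : P \in unitmx)
  (HG : forall j, lieA Gs (Hj P w j)) (hG1 : forall g, Gs g -> G1 Gs g).
Implicit Types (e : rexp C N) (A X Y g : 'M[C]_N).
Let T := tor P w.

Definition tor_root_vector X := lieA Gs X /\ exists2 m : 'rV[int]_r, m != 0 &
  forall u, unitv u -> T u *m X = mon u m *: (X *m T u).

Hypothesis spanT : forall X, lieA Gs X -> exists (c : 'I_r -> C) (s : seq 'M[C]_N),
  (forall Y, Y \in s -> tor_root_vector Y) /\
  X = \sum_j c j *: Hj P w j + \sum_(Y <- s) Y.

Definition conj_vanish e :=
  forall g u, Gs g -> unitv u -> pev e (g *m T u *m invmx g) = 0.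

Lemma T_in u : unitv u -> Gs (T u).
Proof. exact: tor_in. Qed.

(** [dd X (- X)] is the infinitesimal action by conjugation. For y conjugate to a torus point, x |->
    e(x y x^-1) vanishes on the group, so its differential at 1 kills the Lie algebra. *)
Lemma conj_vanish_dd X e : lieA Gs X -> conj_vanish e -> conj_vanish (dd X (- X) e).
Proof.
move=> hX he g u gG hu; have [y yE] : exists y, y = g *m T u *m invmx g by eexists.
have ug := ag_unit GsG gG.
have yG : Gs y.
  by rewrite yE; do 2?[apply: (ag_mul GsG) => //]; [exact: T_in|exact: (ag_inv GsG)].
have uy := ag_unit GsG yG; have u1 := unitmx1 C N.
rewrite -yE pev_dd // mulmxN.
pose S := mulE (mulE PX (cstE y)) PV; pose S' := mulE (mulE PX (cstE (invmx y))) PV.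
have SE x : mev S x = x *m y *m invmx x by rewrite !mevE.
have S'E x : x \in unitmx -> mev S' x = invmx (mev S x).
  by move=> ux; rewrite !mevE !invmxM ?unitmx_mul ?ux ?unitmx_inv // invmxK mulmxA.
have vE : vanish Gs (psub S S' e).
  move=> x xG; have ux := ag_unit GsG xG; rewrite pev_sub ?S'E // SE.
  have -> : x *m y *m invmx x = (x *m g) *m T u *m invmx (x *m g).
    by rewrite invmxM // yE !mulmxA.
  by apply: he => //; apply: (ag_mul GsG).
have := hX _ vE; rewrite pdir_sub ?S'E //.
  rewrite SE !mdirE mulmx0 addr0 invmx1 !mul1mx !mulmx1 mulmxN.
  by [].
rewrite SE !mdirE mulmx0 !addr0 invmx1 !mul1mx !mulmx1 !mulmxN mulmxDr mulmxDl mulmxN mulNmx.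
by rewrite !mulmxA mulmxK // mulVmx // mul1mx opprD opprK addrC.
Qed.

(** Moving a conjugation field past left-invariant ones produces only words of the same length,
    because the left and right parts commute; this keeps the induction on length alive. *)
Lemma dd_Lw X s e : lieA Gs X -> (forall Y, Y \in s -> lieA Gs Y) ->
  exists ws : seq (seq 'M[C]_N),
    (forall v, v \in ws -> size v = size s /\ forall Y, Y \in v -> lieA Gs Y) /\
    eqv (dd X (- X) (Lw s e))
        (PAdd (Lw s (dd X (- X) e)) (psum ws (fun v => Lw v e))).
Proof.
move=> hX; elim: s => [_|Y s ih hs] /=.
  by exists [::]; split=> // A uA /=; rewrite addr0.
have [|ws [hws E]] := ih; first by move=> Z Zs; apply: hs; rewrite inE Zs orbT.
have hY : lieA Gs Y by apply: hs; rewrite inE eqxx.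
exists (((Y *m X - X *m Y) :: s) :: [seq Y :: v | v <- ws]); split=> [v|A uA].
  rewrite inE => /predU1P[->|/mapP[v' /hws[sv hv] ->]]; split=> /=.
  - by [].
  - move=> Z; rewrite inE => /predU1P[->|Zs]; first exact: lieA_bracket.
    by apply: hs; rewrite inE Zs orbT.
  - by rewrite sv.
  - by move=> Z; rewrite inE => /predU1P[->|/hv].
rewrite dd_comm // (eqv_dd _ _ E) //= -[dd 0 Y (psum _ _)]/(iter 1 (dd 0 Y) _).
rewrite iter_dd_sum !pev_sum big_map /= -addrA; congr (_ + _); rewrite addrC.
congr (_ + _); rewrite !mul0mx !mulmx0 subrr mulNmx mulmxN opprK addrC.
by [].
Qed.

Lemma pev_dd_linear A e (I : Type) (s : seq I) (c : I -> C) (X : I -> 'M[C]_N) :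
  A \in unitmx -> pev (dd 0 (\sum_(i <- s) c i *: X i) e) A =
  \sum_(i <- s) c i * pev (dd 0 (X i) e) A.
Proof.
move=> uA; rewrite pev_dd // mul0mx add0r mulmx_sumr pdir_sumr.
by apply: eq_bigr => i _; rewrite pev_dd // mul0mx add0r -scalemxAr pdirZ.
Qed.

(** Induction on the length of the word, for all [e] at once since [e] gets replaced by its
    conjugation derivatives. The outermost direction is split into torus directions and root
    directions. *)
Lemma conj_vanish_Lw k s e u : (size s <= k)%N -> (forall X, X \in s -> lieA Gs X) ->
  conj_vanish e -> unitv u -> pev (Lw s e) (T u) = 0.
Proof.
elim: k s e u => [|k ih] [|X s] e u //= sk hs he hu.
- by have := he 1%:M u (ag_one GsG) hu; rewrite mul1mx invmx1 mulmx1.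
- by have := he 1%:M u (ag_one GsG) hu; rewrite mul1mx invmx1 mulmx1.
have hX : lieA Gs X by apply: hs; rewrite inE eqxx.
have {}hs : forall Y, Y \in s -> lieA Gs Y by move=> Y Ys; apply: hs; rewrite inE Ys orbT.
have uT v : unitv v -> T v \in unitmx by apply: tor_unit.
(* Along the torus the shorter word is the zero Laurent polynomial, so its Euler derivatives vanish
   as well. *)
have hH j v : unitv v -> pev (dd 0 (Hj P w j) (Lw s e)) (T v) = 0.
  move=> hv; have [I [l [c [E1 E2]]]] := pev_tor w uP (Lw s e) (unitmx1 C N).
  have := E2 j v hv; rewrite mul1mx => ->.
  apply: (mon_twist1 (l := l) j (fun k => k%:~R)) hv => v' hv'.
  by rewrite -E1 // mul1mx; apply: ih.
(* The conjugation derivative at [T v] is [mon v (- m) - 1] times the left-invariant derivative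
   along [Y]. It vanishes by induction, and the factor is a nonzero Laurent polynomial. *)
have hY Y v : tor_root_vector Y -> unitv v -> pev (dd 0 Y (Lw s e)) (T v) = 0.
  move=> [hY [m m0 hm]]; move: v; pose f v := pev (dd 0 Y (Lw s e)) (T v).
  apply: (@laurent_domain _ _ f (fun v => mon v (- m) - 1)).
  - have [I [l [c [E1 _]]]] := pev_tor w uP (dd 0 Y (Lw s e)) (unitmx1 C N).
    by exists I, l, c => v hv; rewrite -E1 // mul1mx.
  - apply: (@eq_laurent _ _ (fun v => mon v (- m) + -1)) => //.
    by apply: laurentD; [apply: laurent_mon|apply: laurentC].
  - move=> v hv; have [ws [hws E]] := dd_Lw e hY hs.
    have : pev (dd Y (- Y) (Lw s e)) (T v) = 0.
      rewrite E ?uT //= ih //; last exact: conj_vanish_dd.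
      rewrite add0r pev_sum big_seq big1 // => v' /hws[sv hv']; apply: ih => //.
      by rewrite sv.
    rewrite pev_dd ?uT // mulmxN.
    have -> : Y *m T v = mon v (- m) *: (T v *m Y).
      by rewrite hm // scalerA monN // mulVf ?scale1r // mon_neq0.
    rewrite pdirB pdirZ /f pev_dd ?uT // mul0mx add0r => h.
    by rewrite -[RHS]h mulrBr mulr1 mulrC.
  have [j mj] : exists j, m 0 j != 0.
    apply/existsP; apply: contraT; rewrite negb_exists => /forallP h; case/eqP: m0.
    by apply/rowP => j; rewrite mxE; apply/eqP; move: (h j); rewrite negbK.
  have n2 : (2 : C) != 0 by rewrite pnatr_eq0.
  exists (upd j 2); first exact: upd_unit.
  rewrite mon_upd mxE subr_eq0; apply: contra mj => /eqP h.
  by rewrite -oppr_eq0; apply/eqP/(@expz2_inj C); rewrite h.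
have [c [s' [hs' ->]]] := spanT hX.
have -> : \sum_j c j *: Hj P w j + \sum_(Y <- s') Y =
    \sum_(b <- [:: true; false])
      1 *: (if b then \sum_j c j *: Hj P w j else \sum_(Y <- s') 1 *: Y).
  rewrite !big_cons big_nil !scale1r addr0; congr (_ + _).
  by apply: eq_bigr => Y _; rewrite scale1r.
rewrite pev_dd_linear ?uT // !big_cons big_nil addr0 !mul1r !pev_dd_linear ?uT //.
rewrite big1 => [|j _]; last by rewrite hH ?mulr0.
by rewrite add0r big_seq big1 // => Y /hs' ?; rewrite hY ?mulr0.
Qed.

(* A regular function vanishing on all conjugates of the torus vanishes:
   conjugating moves any torus point in all root directions, so that by
   induction all its derivatives vanish along the torus. *)
Theorem torus_conj_dense e : conj_vanish e -> vanish Gs e.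
Proof.
move=> he; apply: (taylor_principle GsG hG1 (ag_one GsG)) => s hs.
rewrite -(@tor1 _ _ r P w uP); apply: (@conj_vanish_Lw (size s)) => // j.
exact: oner_neq0.
Qed.

End TorusConjugates.

(** * Weights of sl2-modules *)

Section Sl2.
Variables (C : numFieldType) (V : lmodType C) (x y h : V -> V).
Hypotheses (xZ : forall a v, x (a *: v) = a *: x v) (yZ : forall a v, y (a *: v) = a *: y v).
Hypotheses (hx : forall v, h (x v) - x (h v) = 2 *: x v)
  (hy : forall v, h (y v) - y (h v) = - (2 *: y v))
  (xy : forall v, x (y v) - y (x v) = h v).
Variable evs : seq C.
Hypothesis evsP : forall v a, v != 0 -> h v = a *: v -> a \in evs.

(* Only finitely many eigenvalues are available, so a string of eigenvectors
   with pairwise distinct eigenvalues stops. *)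
Lemma eigen_string_stops (f : V -> V) (v : V) (a d : C) : d != 0 -> v != 0 ->
  (forall k, h (iter k f v) = (a + d * k%:R) *: iter k f v) -> (f 0 = 0) ->
  exists k, iter k f v != 0 /\ iter k.+1 f v = 0.
Proof.
move=> d0 v0 hk f0; have [k hk0] : exists k, iter k f v = 0.
  apply/not_existsP => hn.
  pose l := [seq a + d * k%:R | k <- iota 0 (size evs).+1].
  have ul : uniq l.
    rewrite map_inj_uniq ?iota_uniq // => i j /addrI/(mulfI d0)/eqP.
    by rewrite eqr_nat => /eqP.
  have : (size l <= size evs)%N.
    apply: uniq_leq_size => // _ /mapP[k _ ->]; apply: evsP (hk k).
    by apply/eqP; apply: hn.
  by rewrite size_map size_iota ltnn.
elim: k hk0 => [|k ih] hk0; first by move/eqP: v0.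
by have [/ih//|ne] := eqVneq (iter k f v) 0; exists k.
Qed.

Lemma scale0_map (f : V -> V) : (forall a v, f (a *: v) = a *: f v) -> f 0 = 0.
Proof. by move=> fZ; rewrite -[X in f X](scale0r 0) fZ scale0r. Qed.

(** One has x y^(m+1) v = (m+1) (a - m) y^m v; where the string of the y^m v stops, the left side is
    0, which forces [a] to be the index of the last nonzero vector. *)
Lemma sl2_highest_nat (v : V) a : v != 0 -> h v = a *: v -> x v = 0 ->
  exists n : nat, a = n%:R.
Proof.
move=> v0 hv xv.
have hyk k : h (iter k y v) = (a + - 2 * k%:R) *: iter k y v.
  elim: k => [|k ih]; first by rewrite mulr0 addr0.
  rewrite iterS; move/(canRL (subrK _)): (hy (iter k y v)) => ->.
  rewrite ih yZ -scaleNr -scalerDl; congr (_ *: _).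
  by rewrite -[k.+1]addn1 natrD; ring.
have n2 : - 2 != 0 :> C by rewrite oppr_eq0 pnatr_eq0.
have [k [k0 kS]] := eigen_string_stops n2 v0 hyk (scale0_map yZ).
have xyk m : x (iter m.+1 y v) = (m.+1%:R * (a - m%:R)) *: iter m y v.
  elim: m => [|m ih].
    move/(canRL (subrK _)): (xy v) => /= ->.
    by rewrite xv (scale0_map yZ) addr0 hv mul1r subr0.
  rewrite iterS; move/(canRL (subrK _)): (xy (iter m.+1 y v)) => ->.
  rewrite ih yZ hyk -scalerDl; congr (_ *: _).
  by rewrite -!natr1; ring.
have := xyk k; rewrite kS (scale0_map xZ) => /esym/eqP.
rewrite scaler_eq0 (negPf k0) orbF mulf_eq0 pnatr_eq0 /= subr_eq0 => /eqP ->.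
by exists k.
Qed.

Lemma sl2_weight_int (v : V) a : v != 0 -> h v = a *: v -> exists n : int, a = n%:~R.
Proof.
move=> v0 hv.
have hxk k : h (iter k x v) = (a + 2 * k%:R) *: iter k x v.
  elim: k => [|k ih]; first by rewrite mulr0 addr0.
  rewrite iterS; move/(canRL (subrK _)): (hx (iter k x v)) => ->.
  rewrite ih xZ -scalerDl; congr (_ *: _).
  by rewrite -[k.+1]addn1 natrD; ring.
have n2 : 2 != 0 :> C by rewrite pnatr_eq0.
have [k [k0 kS]] := eigen_string_stops n2 v0 hxk (scale0_map xZ).
have [n an] := sl2_highest_nat k0 (hxk k) kS.
exists (n%:Z - (2 * k)%:Z); rewrite intrD mulrNz -[n%:~R]/(n%:R : C) -an.
by rewrite -[(2 * k)%:~R]/((2 * k)%:R : C) natrM addrK.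
Qed.

End Sl2.

(** * Generic vectors, diagonal matrices and adjoint actions *)

Section GenericVector.
Variables (C : numFieldType) (V : vectType C) (U : {vspace V}).

Definition is_linfun (f : V -> C) := forall a x y, f (a *: x + y) = a * f x + f y.

(** One form is added at a time: on the line from the current vector towards a vector where the new
    form is nonzero, each form restricts to a nonzero polynomial, so their product has a nonzero
    value. *)
Lemma generic_vector (I : finType) (F : I -> V -> C) :
  (forall i, is_linfun (F i)) -> (forall i, exists2 x, x \in U & F i x != 0) ->
  exists2 x, x \in U & forall i, F i x != 0.
Proof.
move=> FL F0; suff [x xU hx] : exists2 x, x \in U & all (fun i => F i x != 0) (enum I).
  by exists x => // i; have /allP := hx; apply; rewrite mem_enum.
elim: (enum I) => [|i s [x xU hx]]; first by exists 0 => //; exact: mem0v.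
have [x1 x1U hx1] := F0 i.
pose p j : {poly C} := (F j x)%:P + F j x1 *: 'X.
have pE j t : (p j).[t] = F j (t *: x1 + x).
  by rewrite FL hornerD hornerC hornerZ hornerX addrC mulrC.
have p0 j : F j x1 != 0 \/ F j x != 0 -> p j != 0.
  case=> h; apply: contra_neq h => p0.
    by have := coefD (F j x)%:P (F j x1 *: 'X) 1; rewrite -/(p j) p0 coefC coefZ coefX coef0
      mulr1 add0r.
  by have := pE j 0; rewrite p0 horner0 scale0r add0r.
have q0 : \prod_(j <- i :: s) p j != 0.
  rewrite prodf_seq_neq0 /= p0 /=; last by left.
  by apply/allP => j js; rewrite p0 //; right; move/allP: hx => /(_ j js).
have [t ht] : exists t, (\prod_(j <- i :: s) p j).[t] != 0.
  apply/not_existsP => h; case/eqP: q0; apply: poly_eq0_values => t _.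
  by apply/eqP; apply: contrapT => /negP; apply: h.
exists (t *: x1 + x); first by rewrite memvD ?memvZ.
apply/allP => j js; rewrite -pE; apply: contra ht => /eqP hj.
by rewrite horner_prod (big_rem j) //= hj mul0r.
Qed.

End GenericVector.

Section DiagonalMatrices.
Variables (C : numFieldType) (N : nat) (P : 'M[C]_N).
Hypothesis uP : P \in unitmx.
Implicit Types (X Y : 'M[C]_N) (d : 'I_N -> C).

(* The matrix entries of [X] in the eigenbasis. *)
Definition pent X a b : C := (P *m X *m invmx P) a b.

Lemma pent_cdl d X a b : pent (cd P d *m X) a b = d a * pent X a b.
Proof.
rewrite /pent /cd !mulmxA mulmxV // mul1mx -!mulmxA mul_diag_mx.
by rewrite [LHS]mxE [X in X * _]mxE.
Qed.

Lemma pent_cdr d X a b : pent (X *m cd P d) a b = pent X a b * d b.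
Proof.
rewrite /pent /cd !mulmxA mulmxK //.
by rewrite mul_mx_diag [LHS]mxE [X in _ * X]mxE.
Qed.

Lemma pent_inj X Y : (forall a b, pent X a b = pent Y a b) -> X = Y.
Proof.
move=> h; have {}h : P *m X *m invmx P = P *m Y *m invmx P by apply/matrixP.
by rewrite -[X](mulKmx uP) -[P *m X](mulmxKV uP) h mulmxKV // mulKmx.
Qed.

Lemma pent_neq0 X : X != 0 -> exists a b, pent X a b != 0.
Proof.
move=> X0; apply: contrapT => h; case/eqP: X0; apply: pent_inj => a b.
rewrite [RHS](_ : _ = 0); last by rewrite /pent mulmx0 mul0mx mxE.
by apply/eqP; apply: contrapT => /negP hab; apply: h; exists a, b.
Qed.

Lemma pentZ c X a b : pent (c *: X) a b = c * pent X a b.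
Proof. by rewrite /pent -scalemxAr -scalemxAl [LHS]mxE. Qed.

Lemma pentB X Y a b : pent (X - Y) a b = pent X a b - pent Y a b.
Proof. by rewrite /pent mulmxBr mulmxBl [LHS]mxE [X in _ + X]mxE. Qed.

Lemma pent_cd d a b : pent (cd P d) a b = d a *+ (a == b).
Proof.
by rewrite /pent /cd !mulmxA mulmxV // mul1mx mulmxK // !mxE.
Qed.

Lemma ad_cd_entry d X c : cd P d *m X - X *m cd P d = c *: X ->
  forall a b, pent X a b != 0 -> d a - d b = c.
Proof.
move=> h a b hab; apply: (mulIf hab); rewrite -(pentZ c) -h pentB pent_cdl pent_cdr.
by rewrite mulrBl (mulrC (pent _ _ _)).
Qed.

Lemma comm_cd_entry d' c X :
  (forall a b, pent X a b != 0 -> d' a = c * d' b) -> cd P d' *m X = c *: (X *m cd P d').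
Proof.
move=> h; apply: pent_inj => a b; rewrite pentZ pent_cdl pent_cdr.
have [->|/h ->] := eqVneq (pent X a b) 0; first by rewrite mulr0 mul0r mulr0.
by ring.
Qed.

Lemma ad_cd_eigenvalue d X c : X != 0 -> cd P d *m X - X *m cd P d = c *: X ->
  exists a b, d a - d b = c.
Proof.
by move=> /pent_neq0[a [b hab]] /ad_cd_entry h; exists a, b; apply: h.
Qed.

(* Powers of [X] are eigenvectors of [ad (cd P d)] for distinct eigenvalues. *)
Lemma ad_cd_nilpotent d X c : c != 0 -> cd P d *m X - X *m cd P d = c *: X ->
  exists m, X ^+ m.+1 = 0.
Proof.
move=> c0 hX; have hk k : cd P d *m X ^+ k - X ^+ k *m cd P d = (k%:R * c) *: X ^+ k.
  elim: k => [|k ih]; first by rewrite expr0 -[1]/(1%:M) mulmx1 mul1mx subrr mul0r scale0r.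
  have -> : cd P d *m X ^+ k.+1 - X ^+ k.+1 *m cd P d =
     (cd P d *m X ^+ k - X ^+ k *m cd P d) *m X + X ^+ k *m (cd P d *m X - X *m cd P d).
    rewrite exprSr -[X ^+ k * X]/(X ^+ k *m X) mulmxBl mulmxBr !mulmxA addrA.
    by rewrite subrK.
  rewrite ih hX -scalemxAl -scalemxAr -[X ^+ k *m X]exprSr -scalerDl.
  by rewrite -natr1 mulrDl mul1r.
apply/not_existsP => hn.
have hne k : X ^+ k.+1 != 0 by apply/eqP; apply: hn.
pose evs := [seq d ab.1 - d ab.2 | ab : 'I_N * 'I_N].
pose l := [seq k.+1%:R * c | k <- iota 0 (size evs).+1].
have ul : uniq l.
  rewrite map_inj_uniq ?iota_uniq // => i j /(mulIf c0)/eqP.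
  by rewrite eqr_nat => /eqP[].
have : (size l <= size evs)%N.
  apply: uniq_leq_size => // _ /mapP[k _ ->].
  have [a [b <-]] := ad_cd_eigenvalue (hne k) (hk k.+1).
  by apply: (map_f _ (mem_enum _ (a, b))) || apply/mapP; exists (a, b); rewrite ?mem_enum.
by rewrite size_map size_iota ltnn.
Qed.

End DiagonalMatrices.
Section AdExp.
Variables (C : numFieldType) (N M : nat) (X : 'M[C]_N).
Hypothesis XM : X ^+ M.+1 = 0.
Implicit Types (W : 'M[C]_N) (P Q : 'M[{poly C}]_N).

Lemma dmx_inj P Q : dmx P = dmx Q -> hmx 0 P = hmx 0 Q -> P = Q.
Proof.
move=> dPQ hPQ; apply/matrixP => i j; apply/eqP; rewrite -subr_eq0; apply/eqP.
rewrite [LHS]poly_deriv0 ?derivB.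
  rewrite hornerD hornerN; move/matrixP/(_ i j): hPQ; rewrite !mxE => ->.
  by rewrite subrr.
by move/matrixP/(_ i j): dPQ; rewrite !mxE => ->; rewrite subrr.
Qed.

Let AdP W := expP M X 1 *m map_mx polyC W *m expP M X (-1).

Lemma dmx_AdP W : dmx (AdP W) = AdP (X *m W - W *m X).
Proof.
rewrite /AdP !dmxM dmxC mulmx0 addr0 !dmx_expP // polyCN polyC1 scale1r scaleN1r mulmxN.
rewrite -(expP_comm M X (-1)) raddfB /= !map_mxM mulmxBr mulmxBl !mulmxA.
by [].
Qed.

Lemma hmx_AdP z W : hmx z (AdP W) = expm M X z *m W *m expm M X (- z).
Proof. by rewrite /AdP !hmxM hmxC !hmx_expP mul1r mulN1r. Qed.

(** The derivative in z of Ad(exp zX) W is Ad(exp zX) [X, W]. Integrating repeatedly, starting from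
    the bracket that vanishes, stops the exponential series at degree 2. *)
Lemma Ad_expm W W1 W2 z : X *m W - W *m X = W1 -> X *m W1 - W1 *m X = W2 ->
  X *m W2 - W2 *m X = 0 ->
  expm M X z *m W *m invmx (expm M X z) = W + z *: W1 + (z ^+ 2 / 2) *: W2.
Proof.
move=> h1 h2 h3; rewrite invmx_expm // -hmx_AdP.
have at0 V : hmx 0 (AdP V) = V by rewrite hmx_AdP oppr0 expm0 // mul1mx mulmx1.
pose cM (V : 'M[C]_N) : 'M[{poly C}]_N := map_mx polyC V.
have dX2 : (2^-1 *: 'X^2)^`() = 'X :> {poly C}.
  rewrite derivZ derivXn /= expr1 -mul_polyC mulrnAr -mulrnAl -polyCMn.
  by rewrite -[_ *+ 2]mulr_natr mulVf ?mul1r // pnatr_eq0.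
have E2 : AdP W2 = cM W2.
  apply: dmx_inj; last by rewrite at0 hmxC.
  rewrite dmx_AdP h3 dmxC /AdP map_mx0 mulmx0 mul0mx //.
have E1 : AdP W1 = cM W1 + 'X *: cM W2.
  apply: dmx_inj; rewrite ?dmx_AdP ?h2 ?E2 ?at0; apply/matrixP => i j; rewrite !mxE.
    by rewrite derivD derivM derivX !derivC mul1r mulr0 addr0 add0r.
  by rewrite hornerD hornerM hornerX !hornerC mul0r addr0.
have -> : AdP W = cM W + 'X *: cM W1 + (2^-1 *: 'X^2) *: cM W2.
  apply: dmx_inj; rewrite ?dmx_AdP ?h1 ?E1 ?at0; apply/matrixP => i j; rewrite !mxE.
    by rewrite !derivD !derivM dX2 derivX !derivC !mulr0 !addr0 add0r mul1r.
  by rewrite !hornerD !hornerM hornerX hornerZ hornerXn !hornerC expr0n mulr0 !mul0r !addr0.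
apply/matrixP => i j; rewrite !mxE !hornerD !hornerM hornerX hornerZ hornerXn !hornerC.
by rewrite [X in _ + X * _]mulrC.
Qed.

End AdExp.

Section LinearExpressions.
Variables (C : numFieldType) (N : nat).
Implicit Types (f : 'M[C]_N -> C) (A V X : 'M[C]_N).

Lemma linfun0 f : is_linfun f -> f 0 = 0.
Proof. by move=> fL; have := fL (-1) 0 0; rewrite scaler0 addr0 mulN1r addNr. Qed.

Lemma linfunZ f a X : is_linfun f -> f (a *: X) = a * f X.
Proof. by move=> fL; have := fL a X 0; rewrite !addr0 linfun0 // addr0. Qed.

Lemma linfunD f X Y : is_linfun f -> f (X + Y) = f X + f Y.
Proof. by move=> fL; have := fL 1 X Y; rewrite scale1r mul1r. Qed.

Lemma linfun_sum f (I : Type) (s : seq I) (F : I -> 'M[C]_N) :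
  is_linfun f -> f (\sum_(i <- s) F i) = \sum_(i <- s) f (F i).
Proof.
move=> fL; elim: s => [|i s ih]; first by rewrite !big_nil linfun0.
by rewrite !big_cons linfunD // ih.
Qed.

Lemma linfun_delta f X : is_linfun f -> f X = \sum_a \sum_b f (delta_mx a b) * X a b.
Proof.
move=> fL; rewrite {1}[X]matrix_sum_delta linfun_sum //; apply: eq_bigr => a _.
by rewrite linfun_sum //; apply: eq_bigr => b _; rewrite linfunZ // mulrC.
Qed.

Definition linE f (S : 'I_N -> 'I_N -> rexp C N) : rexp C N :=
  psum (index_enum 'I_N) (fun a => psum (index_enum 'I_N) (fun b =>
    PScale (f (delta_mx a b)) (S a b))).

Lemma pev_linE f S A : is_linfun f -> pev (linE f S) A = f (mev S A).
Proof.
move=> fL; rewrite pev_sum linfun_delta //; apply: eq_bigr => a _.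
by rewrite pev_sum; apply: eq_bigr => b _; rewrite /= mxE.
Qed.

Lemma pdir_linE f S A V : is_linfun f -> pdir (linE f S) A V = f (mdir S A V).
Proof.
move=> fL; rewrite pdir_sum linfun_delta //; apply: eq_bigr => a _.
by rewrite pdir_sum; apply: eq_bigr => b _; rewrite /= mxE.
Qed.

End LinearExpressions.

(** * Cartan subalgebra, roots and coroots inside matrices *)

Section RootStructure.
Variables (C : numClosedFieldType) (N : nat) (Gs : 'M[C]_N -> Prop).
Variables (h : {vspace 'M[C]_N}) (r : nat) (al : 'I_r -> 'M[C]_N -> C).
Variable B : 'M[C]_N -> 'M[C]_N -> C.
Implicit Types (X Y Z H : 'M[C]_N).

Definition br X Y := X *m Y - Y *m X.

Definition root_vec (b : 'M[C]_N -> C) X :=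
  [/\ lieA Gs X, X != 0 & forall H, H \in h -> br H X = b H *: X].

Hypotheses (GsG : alg_group Gs)
  (hL : forall H, H \in h -> lieA Gs H)
  (hbr : forall H H', H \in h -> H' \in h -> br H H' \in h)
  (hself : forall X, lieA Gs X -> (forall Y, Y \in h -> br X Y \in h) -> X \in h)
  (alL : forall i, is_linfun (al i))
  (alfree : forall c : 'I_r -> C,
     (forall H, H \in h -> \sum_i c i * al i H = 0) -> forall i, c i = 0)
  (alsep : forall H, H \in h -> (forall i, al i H = 0) -> H = 0)
  (dimh : \dim h = r)
  (alroot : forall i, exists X, root_vec (al i) X)
  (posneg : forall b, is_linfun b -> (exists2 H, H \in h & b H != 0) ->
     (exists X, root_vec b X) -> exists c : 'I_r -> nat,
       (forall H, H \in h -> b H = \sum_i (c i)%:R * al i H) \/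
       (forall H, H \in h -> b H = - \sum_i (c i)%:R * al i H))
  (BL : forall Z, is_linfun (B^~ Z)) (BR : forall Z, is_linfun (B Z))
  (Bnd : forall X, lieA Gs X -> (forall Y, lieA Gs Y -> B X Y = 0) -> X = 0)
  (Binv : forall g X Y, Gs g -> lieA Gs X -> lieA Gs Y ->
     B (g *m X *m invmx g) (g *m Y *m invmx g) = B X Y).

Lemma brD X Y Z : br X (Y + Z) = br X Y + br X Z.
Proof. by rewrite /br mulmxDr mulmxDl opprD addrACA. Qed.

Lemma brZ X c Y : br X (c *: Y) = c *: br X Y.
Proof. by rewrite /br -scalemxAr -scalemxAl scalerBr. Qed.

Lemma brZl X c Y : br (c *: X) Y = c *: br X Y.
Proof. by rewrite /br -scalemxAr -scalemxAl scalerBr. Qed.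

Lemma brNl X Y : br (- X) Y = - br X Y.
Proof. by rewrite -scaleN1r brZl scaleN1r. Qed.

Lemma brC X Y : br X Y = - br Y X.
Proof. by rewrite /br opprB. Qed.

Lemma br_jacobi X Y Z : br (br X Y) Z = br X (br Y Z) - br Y (br X Z).
Proof.
rewrite /br !mulmxBr !mulmxBl !mulmxA.
move: (X *m Y *m Z) (Y *m X *m Z) (Z *m X *m Y) (Z *m Y *m X) (X *m Z *m Y) (Y *m Z *m X).
by move=> a b c d e f; apply/matrixP => i j; rewrite !mxE; ring.
Qed.

Lemma br_leibniz Z X Y : br Z (br X Y) = br (br Z X) Y + br X (br Z Y).
Proof. by rewrite br_jacobi subrK. Qed.

Lemma br_lie X Y : lieA Gs X -> lieA Gs Y -> lieA Gs (br X Y).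
Proof. exact: lieA_bracket. Qed.

(** A bracket of two elements of [h] acts by 0 on every simple root vector, so every simple root
    kills it; the simple roots separate [h]. *)
Lemma cartan_comm H H' : H \in h -> H' \in h -> H *m H' = H' *m H.
Proof.
move=> hH hH'; apply/eqP; rewrite -subr_eq0 -/(br H H'); apply/eqP.
apply: alsep => [|i]; first exact: hbr.
have [X [_ X0 hX]] := alroot i.
apply/eqP; have : al i (br H H') *: X = 0.
  rewrite -hX ?hbr // br_jacobi !hX // !brZ !hX // !scalerA mulrC.
  by rewrite subrr.
by move/eqP; rewrite scaler_eq0 (negPf X0) orbF.
Qed.

(** Let v be the last nonzero matrix among the X Nn^k. Then v Nn = 0, so Nn v = a v, and a nilpotent
    matrix has no nonzero eigenvalue. *)
Lemma nilp_eigen (Nn X : 'M[C]_N) a : Nn ^+ N = 0 -> X != 0 -> br Nn X = a *: X -> a = 0.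
Proof.
move=> nil X0 hX; apply/eqP; apply: contraT => a0.
have [k hk0 hkS] : exists2 k, X *m Nn ^+ k != 0 & X *m Nn ^+ k.+1 = 0.
  have [m] : exists m, X *m Nn ^+ m = 0 by exists N; rewrite nil mulmx0.
  elim: m => [|m ih]; first by rewrite expr0 -[1]/(1%:M) mulmx1 => /eqP; rewrite (negPf X0).
  by move=> hm; have [/ih//|ne] := eqVneq (X *m Nn ^+ m) 0; exists m.
set v := X *m Nn ^+ k in hk0.
have vN : v *m Nn = 0.
  by rewrite /v -mulmxA -[Nn ^+ k *m Nn]/(Nn ^+ k * Nn) -exprSr.
have Nv : Nn *m v = a *: v.
  rewrite /v mulmxA scalemxAl -hX /br mulmxBl -!mulmxA.
  rewrite -[Nn *m Nn ^+ k]/(Nn * Nn ^+ k) -exprS hkS subr0 mulmxA.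
  by [].
have NkV m : Nn ^+ m *m v = a ^+ m *: v.
  elim: m => [|m ih]; first by rewrite !expr0 scale1r -[1]/(1%:M) mul1mx.
  rewrite exprSr -[Nn ^+ m * Nn]/(Nn ^+ m *m Nn) -mulmxA Nv -scalemxAr ih scalerA.
  by rewrite -exprS.
have := NkV N; rewrite nil mul0mx => /esym/eqP.
by rewrite scaler_eq0 expf_eq0 (negPf a0) andbF (negPf hk0).
Qed.

(** The nilpotent part of H lies in the Lie algebra and commutes with [h], so it lies in [h] by
    self-normalization. Being nilpotent it is killed by all simple roots, hence zero, and H is
    diagonalizable; commuting diagonalizable matrices are simultaneously so. *)
Lemma cartan_diag : exists2 P, P \in unitmx & forall H, H \in h -> exists d, H = cd P d.
Proof.
have diagH H : H \in h -> diagonalizable H.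
  move=> hH; have [Nn [NL Nnil Ncomm Nd]] := jordan_lie GsG (hL hH).
  apply: Nd; have NnC Y : Y \in h -> br Nn Y = 0.
    by move=> hY; rewrite /br (Ncomm Y) ?subrr // cartan_comm.
  have Nh : Nn \in h by apply: hself => // Y hY; rewrite NnC // mem0v.
  apply: alsep => // i; have [X [XL X0 hX]] := alroot i.
  by apply: (nilp_eigen Nnil X0); rewrite hX.
have /codiagonalizableP[P uP /allP hP] :
    {in vbasis h &, forall A A', comm_mx A A'} /\ {in vbasis h, forall A, diagonalizable A}.
  split=> [A A' hA hA'|A hA]; first exact: cartan_comm (vbasis_mem hA) (vbasis_mem hA').
  exact/diagH/vbasis_mem.
exists P => // H hH; exists (fun a => pent P H a a); apply: (pent_inj uP) => a b.
rewrite pent_cd //; have [->|ab] := eqVneq a b; first by rewrite mulr1n.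
rewrite (coord_vbasis hH) mulr0n /pent mulmx_sumr mulmx_suml summxE big1 // => i _.
rewrite -scalemxAr -scalemxAl mxE; apply/eqP; rewrite mulf_eq0; apply/orP; right.
apply/eqP; have /hP/= : (vbasis h)`_i \in vbasis h by rewrite mem_nth ?size_tuple.
by move=> /(diagonalizable_forP _ uP); apply.
Qed.

Definition bilE (S1 S2 : 'I_N -> 'I_N -> rexp C N) : rexp C N :=
  psum (index_enum 'I_N) (fun a => psum (index_enum 'I_N) (fun b =>
    PMul (S1 a b) (linE (B (delta_mx a b)) S2))).

Lemma pev_bilE S1 S2 A : pev (bilE S1 S2) A = B (mev S1 A) (mev S2 A).
Proof.
rewrite pev_sum (linfun_delta _ (BL (mev S2 A))); apply: eq_bigr => a _.
by rewrite pev_sum; apply: eq_bigr => b _; rewrite /= pev_linE // mulrC mxE.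
Qed.

Lemma pdir_bilE S1 S2 A V : pdir (bilE S1 S2) A V =
  B (mdir S1 A V) (mev S2 A) + B (mev S1 A) (mdir S2 A V).
Proof.
rewrite pdir_sum (linfun_delta _ (BL (mev S2 A))) (linfun_delta _ (BL (mdir S2 A V))).
rewrite -big_split; apply: eq_bigr => a _ /=.
rewrite pdir_sum -big_split; apply: eq_bigr => b _ /=.
by rewrite pev_linE // pdir_linE // mulrC !mxE [X in _ + X]mulrC.
Qed.

(** The derivative at 1 of the group invariance of [B], as a regular function of the conjugating
    element. *)
Lemma B_ad_inv Z X Y : lieA Gs Z -> lieA Gs X -> lieA Gs Y ->
  B (br Z X) Y + B X (br Z Y) = 0.
Proof.
move=> hZ hX hY; pose S (W : 'M[C]_N) : 'I_N -> 'I_N -> rexp C N := mulE (mulE PX (cstE W)) PV.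
have SE W (g : 'M[C]_N) : mev (S W) g = g *m W *m invmx g by rewrite !mevE.
have dS W : mdir (S W) 1%:M Z = br Z W.
  by rewrite !mdirE mulmx0 addr0 invmx1 !mul1mx !mulmx1 mulmxN.
have : vanish Gs (PAdd (bilE (S X) (S Y)) (PC (- B X Y))).
  by move=> g gG; rewrite /= pev_bilE !SE Binv // subrr.
move/hZ; rewrite /= pdir_bilE !dS !SE invmx1 !mul1mx !mulmx1.
by rewrite addr0.
Qed.

Lemma al_neq0 i : exists2 H, H \in h & al i H != 0.
Proof.
apply: contrapT => hn.
have h0 H : H \in h -> \sum_j (i == j)%:R * al j H = 0.
  move=> hH; rewrite big1 // => j _.
  have [<-|_] := eqVneq i j; last by rewrite mul0r.
  have [->|ne] := eqVneq (al i H) 0; first by rewrite mulr0.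
  by case: hn; exists H.
by have /eqP := alfree h0 i; rewrite eqxx oner_eq0.
Qed.

Lemma B_weights (b c : 'M[C]_N -> C) X Y : lieA Gs X -> lieA Gs Y ->
  (forall H, H \in h -> br H X = b H *: X) -> (forall H, H \in h -> br H Y = c H *: Y) ->
  (exists2 H, H \in h & b H + c H != 0) -> B X Y = 0.
Proof.
move=> hX hY hb hc [H hH bc]; apply: (mulfI bc); rewrite mulr0.
have := B_ad_inv (hL hH) hX hY; rewrite hb // hc // mulrDl.
by rewrite (linfunZ _ _ (BL Y)) (linfunZ _ _ (BR X)).
Qed.

Section Diagonalized.
Variable P : 'M[C]_N.
Hypotheses (uP : P \in unitmx) (hP : forall H, H \in h -> exists d, H = cd P d).

Definition eps H a := pent P H a a.

Lemma epsL a : is_linfun (eps^~ a).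
Proof.
move=> c X Y; rewrite /eps /pent mulmxDr mulmxDl -scalemxAr -scalemxAl.
by rewrite [LHS]mxE [X in X + _]mxE.
Qed.

Lemma cd_eps H : H \in h -> H = cd P (eps H).
Proof.
case/hP => d ->; apply: eq_cd => // a.
by rewrite /eps pent_cd // eqxx mulr1n.
Qed.

Definition wt H (ab : 'I_N * 'I_N) := eps H ab.1 - eps H ab.2.

Lemma wtL ab : is_linfun (wt^~ ab).
Proof. by move=> c X Y; rewrite /wt !epsL; ring. Qed.

Lemma pent_br H X a b : H \in h -> pent P (br H X) a b = wt H (a, b) * pent P X a b.
Proof.
move=> hH; rewrite /br {1 2}(cd_eps hH) pentB pent_cdl // pent_cdr // /wt /=.
by rewrite mulrBl; congr (_ - _); rewrite mulrC.
Qed.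

(** [H0] separates the distinct weights of the adjoint action of [h] on matrices, so splitting under
    this single element is splitting under all of [h]. *)
Lemma regular_vector : exists2 H0, H0 \in h &
  forall ab ab', wt H0 ab = wt H0 ab' -> forall H, H \in h -> wt H ab = wt H ab'.
Proof.
pose bad (q : ('I_N * 'I_N) * ('I_N * 'I_N)) := `[< exists2 H, H \in h & wt H q.1 - wt H q.2 != 0 >].
pose F (q : {q | bad q}) H := wt H (val q).1 - wt H (val q).2.
have [q c X Y|q|H0 hH0 h0] := @generic_vector _ _ h _ F.
- by rewrite /F !wtL; ring.
- by have /asboolP := valP q.
exists H0 => // ab ab' eqw H hH; apply/eqP; rewrite -subr_eq0; apply: contraT => ne.
have hq : bad (ab, ab') by apply/asboolP; exists H.
by have := h0 (exist _ (ab, ab') hq); rewrite /F /= eqw subrr eqxx.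
Qed.

(** Each weight component of [X] is an interpolation polynomial in the adjoint action of [H0]
    applied to [X], so it stays in the Lie algebra. The component of weight 0 commutes with [h],
    hence lies in it by self-normalization. *)
Lemma root_decomposition X : lieA Gs X -> exists (H : 'M[C]_N) (s : seq 'M[C]_N),
  [/\ H \in h, X = H + \sum_(Y <- s) Y & forall Y, Y \in s -> exists b,
    [/\ is_linfun b, exists2 H, H \in h & b H != 0 & root_vec b Y]].
Proof.
move=> hX; have [H0 hH0 reg] := regular_vector.
pose vs := undup [seq wt H0 ab | ab : 'I_N * 'I_N].
pose Xv v : 'M[C]_N := invmx P *m (\matrix_(a, b)
  (if wt H0 (a, b) == v then pent P X a b else 0)) *m P.
have XvE v a b : pent P (Xv v) a b = if wt H0 (a, b) == v then pent P X a b else 0.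
  by rewrite /pent /Xv !mulmxA mulmxV // mul1mx mulmxK // mxE.
have pent_sum (I : Type) (s : seq I) (F : I -> 'M[C]_N) a b :
    pent P (\sum_(i <- s) F i) a b = \sum_(i <- s) pent P (F i) a b.
  by rewrite /pent mulmx_sumr mulmx_suml summxE.
have Xsum : X = \sum_(v <- vs) Xv v.
  apply: (pent_inj uP) => a b; rewrite pent_sum (bigD1_seq (wt H0 (a, b))) ?undup_uniq //=.
    by rewrite XvE eqxx big1 ?addr0 // => v ne; rewrite XvE eq_sym (negPf ne).
  by rewrite mem_undup; apply/mapP; exists (a, b); rewrite ?mem_enum.
have XvL v : lieA Gs (Xv v).
  have [q qE] : exists q : {poly C}, forall ab, q.[wt H0 ab] = (wt H0 ab == v)%:R.
    by apply: interpolation => ab ab' ->.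
  have -> : Xv v = \sum_(n < size q) q`_n *: iter n (br H0) X.
    apply: (pent_inj uP) => a b; rewrite pent_sum XvE.
    have it n : pent P (iter n (br H0) X) a b = wt H0 (a, b) ^+ n * pent P X a b.
      by elim: n => [|n ih]; rewrite ?mul1r // iterS pent_br // ih exprS mulrA.
    transitivity (q.[wt H0 (a, b)] * pent P X a b).
      by rewrite qE; case: eqP => _; rewrite ?mul1r ?mul0r.
    rewrite horner_coef mulr_suml; apply: eq_bigr => n _.
    by rewrite pentZ it mulrA.
  apply: lieA_sum => n _; apply: lieAZ; elim: (nat_of_ord n) => //= m ih.
  exact: br_lie (hL hH0) ih.
have Xvbr v ab : wt H0 ab = v -> forall H, H \in h -> br H (Xv v) = wt H ab *: Xv v.
  move=> wv H hH; apply: (pent_inj uP) => a b; rewrite pentZ pent_br // XvE.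
  case: eqP => [e|]; last by rewrite !mulr0.
  by rewrite (reg (a, b) ab) // wv e.
have vsP v : v \in vs -> exists ab, wt H0 ab = v.
  by rewrite mem_undup => /mapP[ab _ ->]; exists ab.
exists (\sum_(v <- vs | v == 0) Xv v).
exists [seq Xv v | v <- vs & (v != 0) && (Xv v != 0)]; split.
- rewrite big_seq_cond; apply: memv_suml => v /andP[/vsP[ab wv] /eqP v0].
  apply: hself (XvL v) _ => H hH; rewrite brC (Xvbr _ _ wv) //.
  have -> : wt H ab = 0; last by rewrite scale0r oppr0 mem0v.
  rewrite (reg ab (ab.1, ab.1)) //; first by rewrite /wt subrr.
  by rewrite wv v0 /wt subrr.
- rewrite {1}Xsum (bigID (fun v => v == 0)) /=; congr (_ + _).
  rewrite big_map big_filter big_mkcondr; apply: eq_bigr => v _.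
  by case: eqP.
move=> Y /mapP[v]; rewrite mem_filter => /andP[/andP[v0 Xv0] /vsP[ab wv]] ->.
exists (wt^~ ab); split; [exact: wtL|by exists H0; rewrite ?wv|split=> //].
exact: Xvbr.
Qed.

Lemma br_linear_h Y H (b : 'M[C]_N -> C) : H \in h -> (forall H, H \in h -> br H Y = b H *: Y) ->
  br Y H = - b H *: Y.
Proof. by move=> hH hb; rewrite brC hb // scaleNr. Qed.

(** Nondegeneracy gives an element pairing nontrivially with the root vector X; only its component Y
    of opposite weight can do so. Then T = [X, Y] is in [h] and represents a multiple of the root
    through [B], and rescaling Y gives the triple once [al i T] is known to be nonzero. *)
Lemma coroot_triple i : exists X Y H,
  [/\ root_vec (al i) X,
      lieA Gs Y /\ forall H', H' \in h -> br H' Y = - al i H' *: Y,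
      H \in h, br X Y = H /\ al i H = 2
    & exists2 c, c != 0 & forall H', H' \in h -> B H H' = c * al i H'].
Proof.
have [X [hX X0 hXb]] := alroot i; have [H1 hH1 alH1] := al_neq0 i.
have [Y [hY XY hYb]] : exists Y, [/\ lieA Gs Y, B X Y != 0 &
    forall H', H' \in h -> br H' Y = - al i H' *: Y].
  have [Y hY XY] : exists2 Y, lieA Gs Y & B X Y != 0.
    apply: contrapT => hn; case/eqP: X0; apply: Bnd => // Y hY.
    by apply/eqP; apply: contrapT => /negP ne; apply: hn; exists Y.
  have [H' [s [hH' YE hs]]] := root_decomposition hY.
  have BXH : B X H' = 0.
    apply: (B_weights (b := al i) (c := fun=> 0)) => //; first exact: hL.
      by move=> H2 hH2; rewrite scale0r /br cartan_comm // subrr.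
    by exists H1; rewrite ?addr0.
  have [Z Zs XZ] : exists2 Z, Z \in s & B X Z != 0.
    apply: contrapT => hn; case/eqP: XY; rewrite YE (linfunD _ _ (BR X)) BXH add0r.
    rewrite (linfun_sum _ _ (BR X)) big_seq big1 // => Z Zs.
    by apply/eqP; apply: contrapT => /negP ne; apply: hn; exists Z.
  have [b [_ _ [hZ _ hZb]]] := hs Z Zs.
  exists Z; split=> // H2 hH2; rewrite hZb //; congr (_ *: _); apply/eqP.
  rewrite -addr_eq0 addrC; apply: contraT => ne; case/eqP: XZ.
  by apply: (B_weights (b := al i) (c := b)) => //; exists H2.
pose T := br X Y; have TL : lieA Gs T := br_lie hX hY.
have Th : T \in h.
  apply: hself => // H hH; rewrite brC br_leibniz (hXb H hH) (hYb H hH) brZ brZl.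
  by rewrite scaleNr addrN oppr0 mem0v.
have BT H : H \in h -> B T H = al i H * B X Y.
  move=> hH; have := B_ad_inv hY hX (hL hH).
  rewrite (br_linear_h hH hYb) opprK (linfunZ _ _ (BR X)) brC.
  by rewrite -scaleN1r (linfunZ _ _ (BL H)) mulN1r => /eqP; rewrite addrC subr_eq0 => /eqP.
(* If the root vanished on T, then X would commute with T and with the matrix T* of conjugate
   eigenvalues in the same eigenbasis. Then tr(T* T) = tr(T* [X, Y]) = 0 would be the sum of the
   squared moduli of the eigenvalues of T, forcing T = 0. *)
have alT : al i T != 0.
  apply/eqP => alT0.
  have [d dE] := hP Th; have XT : br T X = 0 by rewrite hXb // alT0 scale0r.
  have fX : cd P (fun a => (d a)^*) *m X = X *m cd P (fun a => (d a)^*).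
    rewrite -[RHS]scale1r; apply: comm_cd_entry => // a b hab; rewrite mul1r.
    have := @ad_cd_entry _ _ _ uP d X 0 _ a b hab; rewrite scale0r -dE => /(_ XT)/eqP.
    by rewrite subr_eq0 => /eqP ->.
  have : \tr (cd P (fun a => (d a)^*) *m T) = 0.
    rewrite /T /br mulmxBr raddfB /= !mulmxA [X in _ - X]mxtrace_mulC mulmxA.
    by rewrite -fX subrr.
  rewrite dE cdM // /cd mxtrace_mulC mulmxA mulmxV // mul1mx mxtrace_diag => tr0.
  have d0 a : d a = 0.
    have : \sum_a (d a)^* * d a = 0.
      by rewrite -[RHS]tr0; apply: eq_bigr => b _; rewrite mxE.
    move/psumr_eq0P => /(_ _ a isT)/eqP.
    rewrite mulf_eq0 conjC_eq0 orbb => hh; apply/eqP/hh => b _.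
    by rewrite mulrC mul_conjC_ge0.
  have T0 : T = 0.
    by rewrite dE -(scale0r (cd P d)) cdZ //; apply: eq_cd => // a; rewrite d0 mul0r.
  by have /eqP := BT H1 hH1; rewrite T0 (linfun0 (BL H1)) eq_sym mulf_eq0 (negPf alH1) (negPf XY).
pose c := 2 / al i T; have c0 : c != 0 by rewrite mulf_neq0 ?invr_eq0 // pnatr_eq0.
exists X, (c *: Y), (c *: T); split.
- by split.
- split=> [|H hH]; first exact: lieAZ.
  by rewrite brZ hYb // !scalerA mulrC.
- by rewrite memvZ.
- by rewrite brZ (linfunZ _ _ (alL i)) /c divfK.
exists (c * B X Y) => [|H hH]; first by rewrite mulf_neq0.
by rewrite (linfunZ _ _ (BL H)) BT //; ring.
Qed.

Section Triples.
Variables (ex ey eh : 'I_r -> 'M[C]_N).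
Hypotheses (exR : forall i, root_vec (al i) (ex i)) (eyL : forall i, lieA Gs (ey i))
  (eyB : forall i H, H \in h -> br H (ey i) = - al i H *: ey i)
  (ehh : forall i, eh i \in h) (exy : forall i, br (ex i) (ey i) = eh i)
  (aleh : forall i, al i (eh i) = 2)
  (Beh : forall i, exists2 c, c != 0 & forall H, H \in h -> B (eh i) H = c * al i H).

Lemma exB i H : H \in h -> br H (ex i) = al i H *: ex i.
Proof. by case: (exR i) => _ _; apply. Qed.

Lemma exL i : lieA Gs (ex i). Proof. by case: (exR i). Qed.

Lemma eh_free (c : 'I_r -> C) : \sum_i c i *: eh i = 0 -> forall i, c i = 0.
Proof.
move=> c0; have /fin_all_exists2[k k0 kE] := Beh.
have kc i : c i * k i = 0.
  apply: (alfree (c := fun i => c i * k i)) => H hH.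
  have E : \sum_i B (c i *: eh i) H = 0.
    by rewrite -(linfun_sum _ _ (BL H)) c0; apply: linfun0 (BL H).
  rewrite -[RHS]E; apply: eq_bigr => j _.
  by rewrite (linfunZ _ _ (BL H)) kE // mulrA.
by move=> i; have /eqP := kc i; rewrite mulf_eq0 (negPf (k0 i)) orbF => /eqP.
Qed.

Lemma eh_span H : H \in h -> exists c : 'I_r -> C, H = \sum_i c i *: eh i.
Proof.
move=> hH; pose b := [tuple eh i | i < r].
have bE (i : 'I_r) : b`_i = eh i by rewrite -tnth_nth tnth_mktuple.
have fb : free b.
  apply/freeP => c hc; apply: eh_free; rewrite -[RHS]hc.
  by apply: eq_bigr => i _; rewrite bE.
have bh : (<<b>> <= h)%VS.
  by apply/span_subvP => _ /tnthP[i ->]; rewrite tnth_mktuple.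
have bhE : <<b>>%VS = h.
  apply/eqP; rewrite eqEdim bh /= dimh.
  by move: fb; rewrite /free => /eqP ->; rewrite size_tuple.
rewrite -bhE in hH; exists (fun i => coord b i H); rewrite {1}(coord_span hH).
by apply: eq_bigr => i _; rewrite bE.
Qed.

Lemma eh_ex i : br (eh i) (ex i) = 2 *: ex i.
Proof. by rewrite exB // aleh. Qed.

Lemma eh_ey i : br (eh i) (ey i) = - (2 *: ey i).
Proof. by rewrite eyB // aleh scaleNr. Qed.

Lemma eh_int i a : exists n : int, eps (eh i) a = n%:~R.
Proof.
pose v : 'cV[C]_N := invmx P *m delta_mx a 0.
have ehE := cd_eps (ehh i).
have v0 : v != 0.
  apply/eqP => v0; have := congr1 (fun v => (P *m v) a 0) v0.
  rewrite /v mulKVmx // mulmx0 !mxE !eqxx => /eqP.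
  by rewrite oner_eq0.
apply: (@sl2_weight_int _ _ (mulmx (ex i)) (mulmx (ey i)) (mulmx (eh i)) _ _ _ _ _
  (codom (eps (eh i))) _ v) => //.
- by move=> b u; rewrite -scalemxAr.
- by move=> b u; rewrite -scalemxAr.
- by move=> u; rewrite !mulmxA -mulmxBl -/(br _ _) eh_ex scalemxAl.
- by move=> u; rewrite !mulmxA -mulmxBl -/(br _ _) eh_ey mulNmx scalemxAl.
- by move=> u; rewrite !mulmxA -mulmxBl -/(br _ _) exy.
- move=> u b u0 hu; have [a' ha'] : exists a', (P *m u) a' 0 != 0.
    apply: contrapT => hn; case/eqP: u0; apply: (mulPI uP); rewrite mulmx0.
    apply/colP => a'; rewrite [RHS]mxE; apply/eqP; apply: contrapT => /negP ne.
    by apply: hn; exists a'.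
  have := cd_eigen uP (eps (eh i)) u a'; rewrite -ehE -mulmxA hu -scalemxAr mxE.
  by move/(mulIf ha') ->; apply: codom_f.
rewrite {1}ehE /v /cd -!mulmxA (mulmxA P) mulmxV // mul1mx scalemxAr; congr (_ *m _).
apply/colP => b; rewrite mul_diag_mx !mxE; have [->|] := eqVneq b a; rewrite ?mulr0 //.
Qed.

Lemma cartan_int i j : exists n : int, al i (eh j) = n%:~R.
Proof.
case: (exR i) => _ /(pent_neq0 uP)[a [b hab]] hX.
have [n nE] := eh_int j a; have [m mE] := eh_int j b.
exists (n - m); rewrite intrB -nE -mE.
have hc : cd P (eps (eh j)) *m ex i - ex i *m cd P (eps (eh j)) = al i (eh j) *: ex i.
  by rewrite -cd_eps // -/(br _ _) hX.
by rewrite -(ad_cd_entry uP hc hab).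
Qed.

(** If [y_j, x_i] were nonzero it would be a root vector for the i-th minus the j-th simple root,
    whose coefficients have both signs. So x_i is a highest weight vector for the triple (y_j, x_j,
    - h_j), whose highest weights are natural numbers. *)
Lemma cartan_offdiag i j : i != j -> exists n : nat, al i (eh j) = - n%:R.
Proof.
move=> ij; have X0 : ex i != 0 by case: (exR i).
have YX : br (ey j) (ex i) = 0.
  apply/eqP; apply: contraT => ne.
  pose b H := al i H - al j H.
  have bL : is_linfun b by move=> c X Y; rewrite /b !alL; ring.
  have bR : root_vec b (br (ey j) (ex i)).
    split=> // [|H hH]; first by apply: br_lie => //; apply: exL.
    by rewrite br_leibniz (eyB j hH) (exB i hH) brZ brZl -scalerDl addrC.
  have coefs (c : 'I_r -> C) : (forall H, H \in h -> b H = \sum_k c k * al k H) ->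
      c i = 1 /\ c j = -1.
    move=> hc; have z : forall k, c k - (k == i)%:R + (k == j)%:R = 0.
      apply: alfree => H hH.
      have -> : \sum_k (c k - (k == i)%:R + (k == j)%:R) * al k H =
          \sum_k c k * al k H - al i H + al j H.
        under eq_bigr do rewrite mulrDl mulrBl.
        rewrite big_split sumrB /=; congr (_ - _ + _).
          by rewrite (bigD1 i) //= eqxx mul1r big1 ?addr0 // => k /negPf ->; rewrite mul0r.
        by rewrite (bigD1 j) //= eqxx mul1r big1 ?addr0 // => k /negPf ->; rewrite mul0r.
      by rewrite -hc // /b; ring.
    have zi := z i; have zj := z j.
    rewrite eqxx (negPf ij) addr0 in zi; rewrite eqxx eq_sym (negPf ij) subr0 in zj.
    by split; apply/eqP; [rewrite -subr_eq0 zi|rewrite -subr_eq0 opprK zj].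
  have bn0 : exists2 H, H \in h & b H != 0.
    apply: contrapT => hn; have [|c1 _] := coefs (fun=> 0).
      move=> H hH; rewrite big1 ?mul0r // => [|k _]; last by rewrite mul0r.
      by apply/eqP; apply: contrapT => /negP nz; apply: hn; exists H.
    by move/eqP: c1; rewrite eq_sym oner_eq0.
  have [c [hc|hc]] := posneg bL bn0 (ex_intro _ _ bR).
    have [_ /eqP] := coefs (fun k => (c k)%:R) hc.
    by rewrite -addr_eq0 natr1 pnatr_eq0.
  have [|/eqP] := coefs (fun k => - (c k)%:R).
    by move=> H hH; rewrite hc // -sumrN; apply: eq_bigr => k _; rewrite mulNr.
  by rewrite eq_sym -addr_eq0 addrC natr1 pnatr_eq0.
have [n nE] : exists n : nat, - al i (eh j) = n%:R.
  apply: (@sl2_highest_nat _ _ (br (ey j)) (br (ex j)) (br (- eh j)) _ _ _ _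
    [seq eps (eh j) ab.2 - eps (eh j) ab.1 | ab : 'I_N * 'I_N] _ (ex i)) => //.
  - by move=> c v; rewrite brZ.
  - by move=> c v; rewrite brZ.
  - move=> v; by rewrite -br_jacobi !brNl eh_ex brZl.
  - by move=> v; rewrite -br_jacobi (brC (ey j)) exy.
  - move=> v c v0; rewrite brNl => hc.
    have hc' : cd P (eps (eh j)) *m v - v *m cd P (eps (eh j)) = - c *: v.
      by rewrite -cd_eps // -/(br _ _) scaleNr -hc opprK.
    have [a [b ab]] := ad_cd_eigenvalue uP v0 hc'.
    apply/mapP; exists (a, b); rewrite ?mem_enum //=.
    by rewrite -[c]opprK -ab opprB.
  by rewrite brNl exB // scaleNr.
by exists n; rewrite -nE opprK.
Qed.

(** The last factor does not depend on [j], so comparison with j = i makes the trace form symmetrize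
    the Cartan matrix ([rd_form]). *)
Lemma trace_cartan i j :
  \tr (eh i *m eh j) = al i (eh j) * \tr (ex i *m ey i).
Proof.
have E : ey i *m eh j = eh j *m ey i + al i (eh j) *: ey i.
  have := eyB i (ehh j); rewrite /br => /(canRL (subrK _)) ->.
  by rewrite scaleNr addrC addrA subrr add0r.
rewrite -{1}(exy i) /br mulmxBl raddfB /= -!mulmxA E mulmxDr raddfD /=.
rewrite -scalemxAr linearZ /= [X in _ - X]mxtrace_mulC -!mulmxA.
by rewrite addrAC subrr add0r.
Qed.

Lemma root_vec_nilpotent (b : 'M[C]_N -> C) X : (exists2 H, H \in h & b H != 0) ->
  (forall H, H \in h -> br H X = b H *: X) -> exists m, X ^+ m.+1 = 0.
Proof.
move=> [H hH bH] hX; apply: (@ad_cd_nilpotent _ _ _ uP (eps H) _ (b H)) => //.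
by rewrite -cd_eps // -/(br _ _) hX.
Qed.

Lemma ex_nilpotent i : exists m, ex i ^+ m.+1 = 0.
Proof. by apply: (root_vec_nilpotent (al_neq0 i)) => H; apply: exB. Qed.

Lemma ey_nilpotent i : exists m, ey i ^+ m.+1 = 0.
Proof.
have [H hH nz] := al_neq0 i.
apply: (@root_vec_nilpotent (fun H => - al i H)) => [|H' hH']; last exact: eyB.
by exists H; rewrite ?oppr_eq0.
Qed.

(* The third nilpotent element of the triple is a conjugate of [ey i]. *)
Lemma eyhx_nilpotent i : exists m, (ey i + eh i - ex i) ^+ m.+1 = 0.
Proof.
have [k hk] := ex_nilpotent i; have [m hm] := ey_nilpotent i; exists m.
have E := @Ad_expm _ _ _ _ hk (ey i) (eh i) (- (2 *: ex i)) 1 (exy i).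
rewrite -!/(br _ _) in E.
have {}E : ey i + eh i - ex i = expm k (ex i) 1 *m ey i *m invmx (expm k (ex i) 1).
  rewrite E ?expr1n ?scale1r.
  - by rewrite scalerN scalerA div1r mulVf ?scale1r ?pnatr_eq0.
  - by rewrite brC eh_ex.
  - by rewrite -scaleNr brZ /br subrr scaler0.
set g := expm _ _ _ in E; have ug : g \in unitmx by apply: expm_unit.
have conjX n : (g *m ey i *m invmx g) ^+ n = g *m (ey i ^+ n) *m invmx g.
  elim: n => [|n ih]; first by rewrite !expr0 mulmx1 mulmxV.
  by rewrite !exprS ih -!mulmxE !mulmxA mulmxKV.
by rewrite E conjX hm mulmx0 mul0mx.
Qed.

(** Root vectors are nilpotent, and a coroot is recovered from nilpotents as h = (y + h - x) - y +
    x. *)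
Lemma lie_span X : lieA Gs X -> exists s : seq 'M[C]_N,
  (forall Y, Y \in s -> lieA Gs Y /\ exists m, Y ^+ m.+1 = 0) /\ X \in <<s>>%VS.
Proof.
move=> hX; have [H [s [hH -> hs]]] := root_decomposition hX.
pose nn i := ey i + eh i - ex i.
pose s1 := [seq ex i | i : 'I_r] ++ [seq ey i | i : 'I_r] ++ [seq nn i | i : 'I_r].
exists (s1 ++ s); split=> [Y|].
  rewrite !mem_cat -!orbA => /or4P[/mapP[i _ ->]|/mapP[i _ ->]|/mapP[i _ ->]|/hs].
  - by split; [apply: exL|apply: ex_nilpotent].
  - by split; [apply: eyL|apply: ey_nilpotent].
  - split; last exact: eyhx_nilpotent.
    by apply: lieAD; [apply: lieAD; [|apply: hL]|apply: lieAN; apply: exL].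
  by case=> b [_ b0 [hY _ hYb]]; split=> //; apply: (root_vec_nilpotent b0).
have [c ->] := eh_span hH; apply: memvD; last first.
  rewrite big_seq; apply: memv_suml => Y Ys; apply: memv_span.
  by rewrite mem_cat Ys orbT.
apply: memv_suml => i _; apply: memvZ.
have -> : eh i = nn i - ey i + ex i.
  by rewrite /nn addrAC subrK (addrC (ey i)) addrK.
have mem (f : 'I_r -> 'M[C]_N) : f i \in [seq f j | j : 'I_r] by rewrite map_f ?mem_enum.
apply: memvD; first apply: memvB; apply: memv_span; rewrite !mem_cat ?(mem ex) ?(mem ey) ?(mem nn) ?orbT //.
Qed.

Lemma lie_nilpotent_span : nilpotent_span Gs.
Proof.
have [|a X Y|U hU] := @vspace_of_pred _ _ (lieA Gs).
- exact: lieA0.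
- by move=> hX hY; apply: lieAD hY; apply: lieAZ.
have /fin_all_exists2[s hs sb] (k : 'I_(\dim U)) : exists2 s : seq 'M[C]_N,
    (forall Y, Y \in s -> lieA Gs Y /\ exists m, Y ^+ m.+1 = 0) & (vbasis U)`_k \in <<s>>%VS.
  have [s [h1 h2]] : exists s : seq 'M[C]_N,
     (forall Y, Y \in s -> lieA Gs Y /\ exists m, Y ^+ m.+1 = 0) /\ (vbasis U)`_k \in <<s>>%VS.
    by apply/lie_span/hU/vbasis_mem/mem_nth; rewrite size_tuple.
  by exists s.
pose L := flatten [seq s k | k : 'I_(\dim U)].
have hL' (i : 'I_(size L)) : lieA Gs L`_i /\ exists m, L`_i ^+ m.+1 = 0.
  by have /flatten_mapP[k _ /hs] := mem_nth 0 (ltn_ord i).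
have /fin_all_exists[M hM] (i : 'I_(size L)) : exists m, L`_i ^+ m.+1 = 0.
  by case: (hL' i).
exists (size L), (fun i => L`_i), M; split=> // [i|X hX]; first by case: (hL' i).
have XL : X \in <<in_tuple L>>%VS.
  move/hU: hX => /coord_vbasis ->; apply: memv_suml => k _; apply: memvZ.
  apply: (subvP (sub_span _)) (sb k) => Y Ys; apply/flatten_mapP.
  by exists k; rewrite ?mem_enum.
exists (fun i => coord (in_tuple L) i X); exact: coord_span XL.
Qed.

Lemma root_decomposition_nat X : lieA Gs X -> exists (c : 'I_r -> C) (s : seq 'M[C]_N),
  X = \sum_i c i *: eh i + \sum_(Y <- s) Y /\ forall Y, Y \in s ->
    [/\ lieA Gs Y, Y != 0 & exists (k : 'I_r -> nat) (sg : bool), (exists i, k i != 0%N) /\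
      forall H, H \in h -> br H Y = ((-1) ^+ sg * \sum_i (k i)%:R * al i H) *: Y].
Proof.
move=> hX; have [H [s [hH XE hs]]] := root_decomposition hX.
have [c HE] := eh_span hH; exists c, s; split=> [|Y Ys]; first by rewrite XE HE.
have [b [bL [H1 hH1 b1] bY]] := hs Y Ys; have [hY Y0 hYb] := bY; split=> //.
have bn0 : exists2 H, H \in h & b H != 0 by exists H1.
have [k hk] := posneg bL bn0 (ex_intro _ _ bY).
have kn0 (sg : bool) : (forall H, H \in h -> b H = (-1) ^+ sg * \sum_i (k i)%:R * al i H) ->
    exists i, k i != 0%N.
  move=> hb; apply: contrapT => hn; case/eqP: b1; rewrite hb // big1 ?mulr0 // => i _.
  have [->|ne] := eqVneq (k i) 0%N; first by rewrite mul0r.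
  by case: hn; exists i.
case: hk => hk; [exists k, false|exists k, true].
  have hk' H2 : H2 \in h -> b H2 = (-1) ^+ false * \sum_i (k i)%:R * al i H2.
    by move=> hH2; rewrite expr0 mul1r hk.
  by split=> [|H2 hH2]; [apply: (kn0 _ hk')|rewrite hYb // hk'].
have hk' H2 : H2 \in h -> b H2 = (-1) ^+ true * \sum_i (k i)%:R * al i H2.
  by move=> hH2; rewrite expr1 mulN1r hk.
by split=> [|H2 hH2]; [apply: (kn0 _ hk')|rewrite hYb // hk'].
Qed.

Lemma B_cartan_nondeg H : H \in h -> (forall j, B H (eh j) = 0) -> H = 0.
Proof.
move=> hH hB; apply: Bnd => [|Y hY]; first exact: hL.
have [H' [s [hH' YE hs]]] := root_decomposition hY.
rewrite YE (linfunD _ _ (BR H)) (linfun_sum _ _ (BR H)) big_seq big1 => [|Z /hs[b [_ [H1 hH1 b1] [hZ _ hZb]]]].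
  have [c ->] := eh_span hH'; rewrite addr0 (linfun_sum _ _ (BR H)) big1 // => j _.
  by rewrite (linfunZ _ _ (BR H)) hB mulr0.
apply: (B_weights (b := fun=> 0) (c := b)) => //; first exact: hL.
  by move=> H2 hH2; rewrite scale0r /br cartan_comm // subrr.
by exists H1; rewrite ?add0r.
Qed.

End Triples.

End Diagonalized.

(** The trace form of the defining representation on the simple coroots, computed from their
    integral eigenvalues. *)
Definition cartan_form (w : 'I_N -> 'rV[int]_r) i j : int := \sum_a w a 0 i * w a 0 j.

(** The structure theory in coordinates: the simple coroots are the [Hj P w j], with integral
    eigenvalues [w] in the basis [P]; [ex] and [ey] are Chevalley generators and [A] is the Cartan
    matrix. *)
Record root_datum (P : 'M[C]_N) (w : 'I_N -> 'rV[int]_r) (ex ey : 'I_r -> 'M[C]_N)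
    (A : 'I_r -> 'I_r -> int) : Prop := RootDatum {
  rd_unit : P \in unitmx;
  rd_h : forall H, H \in h <-> exists c : 'I_r -> C, H = \sum_j c j *: Hj P w j;
  rd_exL : forall i, lieA Gs (ex i);
  rd_eyL : forall i, lieA Gs (ey i);
  rd_ex : forall i H, H \in h -> br H (ex i) = al i H *: ex i;
  rd_ey : forall i H, H \in h -> br H (ey i) = - al i H *: ey i;
  rd_exn : forall i, exists m, ex i ^+ m.+1 = 0;
  rd_eyn : forall i, exists m, ey i ^+ m.+1 = 0;
  rd_exy : forall i, br (ex i) (ey i) = Hj P w i;
  rd_al : forall i j, al i (Hj P w j) = (A i j)%:~R;
  rd_diag : forall i, A i i = 2;
  rd_offdiag : forall i j, i != j -> A i j <= 0;
  rd_form : forall i j, 2 * cartan_form w i j = cartan_form w i i * A i j;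
  rd_faithful : forall x : 'I_r -> C, (forall a, \sum_i x i * (w a 0 i)%:~R = 0) -> forall i, x i = 0;
  rd_span : forall X, lieA Gs X -> exists (c : 'I_r -> C) (s : seq 'M[C]_N),
    X = \sum_i c i *: Hj P w i + \sum_(Y <- s) Y /\ forall Y, Y \in s ->
    [/\ lieA Gs Y, Y != 0 & exists (k : 'I_r -> nat) (sg : bool), (exists i, k i != 0%N) /\
      forall H, H \in h -> br H Y = ((-1) ^+ sg * \sum_i (k i)%:R * al i H) *: Y];
  rd_B : forall H, H \in h -> (forall j, B H (Hj P w j) = 0) -> H = 0;
  rd_nil : nilpotent_span Gs }.

Theorem root_datum_exists : exists P w ex ey A, root_datum P w ex ey A.
Proof.
have [P uP hP] := cartan_diag; exists P.
have /fin_all_exists[ex hex] := coroot_triple uP hP.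
have /fin_all_exists[ey hey] := hex.
have /fin_all_exists[eh heh] := hey.
have exR i : root_vec (al i) (ex i) by case: (heh i).
have eyL i : lieA Gs (ey i) by case: (heh i) => _ [].
have eyB i H : H \in h -> br H (ey i) = - al i H *: ey i by case: (heh i) => _ [_ h1] _ _ _ /h1.
have ehh i : eh i \in h by case: (heh i).
have exy i : br (ex i) (ey i) = eh i by case: (heh i) => _ _ _ [].
have aleh i : al i (eh i) = 2 by case: (heh i) => _ _ _ [].
have Beh i : exists2 c, c != 0 & forall H, H \in h -> B (eh i) H = c * al i H.
  by case: (heh i).
have /fin_all_exists[w wE] a : exists m : 'rV[int]_r, forall j, eps P (eh j) a = (m 0 j)%:~R.
  have /fin_all_exists[n nE] j := eh_int uP hP exR eyB ehh exy aleh j a.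
  by exists (\row_j n j) => j; rewrite mxE.
have ehE j : Hj P w j = eh j.
  by rewrite [RHS](cd_eps uP hP (ehh j)); apply: eq_cd => a; rewrite wE.
have /fin_all_exists[A0 A0E] i : exists m : 'I_r -> int, forall j, al i (eh j) = (m j)%:~R.
  have /fin_all_exists[n nE] j := cartan_int uP hP exR eyB ehh exy aleh i j.
  by exists n.
exists w, ex, ey, A0.
have formE i j : (cartan_form w i j)%:~R = \tr (eh i *m eh j) :> C.
  rewrite -!ehE cdM // /cd mxtrace_mulC mulmxA mulmxV // mul1mx mxtrace_diag.
  by rewrite rmorph_sum; apply: eq_bigr => a _; rewrite mxE rmorphM.
split=> //.
- move=> H; split=> [hH|[c ->]].
    have [c ->] := eh_span ehh Beh hH; exists c.
    by apply: eq_bigr => j _; rewrite ehE.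
  by apply: memv_suml => j _; rewrite memvZ // ehE.
- by move=> i; case: (exR i).
- by move=> i H hH; apply: exB.
- by move=> i; apply: (ex_nilpotent uP hP exR).
- by move=> i; apply: (ey_nilpotent uP hP eyB).
- by move=> i; rewrite ehE.
- by move=> i j; rewrite ehE.
- by move=> i; apply: (@intr_inj C); rewrite -A0E aleh.
- move=> i j ij; have [n nE] := cartan_offdiag uP hP exR eyL eyB ehh exy aleh ij.
  have : (A0 i j)%:~R = (- n%:Z)%:~R :> C by rewrite -A0E nE rmorphN.
  by move/intr_inj ->; rewrite oppr_le0.
- move=> i j; apply: (@intr_inj C); rewrite !rmorphM /= !formE !(trace_cartan eyB ehh exy) aleh A0E.
  by ring.
- move=> x hx; apply: (@eh_free eh Beh).
  have cdsum (s : seq 'I_r) : \sum_(i <- s) x i *: eh i =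
      cd P (fun a => \sum_(i <- s) x i * (w a 0 i)%:~R).
    elim: s => [|i s ih].
      rewrite big_nil -(scale0r (cd P (fun=> 0))) cdZ //; apply: eq_cd => a.
      by rewrite big_nil mul0r.
    rewrite big_cons ih -ehE /Hj cdZ // cdD //; apply: eq_cd => a.
    by rewrite big_cons.
  rewrite cdsum -(scale0r (cd P (fun=> 0))) cdZ //; apply: eq_cd => a.
  by rewrite hx mul0r.
- move=> X /(root_decomposition_nat uP hP ehh Beh)[c [s [XE hs]]]; exists c, s; split=> //.
  by rewrite XE; congr (_ + _); apply: eq_bigr => i _; rewrite ehE.
- move=> H hH hB; apply: (B_cartan_nondeg uP hP ehh Beh hH) => j.
  by rewrite -ehE.
exact: (lie_nilpotent_span uP hP exR eyL eyB ehh exy aleh Beh).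
Qed.

End RootStructure.

(** * Simple reflections on weights and on the torus *)

Section ReflectionsOfCharacters.
Variables (C : numFieldType) (r : nat) (A : 'I_r -> 'I_r -> int).
Implicit Types (u : 'I_r -> C) (m : 'rV[int]_r).

Lemma monX u m k : mon u (k *: m) = mon u m ^ k.
Proof.
have kM : {morph (fun x : C => x ^ k) : x y / x * y} by move=> x y; apply: expfzMl.
rewrite /mon (big_morph _ kM (exp1rz _ k)).
by apply: eq_bigr => j _; rewrite mxE mulrC exprz_exp.
Qed.

(* The simple roots, in the basis of weights dual to the coroots. *)
Definition rootv i : 'rV[int]_r := \row_j A i j.

Definition refl i m : 'rV[int]_r := m - m 0 i *: rootv i.

(** The simple reflection of the torus, dual to [refl]: in the coordinates given by coroots only the
    i-th one changes, by the inverse of the i-th root. *)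
Definition srefl i u : 'I_r -> C := fun j => u j * upd i (mon u (- rootv i)) j.

Lemma srefl_unit i u : unitv u -> unitv (srefl i u).
Proof. by move=> hu j; rewrite mulf_neq0 // upd_unit // mon_neq0. Qed.

Lemma mon_srefl i u m : unitv u -> mon (srefl i u) m = mon u (refl i m).
Proof.
move=> hu; rewrite monMl mon_upd -monX -monD //; congr (mon u _).
by rewrite scalerN.
Qed.

End ReflectionsOfCharacters.

Section TorusFromCoroots.
Variables (C : numClosedFieldType) (N r : nat).
Implicit Types (P : 'M[C]_N) (w : 'I_N -> 'rV[int]_r) (u : 'I_r -> C).

Lemma tor_eigen P w u (v : 'cV[C]_N) (m : 'rV[int]_r) : P \in unitmx ->
  (forall j, Hj P w j *m v = (m 0 j)%:~R *: v) -> tor P w u *m v = mon u m *: v.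
Proof.
move=> uP hv; apply: (mulPI uP); apply/colP => a.
rewrite -scalemxAr mulmxA cd_eigen // [RHS]mxE.
have [->|ne] := eqVneq ((P *m v) a 0) 0; first by rewrite !mulr0.
congr (mon u _ * _); apply/rowP => j; apply: (@intr_inj C); apply: (mulIf ne).
have := congr1 (fun x => (P *m x) a 0) (hv j).
by rewrite /= mulmxA cd_eigen // -scalemxAr [X in _ = X]mxE.
Qed.

Lemma eq_tor_Hj P w P' w' u : P \in unitmx -> P' \in unitmx ->
  (forall j, Hj P w j = Hj P' w' j) -> tor P w u = tor P' w' u.
Proof.
move=> uP uP' E; have cdv d b : cd P' d *m (invmx P' *m delta_mx b (0 : 'I_1)) =
    d b *: (invmx P' *m delta_mx b 0).
  rewrite /cd !mulmxA mulmxK // -mulmxA scalemxAr; congr (_ *m _).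
  apply/colP => a; rewrite mul_diag_mx !mxE.
  by case: eqP => [->|]; rewrite ?mulr1 ?mulr0.
rewrite -[LHS](mulmxKV uP') -[RHS](mulmxKV uP'); congr (_ *m _).
apply/matrixP => a b.
have tE : tor P w u *m (invmx P' *m delta_mx b (0 : 'I_1)) =
    tor P' w' u *m (invmx P' *m delta_mx b 0).
  by rewrite cdv; apply: tor_eigen => // j; rewrite E cdv.
move/colP/(_ a): tE; rewrite !mulmxA -!colE !mxE.
by [].
Qed.

Lemma conj_cd (g P : 'M[C]_N) d : g \in unitmx -> P \in unitmx ->
  g *m cd P d *m invmx g = cd (P *m invmx g) d.
Proof. by move=> ug uP; rewrite /cd invmxM ?unitmx_inv // invmxK !mulmxA. Qed.

End TorusFromCoroots.

(** * Representatives of simple reflections in the group *)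

Section WeylElements.
Variables (C : numClosedFieldType) (N : nat) (Gs : 'M[C]_N -> Prop).
Variables (h : {vspace 'M[C]_N}) (r : nat) (al : 'I_r -> 'M[C]_N -> C).
Variables (B : 'M[C]_N -> 'M[C]_N -> C) (P : 'M[C]_N) (w : 'I_N -> 'rV[int]_r).
Variables (ex ey : 'I_r -> 'M[C]_N) (A : 'I_r -> 'I_r -> int).
Hypotheses (GsG : alg_group Gs) (hL : forall H, H \in h -> lieA Gs H)
  (hself : forall X, lieA Gs X -> (forall Y, Y \in h -> br X Y \in h) -> X \in h)
  (alL : forall i, is_linfun (al i))
  (alfree : forall c : 'I_r -> C,
     (forall H, H \in h -> \sum_i c i * al i H = 0) -> forall i, c i = 0).
Hypothesis RD : root_datum Gs h al B P w ex ey A.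
Implicit Types (X Y H : 'M[C]_N) (u : 'I_r -> C).

Let uP := rd_unit RD.

Lemma Hj_in j : Hj P w j \in h.
Proof.
apply/(rd_h RD); exists (fun k => (k == j)%:R).
rewrite (bigD1 j) //= eqxx scale1r big1 ?addr0 // => k /negPf ->.
by rewrite scale0r.
Qed.

Lemma al_lin i H : H \in h -> exists2 c : 'I_r -> C, H = \sum_j c j *: Hj P w j &
  al i H = \sum_j c j * (A i j)%:~R.
Proof.
move=> /(rd_h RD)[c HE]; exists c => //; rewrite HE linfun_sum //.
by apply: eq_bigr => j _; rewrite linfunZ // (rd_al RD).
Qed.

(** The classical representative exp(x_i) exp(-y_i) exp(x_i). [Ad_expm] gives the action of each
    factor on [h], x_i and y_i, and the three are composed. *)
Lemma weyl_element i : exists2 g, Gs g &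
  forall H, H \in h -> g *m H *m invmx g = H - al i H *: Hj P w i.
Proof.
have [m xm] := rd_exn RD i; have [m' ym] := rd_eyn RD i.
pose e1 := expm m (ex i) 1; pose e2 := expm m' (ey i) (-1).
have x_in : Gs e1 by apply: expm_in => //; apply: (rd_exL RD).
have y_in : Gs e2 by apply: expm_in => //; apply: (rd_eyL RD).
have Hi := Hj_in i; have aH : al i (Hj P w i) = 2 by rewrite (rd_al RD) (rd_diag RD).
have xH H : H \in h -> br (ex i) H = - al i H *: ex i.
  by move=> hH; rewrite brC (rd_ex RD) // scaleNr.
have yH H : H \in h -> br (ey i) H = al i H *: ey i.
  by move=> hH; rewrite brC (rd_ey RD) // scaleNr opprK.
have br0 X : br X X = 0 by rewrite /br subrr.
have yx : br (ey i) (ex i) = - Hj P w i by rewrite brC (rd_exy RD).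
have Ad1 M X z H c : X ^+ M.+1 = 0 -> br X H = c *: X ->
    expm M X z *m H *m invmx (expm M X z) = H + z *: (c *: X).
  move=> XM XH; rewrite (Ad_expm XM z XH (W2 := 0)) ?scaler0 ?addr0 // -/(br _ _).
    by rewrite brZ br0 scaler0.
  by rewrite /br mulmx0 mul0mx subrr.
have AdxH H : H \in h -> e1 *m H *m invmx e1 = H - al i H *: ex i.
  by move=> hH; rewrite (Ad1 _ _ _ _ _ xm (xH H hH)) scale1r scaleNr.
have AdyH H : H \in h -> e2 *m H *m invmx e2 = H - al i H *: ey i.
  by move=> hH; rewrite (Ad1 _ _ _ _ _ ym (yH H hH)) scaleN1r.
have Adyx : e2 *m ex i *m invmx e2 = ex i + Hj P w i - ey i.
  rewrite (Ad_expm ym (-1) yx (W2 := - (2 *: ey i))) -/(br _ _).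
  - rewrite scaleN1r opprK sqrrN expr1n mul1r scalerN scalerA mulVf ?scale1r //.
    by rewrite pnatr_eq0.
  - by rewrite -[- Hj _ _ _]scaleN1r brZ yH // aH scaleN1r.
  by rewrite -scaleNr brZ br0 scaler0.
have Adxy : e1 *m ey i *m invmx e1 = ey i + Hj P w i - ex i.
  rewrite (Ad_expm xm 1 (rd_exy RD i) (W2 := - (2 *: ex i))) -/(br _ _).
  - rewrite scale1r expr1n mul1r scalerN scalerA mulVf ?scale1r //.
    by rewrite pnatr_eq0.
  - by rewrite xH // aH scaleNr.
  by rewrite -scaleNr brZ br0 scaler0.
have Adxx : e1 *m ex i *m invmx e1 = ex i.
  by rewrite (Ad1 _ _ _ _ 0 xm) ?scale0r ?scaler0 ?addr0 ?br0.
exists (e1 *m e2 *m e1); first by do 2?[apply: (ag_mul GsG)].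
move=> H hH; have u1 := ag_unit GsG x_in; have u2 := ag_unit GsG y_in.
have conjD g X Y : g *m (X + Y) *m invmx g = g *m X *m invmx g + g *m Y *m invmx g.
  by rewrite mulmxDr mulmxDl.
have conjZ g c X : g *m (c *: X) *m invmx g = c *: (g *m X *m invmx g).
  by rewrite -scalemxAr -scalemxAl.
have conjN g X : g *m (- X) *m invmx g = - (g *m X *m invmx g).
  by rewrite mulmxN mulNmx.
rewrite !invmxM ?unitmx_mul ?u1 ?u2 //.
have -> : e1 *m e2 *m e1 *m H *m (invmx e1 *m (invmx e2 *m invmx e1)) =
    e1 *m (e2 *m (e1 *m H *m invmx e1) *m invmx e2) *m invmx e1 by rewrite !mulmxA.
rewrite (AdxH H hH) conjD conjN conjZ (AdyH H hH) Adyx !(conjD, conjN, conjZ) (AdxH H hH) Adxy Adxx.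
rewrite (AdxH _ Hi) aH; apply/matrixP => a b; rewrite !mxE.
by ring.
Qed.

Lemma weyl_torus i : exists2 g, Gs g &
  (forall H, H \in h -> g *m H *m invmx g = H - al i H *: Hj P w i) /\
  (forall u, unitv u -> g *m tor P w u *m invmx g = tor P w (srefl A i u)).
Proof.
have [g gG hg] := weyl_element i; exists g => //; split=> // u hu.
have ug := ag_unit GsG gG.
have aH : al i (Hj P w i) = 2 by rewrite (rd_al RD) (rd_diag RD).
rewrite conj_cd // -/(tor _ _ _).
transitivity (tor P (fun a => refl A i (w a)) u).
  apply: eq_tor_Hj => //; first by rewrite unitmx_mul uP unitmx_inv.
  move=> j; rewrite /Hj -conj_cd // hg ?Hj_in // (rd_al RD) -scaleNr cdZ // cdD //.
  apply: eq_cd => a; rewrite !mxE rmorphB rmorphM /=.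
  by ring.
by apply: eq_cd => a; rewrite mon_srefl.
Qed.

Lemma h_of_torus_comm X : lieA Gs X ->
  (forall u, unitv u -> tor P w u *m X = X *m tor P w u) -> X \in h.
Proof.
move=> hX hc; apply: hself => // H /(rd_h RD)[c ->].
suff -> : br X (\sum_j c j *: Hj P w j) = 0 by rewrite mem0v.
rewrite /br mulmx_sumr mulmx_suml -sumrB; apply: big1 => j _.
rewrite -scalemxAl -scalemxAr -scalerBr.
(* The torus point with j-th coordinate 2 and the others 1 is enough: k |-> 2^k is injective on
   integers, so commuting with that point means commuting with [Hj P w j]. *)
have n2 : (2 : C) != 0 by rewrite pnatr_eq0.
have := hc _ (upd_unit j n2).
rewrite /tor (eq_cd P (d' := fun a => 2 ^ (w a 0 j))); last by move=> a; rewrite mon_upd.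
move=> h2; rewrite [X in _ *: (_ - X)](_ : _ = 1 *: (X *m Hj P w j)).
  by rewrite scale1r subrr scaler0.
apply: (comm_cd_entry uP) => a b hab; rewrite mul1r; congr (_%:~R).
have := congr1 (fun Y => pent P Y a b) h2; rewrite pent_cdl // pent_cdr // mulrC.
by move/(mulfI hab)/expz2_inj.
Qed.

Lemma torus_root_span X : lieA Gs X -> exists (c : 'I_r -> C) (s : seq 'M[C]_N),
  (forall Y, Y \in s -> tor_root_vector Gs P w Y) /\
  X = \sum_j c j *: Hj P w j + \sum_(Y <- s) Y.
Proof.
move=> /(rd_span RD)[c [s [-> hs]]]; exists c, s; split=> // Y /hs[hY Y0 [k [sg [[i ki] hk]]]].
split=> //; pose m : 'rV[int]_r := \row_j ((-1) ^+ sg * \sum_i (k i)%:Z * A i j).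
have mE j : (m 0 j)%:~R = (-1) ^+ sg * \sum_i (k i)%:R * al i (Hj P w j) :> C.
  rewrite mxE rmorphM rmorph_sign rmorph_sum; congr (_ * _); apply: eq_bigr => l _.
  by rewrite rmorphM /= (rd_al RD).
exists m.
  apply: contraNneq ki => m0; rewrite -(eqr_nat C); apply/eqP.
  apply: (alfree (c := fun i => (k i)%:R)) => H /(rd_h RD)[d ->].
  transitivity (\sum_j d j * (\sum_i (k i)%:R * al i (Hj P w j))).
    under [RHS]eq_bigr do rewrite mulr_sumr.
    rewrite exchange_big; apply: eq_bigr => l _; rewrite linfun_sum // mulr_sumr.
    by apply: eq_bigr => j _; rewrite linfunZ // mulrCA.
  apply: big1 => j _; have := mE j; rewrite m0 mxE => /esym/eqP.
  by rewrite mulf_eq0 signr_eq0 /= => /eqP ->; rewrite mulr0.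
move=> u hu; apply: (comm_cd_entry uP) => a b hab; rewrite -monD //; congr (mon u _).
apply/rowP => j; apply: (@intr_inj C).
have := ad_cd_entry uP (hk _ (Hj_in j)) hab; rewrite -mE => /eqP.
by rewrite subr_eq => /eqP ->; rewrite [in RHS]mxE rmorphD.
Qed.

End WeylElements.

(** * Leading monomials for the order given by the simple roots *)

Section LeadingTerms.
Variables (C : numFieldType) (r : nat) (A : 'I_r -> 'I_r -> int).
Implicit Types (u : 'I_r -> C) (m l : 'rV[int]_r) (k : {ffun 'I_r -> nat}).

Definition root_comb k : 'rV[int]_r := \sum_i (k i)%:Z *: rootv A i.

Lemma root_comb0 : root_comb 0 = 0.
Proof. by rewrite /root_comb big1 // => i _; rewrite ffunE scale0r. Qed.

Lemma root_combD k k' : root_comb (k + k') = root_comb k + root_comb k'.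
Proof.
by rewrite /root_comb -big_split; apply: eq_bigr => i _; rewrite ffunE PoszD scalerDl.
Qed.

(* [f] is [c] times the monomial of exponent [l] plus a combination of
   monomials of strictly lower exponents. *)
Definition top l (c : C) (f : ('I_r -> C) -> C) :=
  exists (I : finType) (k : I -> {ffun 'I_r -> nat}) (d : I -> C),
    \sum_(i | k i == 0) d i = c /\
    forall u, unitv u -> f u = \sum_i d i * mon u (l - root_comb (k i)).

End LeadingTerms.

(** A joint eigenfunction of the Euler operators. If m' differs from [m] at j, the j-th eigenvalue
    equation multiplies the coefficient of m' by a nonzero number, and independence of monomials
    makes it vanish. *)
Lemma monomials_of_weight (C : numFieldType) (r : nat) (I : finType) (l : I -> 'rV[int]_r)
  (c : I -> C) (m : 'rV[int]_r) :
  (forall j u, unitv u -> \sum_i c i * (l i 0 j)%:~R * mon u (l i) =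
     (m 0 j)%:~R * \sum_i c i * mon u (l i)) ->
  forall u, unitv u -> \sum_i c i * mon u (l i) = (\sum_i c i) * mon u m.
Proof.
move=> hj; have class0 m' : m' != m -> \sum_(i | l i == m') c i = 0.
  move=> ne; have [j nj] : exists j, m' 0 j != m 0 j.
    apply/existsP; apply: contraT; rewrite negb_exists => /forallP e; case/eqP: ne.
    by apply/rowP => j; apply/eqP; move: (e j); rewrite negbK.
  have := @mon_indep _ _ _ l (fun i => c i * ((l i 0 j)%:~R - (m 0 j)%:~R)).
  move=> /(_ _ m') h; have {h} := h _ => h.
  have {}h : \sum_(i | l i == m') c i * ((l i 0 j)%:~R - (m 0 j)%:~R) = 0.
    apply: h => u hu; rewrite -[RHS](subrr ((m 0 j)%:~R * \sum_i c i * mon u (l i))).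
    rewrite -{1}hj // mulr_sumr -sumrB; apply: eq_bigr => i _.
    by ring.
  have nz : ((m' 0 j)%:~R - (m 0 j)%:~R : C) != 0 by rewrite subr_eq0 eqr_int.
  apply: (mulIf nz); rewrite mul0r -[RHS]h mulr_suml.
  by apply: eq_bigr => i /eqP ->.
move=> u hu; pose s := undup [seq l i | i <- index_enum I].
have splitE (F : I -> C) : \sum_i F i = \sum_(m' <- s) \sum_(i | l i == m') F i.
  rewrite [RHS](exchange_big_dep xpredT) //=; apply: eq_bigr => i _.
  rewrite big_mkcond (bigD1_seq (l i)) ?undup_uniq ?mem_undup ?map_f ?mem_index_enum //=.
  by rewrite eqxx big1 ?addr0 // => m' /negPf ne; rewrite eq_sym ne.
rewrite (splitE (fun i => c i * mon u (l i))) splitE mulr_suml; apply: eq_bigr => m' _.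
have [->|ne] := eqVneq m' m.
  by rewrite mulr_suml; apply: eq_bigr => i /eqP ->.
transitivity ((\sum_(i | l i == m') c i) * mon u m'); last by rewrite class0 // !mul0r.
by rewrite mulr_suml; apply: eq_bigr => i /eqP ->.
Qed.

(** * Weights and characters of an irreducible highest weight representation *)

Section Representations.
Variables (C : numClosedFieldType) (N : nat) (Gs : 'M[C]_N -> Prop).
Variables (h : {vspace 'M[C]_N}) (r : nat) (al : 'I_r -> 'M[C]_N -> C).
Variables (B : 'M[C]_N -> 'M[C]_N -> C) (P : 'M[C]_N) (w : 'I_N -> 'rV[int]_r).
Variables (ex ey : 'I_r -> 'M[C]_N) (A : 'I_r -> 'I_r -> int).
Hypotheses (GsG : alg_group Gs) (hL : forall H, H \in h -> lieA Gs H)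
  (hG1 : forall g, Gs g -> G1 Gs g) (alL : forall i, is_linfun (al i)).
Hypothesis RD : root_datum Gs h al B P w ex ey A.
Variables (n : nat) (E : 'I_n -> 'I_n -> rexp C N).
Let rho := mev E.
Let drho X := mdir E 1%:M X.
Hypotheses (rho1 : rho 1%:M = 1%:M)
  (rhoM : forall g k, Gs g -> Gs k -> rho (g *m k) = rho g *m rho k)
  (irr : forall U : {vspace 'cV[C]_n},
     (forall g x, Gs g -> x \in U -> rho g *m x \in U) -> U = 0%VS \/ U = fullv).
Variables (i0 : 'I_r) (v0 : 'cV[C]_n).
Hypotheses (v0_neq0 : v0 != 0)
  (v0_weight : forall j, drho (Hj P w j) *m v0 = (i0 == j)%:R *: v0)
  (v0_highest : forall X (k : 'I_r -> nat), lieA Gs X -> X != 0 -> (exists i, k i != 0%N) ->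
     (forall H, H \in h -> br H X = (\sum_i (k i)%:R * al i H) *: X) -> drho X *m v0 = 0).
Implicit Types (X Y Z H g : 'M[C]_N) (x y v : 'cV[C]_n) (u : 'I_r -> C)
  (k : {ffun 'I_r -> nat}) (U : {vspace 'cV[C]_n}).

Let uP := rd_unit RD.

Definition coefE (q : 'rV[C]_n) v : rexp C N := psum (index_enum 'I_n) (fun a =>
  PScale (q 0 a) (psum (index_enum 'I_n) (fun b => PScale (v b 0) (E a b)))).

Lemma pev_coefE q v g : pev (coefE q v) g = (q *m (rho g *m v)) 0 0.
Proof.
rewrite pev_sum mxE; apply: eq_bigr => a _ /=; rewrite pev_sum mxE; congr (_ * _).
by apply: eq_bigr => b _ /=; rewrite mxE mulrC.
Qed.

Lemma pdir_coefE q v g X : pdir (coefE q v) g X = (q *m (mdir E g X *m v)) 0 0.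
Proof.
rewrite pdir_sum mxE; apply: eq_bigr => a _ /=; rewrite pdir_sum mxE; congr (_ * _).
by apply: eq_bigr => b _ /=; rewrite mxE mulrC.
Qed.

Lemma coefE_dd q v X g : lieA Gs X -> Gs g ->
  pev (dd 0 X (coefE q v)) g = pev (coefE q (drho X *m v)) g.
Proof.
move=> hX gG; have ug := ag_unit GsG gG; have u1 := unitmx1 C N.
have hv : vanish Gs (PAdd (ptrans g 1%:M (coefE q v)) (PScale (-1) (coefE (q *m rho g) v))).
  move=> x xG /=; rewrite pev_trans ?(ag_unit GsG xG) // mulmx1 !pev_coefE rhoM // !mulmxA.
  by rewrite mulN1r subrr.
have /= := hX _ hv; rewrite pdir_trans // !mulmx1 !pdir_coefE => /eqP.
rewrite mulN1r subr_eq0 => /eqP h1.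
by rewrite pev_dd // mul0mx add0r pdir_coefE pev_coefE h1 !mulmxA.
Qed.

Lemma coefE_Lw q v s : (forall X, X \in s -> lieA Gs X) -> forall g, Gs g ->
  pev (Lw s (coefE q v)) g = pev (coefE q (foldr (fun X x => drho X *m x) v s)) g.
Proof.
elim: s => [//|X s ih] hs g gG /=; have ug := ag_unit GsG gG.
have hX : lieA Gs X by apply: hs; rewrite inE eqxx.
rewrite -coefE_dd //; apply/eqP; rewrite -subr_eq0 -mulN1r.
have hv : vanish Gs (PAdd (Lw s (coefE q v))
    (PScale (-1) (coefE q (foldr (fun X x => drho X *m x) v s)))).
  move=> k kG /=; rewrite ih ?mulN1r ?subrr // => Y Ys.
  by apply: hs; rewrite inE Ys orbT.
by have /= -> := vanish_L GsG hX hv gG.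
Qed.

Lemma drho_linear a X Y : drho (a *: X + Y) = a *: drho X + drho Y.
Proof. by apply/matrixP => i j; rewrite !mxE pdirD pdirZ. Qed.

Lemma drhoZ a X : drho (a *: X) = a *: drho X.
Proof. by apply/matrixP => i j; rewrite !mxE pdirZ. Qed.

Lemma drhoD X Y : drho (X + Y) = drho X + drho Y.
Proof. by apply/matrixP => i j; rewrite !mxE pdirD. Qed.

Lemma drho_sum (I : Type) (s : seq I) (F : I -> 'M[C]_N) :
  drho (\sum_(i <- s) F i) = \sum_(i <- s) drho (F i).
Proof. by apply/matrixP => i j; rewrite summxE mxE pdir_sumr; apply: eq_bigr => k _; rewrite mxE. Qed.

Lemma coefE_inj x y : (forall q, pev (coefE q x) 1%:M = pev (coefE q y) 1%:M) -> x = y.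
Proof.
move=> hq; apply/colP => a; have := hq (delta_mx 0 a).
by rewrite !pev_coefE rho1 !mul1mx -!rowE !mxE.
Qed.

Lemma drho_br X Y : lieA Gs X -> lieA Gs Y -> forall v,
  drho X *m (drho Y *m v) = drho (br X Y) *m v + drho Y *m (drho X *m v).
Proof.
move=> hX hY v; apply: coefE_inj => q; have G1 := ag_one GsG; have u1 := unitmx1 C N.
have hs (Z W : 'M[C]_N) : lieA Gs Z -> lieA Gs W -> forall V, V \in [:: Z; W] -> lieA Gs V.
  by move=> hZ hW V; rewrite !inE => /orP[/eqP->|/eqP->].
have e1 := coefE_Lw q v (hs _ _ hX hY) G1; have e2 := coefE_Lw q v (hs _ _ hY hX) G1.
have e3 := coefE_dd q v (lieA_bracket GsG hX hY) G1.
have := dd_comm 0 X 0 Y (coefE q v) u1; rewrite /= in e1 e2 e3 *.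
rewrite e1 e2 !mulmx0 subrr e3 => ->.
by rewrite !pev_coefE rho1 !mul1mx mulmxDr [in RHS]mxE addrC.
Qed.

(** A subspace stable under the Lie algebra is stable under the group. For x in U, the coordinates
    of rho(g) x transverse to U are regular functions of g all of whose iterated derivatives vanish
    at 1, so [taylor_principle] applies; irreducibility concludes. *)
Lemma stable_full U : (forall X x, lieA Gs X -> x \in U -> drho X *m x \in U) ->
  v0 \in U -> U = fullv.
Proof.
move=> hU v0U; case: (irr (U := U)) => [g x gG xU||//]; last first.
  by move=> U0; move: v0U v0_neq0; rewrite U0 memv0 => ->.
pose f y : 'cV[C]_n := y - projv U y.
suff /eqP : f (rho g *m x) = 0 by rewrite subr_eq0 => /eqP ->; apply: memv_proj.
apply/colP => c; rewrite [RHS]mxE.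
pose q : 'rV[C]_n := \row_a f (delta_mx a 0) c 0.
have qE y : (q *m y) 0 0 = f y c 0.
  have yE : y = \sum_a y a 0 *: delta_mx a 0.
    by rewrite [LHS]matrix_sum_delta; apply: eq_bigr => a _; rewrite big_ord1.
  rewrite [in RHS]yE /f linear_sum -sumrB summxE mxE; apply: eq_bigr => a _.
  by rewrite linearZ -scalerBr mxE [RHS]mxE mulrC.
rewrite -qE -pev_coefE; apply: (taylor_principle GsG hG1 (ag_one GsG)) gG => s hs.
rewrite coefE_Lw //; last exact: ag_one.
rewrite pev_coefE rho1 mul1mx qE.
have -> : f (foldr (fun X x => drho X *m x) x s) = 0; last by rewrite mxE.
suff xsU : foldr (fun X x => drho X *m x) x s \in U by rewrite /f projv_id // subrr.
elim: s hs => [//|X s ih] hs /=; apply: hU; first by apply: hs; rewrite inE eqxx.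
by apply: ih => Y Ys; apply: hs; rewrite inE Ys orbT.
Qed.

(** The vectors reached from the highest weight vector by negative root vectors. The index counts
    the simple roots subtracted so far; the condition [k' != 0] makes [v0] the only word of index
    0. *)
Inductive word : {ffun 'I_r -> nat} -> 'cV[C]_n -> Prop :=
| word_nil : word 0 v0
| word_cons k k' x Y : word k x -> lieA Gs Y -> k' != 0 ->
    (forall H, H \in h -> br H Y = (- \sum_i (k' i)%:R * al i H) *: Y) ->
    word (k + k') (drho Y *m x).

Lemma word0 k x : word k x -> k = 0 -> x = v0.
Proof.
case=> // {x}{}k k' x Y _ _ /eqP k'0 _ kk; case: k'0; apply/ffunP => i.
move/ffunP/(_ i): kk; rewrite !ffunE => /eqP; rewrite -[_ + _ == _]/((k i + k' i)%N == 0%N).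
by rewrite addn_eq0 => /andP[_ /eqP].
Qed.

Definition word_weight k : 'rV[int]_r := delta_mx 0 i0 - root_comb A k.

Lemma word_eigen k x j : word k x ->
  drho (Hj P w j) *m x = (word_weight k 0 j)%:~R *: x.
Proof.
elim=> [|{x}{}k k' x Y _ ih hY _ hk].
  by rewrite v0_weight /word_weight root_comb0 subr0 mxE eqxx eq_sym; case: eqP.
have HL : lieA Gs (Hj P w j) by apply: hL; apply: (Hj_in RD).
rewrite drho_br // hk ?(Hj_in RD) // ih drhoZ -scalemxAl -scalemxAr -scalerDl.
congr (_ *: _); rewrite /word_weight root_combD opprD addrA [in RHS]mxE rmorphD [LHS]addrC /=.
congr (_ + _); rewrite mxE rmorphN /= summxE rmorph_sum; congr (- _).
by apply: eq_bigr => i _; rewrite !mxE rmorphM /= (rd_al RD).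
Qed.

(** Membership in the span of all words, phrased without choosing a finite family of them. *)
Definition spanned x := forall U, (forall k y, word k y -> y \in U) -> x \in U.

Lemma spanned_word k x : word k x -> spanned x.
Proof. by move=> hx U hU; apply: hU hx. Qed.

Lemma spannedP a x y : spanned x -> spanned y -> spanned (a *: x + y).
Proof. by move=> hx hy U hU; rewrite memvD ?memvZ ?hx ?hy. Qed.

Lemma spanned0 : spanned 0.
Proof. by move=> U _; apply: mem0v. Qed.

Lemma spanned_mul X : (forall k y, word k y -> spanned (drho X *m y)) ->
  forall x, spanned x -> spanned (drho X *m x).
Proof.
move=> hX x hx U hU; pose f : 'Hom('cV[C]_n, 'cV[C]_n) := linfun (mulmx (drho X)).
have fE y : f y = drho X *m y by rewrite lfunE.
by rewrite -fE memv_preim; apply: hx => k y hy; rewrite -memv_preim fE; apply: hX hy _ hU.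
Qed.

Lemma spanned_neg Y k' : lieA Gs Y -> k' != 0 ->
  (forall H, H \in h -> br H Y = (- \sum_i (k' i)%:R * al i H) *: Y) ->
  forall x, spanned x -> spanned (drho Y *m x).
Proof.
move=> hY k0 hk; apply: spanned_mul => k y hy.
exact: (spanned_word (word_cons hy hY k0 hk)).
Qed.

(** Induction on words. On [v0] a coroot acts by a scalar, a negative root vector makes a word, a
    positive one gives 0. On a longer word the operator is commuted past the outermost letter, and
    the induction hypothesis covers both the bracket and the operator. *)
Lemma spanned_stable X x : lieA Gs X -> spanned x -> spanned (drho X *m x).
Proof.
move=> hX; apply: spanned_mul => k y hy; move: X hX.
elim: hy => [|{y}{}k k' x0 Y' hx0 ih hY' k'0 hk'] X hX.
all: have [c [s [XE hs]]] := rd_span RD hX; rewrite XE drhoD mulmxDl -[X in X + _]scale1r.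
all: apply: spannedP.
- rewrite drho_sum mulmx_suml; apply: (big_ind spanned) => [|x1 x2 h1 h2|j _].
  + exact: spanned0.
  + by rewrite -[x1]scale1r; apply: spannedP.
  rewrite drhoZ -scalemxAl v0_weight scalerA -[X in spanned X]addr0; apply: spannedP.
    exact: spanned_word word_nil.
  exact: spanned0.
- rewrite drho_sum mulmx_suml big_seq; apply: (big_ind spanned) => [|x1 x2 h1 h2|Y /hs].
  + exact: spanned0.
  + by rewrite -[x1]scale1r; apply: spannedP.
  move=> [hY Y0 [kY [sg [kY0 hkY]]]]; case: sg hkY => hkY.
    apply: (@spanned_neg _ [ffun i => kY i]) (spanned_word word_nil) => //.
      case: kY0 => i; apply: contra => /eqP/ffunP/(_ i); rewrite !ffunE => ->.
      by [].
    move=> H hH; rewrite hkY // expr1 mulN1r; congr (- _ *: _).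
    by apply: eq_bigr => i _; rewrite ffunE.
  rewrite (v0_highest hY Y0 kY0) => [|H hH]; first exact: spanned0.
  by rewrite hkY // expr0 mul1r.
- rewrite drho_sum mulmx_suml; apply: (big_ind spanned) => [|x1 x2 h1 h2|j _].
  + exact: spanned0.
  + by rewrite -[x1]scale1r; apply: spannedP.
  have hw := word_cons hx0 hY' k'0 hk'.
  rewrite drhoZ -scalemxAl (word_eigen _ hw) scalerA -[X in spanned X]addr0; apply: spannedP.
    exact: spanned_word hw.
  exact: spanned0.
rewrite drho_sum mulmx_suml big_seq; apply: (big_ind spanned) => [|x1 x2 h1 h2|Y /hs].
- exact: spanned0.
- by rewrite -[x1]scale1r; apply: spannedP.
move=> [hY Y0 _]; rewrite drho_br // -[X in X + _]scale1r; apply: spannedP.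
  by apply: ih; apply: lieA_bracket.
by apply: (spanned_neg hY' k'0 hk'); apply: ih.
Qed.

Lemma all_spanned x : spanned x.
Proof.
have [U hU] := vspace_of_pred spanned0 spannedP.
have -> : spanned x <-> x \in U by apply: hU.
rewrite (stable_full (U := U)) ?memvf // => [X y hX /hU hy|].
  by apply/hU; apply: spanned_stable.
by apply/hU; apply: spanned_word word_nil.
Qed.

Lemma word_basis : exists X : seq 'cV[C]_n,
  [/\ basis_of fullv X, v0 \in X & forall x, x \in X -> exists k, word k x].
Proof.
have grow d : (exists X : seq 'cV[C]_n,
      [/\ basis_of fullv X, v0 \in X & forall x, x \in X -> exists k, word k x]) \/
    exists X : seq 'cV[C]_n, [/\ free X, (d <= size X)%N, v0 \in X
      & forall x, x \in X -> exists k, word k x].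
  elim: d => [|d [|[X [fX dX vX hX]]]]; [right|by left|].
    exists [:: v0]; split=> //; first by rewrite seq1_free.
      by rewrite inE.
    by move=> x; rewrite inE => /eqP ->; exists 0; apply: word_nil.
  have [hX'|/existsNP[k /existsNP[x /not_implyP[hx /negP xX]]]] :=
      pselect (forall k x, word k x -> x \in <<X>>%VS).
    left; exists X; split=> //; rewrite /basis_of fX andbT; apply/eqP/vspaceP => x.
    by rewrite memvf; apply: all_spanned hX'.
  right; exists (x :: X); split=> //=.
  - by rewrite free_cons xX.
  - by rewrite inE vX orbT.
  by move=> y; rewrite inE => /predU1P[->|/hX//]; exists k.
have [//|[X [/eqP fX dX _ _]]] := grow (\dim {:'cV[C]_n}).+1.
by have := leq_trans dX (leq_trans (eq_leq (esym fX)) (dimvS (subvf _))); rewrite ltnn.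
Qed.

Let T := tor P w.

Lemma word_torus k x u : word k x -> unitv u -> rho (T u) *m x = mon u (word_weight k) *: x.
Proof.
move=> hx hu; have HL j : lieA Gs (Hj P w j) by apply: hL; apply: (Hj_in RD).
have TG t : unitv t -> Gs (T t) by apply: (tor_in uP).
suff key q t : unitv t -> pev (coefE q x) (T t) = mon t (word_weight k) * pev (coefE q x) 1%:M.
  apply/colP => a; have := key (delta_mx 0 a) u hu.
  by rewrite !pev_coefE rho1 mul1mx -!rowE !mxE.
have [I [l [c [E1 E2]]]] := pev_tor w uP (coefE q x) (unitmx1 C N).
move=> ht; have := @monomials_of_weight C r I l c (word_weight k).
have u1 : unitv (fun _ : 'I_r => 1 : C) by move=> j; apply: oner_neq0.
have c1 := E1 _ u1; rewrite mul1mx (tor1 w uP) in c1.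
have {}E1 t' : unitv t' -> pev (coefE q x) (T t') = \sum_i c i * mon t' (l i).
  by move=> /E1 <-; rewrite mul1mx.
move=> /(_ _ t ht) E3; rewrite E1 // E3 => [|j t' ht'].
  rewrite mulrC c1; congr (_ * _); apply: eq_bigr => i _.
  by rewrite mon1 mulr1.
have tG := TG _ ht'; rewrite -E2 // mul1mx coefE_dd // (word_eigen j hx) -E1 // !pev_coefE.
by rewrite -!scalemxAr mxE.
Qed.

Definition charE : rexp C N := psum (index_enum 'I_n) (fun a => E a a).

Lemma pev_charE g : pev charE g = \tr (rho g).
Proof. by rewrite pev_sum; apply: eq_bigr => a _; rewrite mxE. Qed.

Lemma pev_dd_charE X g : lieA Gs X -> Gs g -> pev (dd 0 X charE) g = \tr (rho g *m drho X).
Proof.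
move=> hX gG; have ug := ag_unit GsG gG; rewrite pev_dd // mul0mx add0r pdir_sum.
apply: eq_bigr => a _; have := coefE_dd (delta_mx 0 a) (delta_mx a 0) hX gG.
rewrite pev_dd // mul0mx add0r pdir_coefE pev_coefE mulmxA.
by rewrite -!colE -!rowE !mxE => ->; apply: eq_bigr => b _; rewrite !mxE.
Qed.

Lemma charE_class g (x : 'M[C]_N) : Gs g -> Gs x -> pev charE (x *m g *m invmx x) = pev charE g.
Proof.
move=> gG xG; have xiG := ag_inv GsG xG; have ux := ag_unit GsG xG.
rewrite !pev_charE !rhoM //; last exact: (ag_mul GsG).
by rewrite mxtrace_mulC mulmxA -rhoM // mulVmx // rho1 mul1mx.
Qed.

(** In a basis of words the torus acts diagonally with the weights of the words. The only word of
    index 0 in the basis is [v0], so the highest weight occurs once and all others are strictly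
    lower; differentiation along the j-th coroot multiplies each monomial by its j-th exponent. *)
Theorem character_torus :
  top A (delta_mx 0 i0) 1 (fun u => pev charE (T u)) /\
  forall j, top A (delta_mx 0 i0) (i0 == j)%:R (fun u => pev (dd 0 (Hj P w j) charE) (T u)).
Proof.
have [X0 [bX vX hX]] := word_basis; pose X := in_tuple X0; set d := size X0 in X *.
have /fin_all_exists[k hk] (b : 'I_d) : exists k, word k X`_b /\ (X`_b = v0 -> k = 0).
  have [->|ne] := eqVneq X`_b v0; first by exists 0; split=> //; apply: word_nil.
  have [k hk] := hX _ (mem_nth 0 (ltn_ord b)); exists k; split=> // Xv.
  by rewrite Xv eqxx in ne.
have fX : free X by case/andP: bX.
pose Q : 'M[C]_(n, d) := \matrix_(a, b) X`_b a 0.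
pose Q' : 'M[C]_(d, n) := \matrix_(b, a) coord X b (delta_mx a 0).
have QQ' : Q *m Q' = 1%:M.
  apply/matrixP => a a'; rewrite mxE.
  have bX' : basis_of fullv X by []; have := coord_basis bX' (memvf (delta_mx a' 0 : 'cV[C]_n)).
  move/matrixP/(_ a 0); rewrite !mxE eqxx andbT => ->; rewrite summxE.
  by apply: eq_bigr => b _; rewrite !mxE mulrC.
have Q'Q : Q' *m Q = 1%:M.
  apply/matrixP => b b'; rewrite !mxE eq_sym -(coord_free _ _ fX).
  rewrite [X in coord _ _ X]matrix_sum_delta linear_sum; apply: eq_bigr => a _.
  by rewrite big_ord1 linearZ !mxE mulrC.
have diag_tr (M : 'M[C]_n) (m : 'I_d -> C) : (forall b : 'I_d, M *m X`_b = m b *: X`_b) ->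
    \tr M = \sum_b m b.
  move=> hM; have MQ : M *m Q = Q *m diag_mx (\row_b m b).
    apply/matrixP => a b; rewrite mul_mx_diag [RHS]mxE [LHS]mxE [Q a b]mxE [X in _ * X]mxE [RHS]mulrC.
    have := congr1 (fun x : 'cV_n => x a 0) (hM b); rewrite [RHS]mxE => <-; rewrite [RHS]mxE.
    by apply: eq_bigr => c _; rewrite mxE.
  rewrite -[M]mulmx1 -QQ' mulmxA MQ -mulmxA mxtrace_mulC -mulmxA Q'Q mulmx1 mxtrace_diag.
  by apply: eq_bigr => b _; rewrite mxE.
have hT u : unitv u -> forall b : 'I_d, rho (T u) *m X`_b = mon u (word_weight (k b)) *: X`_b.
  by move=> hu b; have [hw _] := hk b; apply: word_torus.
(* A basis has no repetition and a word of index 0 equals [v0], so exactly one basis index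
   contributes to the leading coefficient. *)
have one : exists b0, forall b, (k b == 0) = (b == b0).
  have ltd : (index v0 X0 < d)%N by rewrite index_mem.
  have X0E : X`_(Ordinal ltd) = v0 by rewrite nth_index.
  have uX := free_uniq fX.
  have kb b : k b = 0 -> b = Ordinal ltd.
    move=> kb0; apply: val_inj; apply/eqP; rewrite -(nth_uniq 0 _ _ uX) //=.
    by rewrite [X in _ == X]X0E; apply/eqP; have [hw _] := hk b; apply: word0 hw kb0.
  exists (Ordinal ltd) => b; apply/eqP/eqP => [/kb //|->].
  by have [_] := hk (Ordinal ltd); apply.
have [b0 hb0] := one.
split=> [|j].
  exists 'I_d, k, (fun=> 1); split=> [|u hu].
    by rewrite (eq_bigl (pred1 b0)) ?big_pred1_eq.
  rewrite pev_charE (diag_tr _ _ (hT u hu)); apply: eq_bigr => b _.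
  by rewrite mul1r.
exists 'I_d, k, (fun b => (word_weight (k b) 0 j)%:~R); split=> [|u hu].
  rewrite (eq_bigl (pred1 b0)) ?big_pred1_eq // /word_weight.
  have /eqP -> : k b0 == 0 by rewrite hb0.
  by rewrite root_comb0 subr0 mxE eqxx eq_sym; case: eqP.
have HL l : lieA Gs (Hj P w l) by apply: hL; apply: (Hj_in RD).
rewrite pev_dd_charE //; last exact: (tor_in uP).
rewrite (diag_tr _ (fun b => (word_weight (k b) 0 j)%:~R * mon u (word_weight (k b)))).
  by [].
move=> b; have [hw _] := hk b.
by rewrite -mulmxA (word_eigen j hw) -scalemxAr hT // scalerA.
Qed.
End Representations.

(** * A height function from positivity of the trace form *)

Section Height.
Variables (C : numClosedFieldType) (N r : nat) (w : 'I_N -> 'rV[int]_r).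
Variable A : 'I_r -> 'I_r -> int.
Hypotheses (offdiag : forall i j, i != j -> A i j <= 0)
  (form : forall i j, 2 * cartan_form w i j = cartan_form w i i * A i j)
  (faithful : forall x : 'I_r -> C,
     (forall a, \sum_i x i * (w a 0 i)%:~R = 0) -> forall i, x i = 0).
Let K := cartan_form w.

Lemma cartan_form_diag_ge0 i : 0 <= K i i.
Proof. by apply: sumr_ge0 => a _; rewrite -expr2 sqr_ge0. Qed.

Lemma cartan_form_offdiag i j : i != j -> K i j <= 0.
Proof.
move=> /offdiag Aij; rewrite -(pmulr_rle0 _ (ltr0n _ 2)) form.
by rewrite mulr_ge0_le0 // cartan_form_diag_ge0.
Qed.

(** A Gram matrix argument: for v in the kernel, pairing v K with the conjugate of v gives the sum
    over [a] of the squared moduli of the [s a], so every [s a] is 0, and faithfulness gives v =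
    0. *)
Lemma cartan_form_det_neq0 : \det (\matrix_(i, j) K i j) != 0.
Proof.
rewrite -(intr_eq0 C) -det_map_mx; apply/det0P => -[v v0 vK]; case/eqP: v0.
apply/rowP => i; rewrite mxE; apply: (faithful (x := fun i => v 0 i)) => a.
pose s a := \sum_i v 0 i * (w a 0 i)%:~R.
suff : \sum_a s a * (s a)^* = 0.
  move/eqP; rewrite psumr_eq0 => [|b _]; last exact: mul_conjC_ge0.
  by move/allP/(_ a (mem_index_enum a)); rewrite mul_conjC_eq0 => /eqP.
transitivity (\sum_j (v *m map_mx intr (\matrix_(i, j) K i j)) 0 j * (v 0 j)^*); last first.
  by rewrite vK big1 // => j _; rewrite mxE mul0r.
transitivity (\sum_j \sum_i \sum_b v 0 i * (w b 0 i)%:~R * (w b 0 j)%:~R * (v 0 j)^*).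
  under eq_bigr => b _ do rewrite mulr_suml.
  rewrite exchange_big /=; under eq_bigr => j _ do under eq_bigr => b _ do
    rewrite rmorph_sum mulr_sumr.
  under eq_bigr do rewrite exchange_big.
  rewrite exchange_big /=; apply: eq_bigr => j _; apply: eq_bigr => k _; apply: eq_bigr => b _.
  by rewrite rmorphM /= rmorph_int; ring.
apply: eq_bigr => j _; rewrite mxE mulr_suml; apply: eq_bigr => k _.
rewrite !mxE rmorph_sum mulr_sumr mulr_suml; apply: eq_bigr => b _.
by rewrite rmorphM /= mulrA.
Qed.

(* The Cartan matrix is, up to positive row factors, a positive definite matrix
   with nonpositive off-diagonal entries, so its inverse is nonnegative. *)
Lemma height_exists : exists x : 'I_r -> int,
  (forall j, 0 <= x j) /\ forall k, 0 < \sum_j A k j * x j.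
Proof.
pose M : 'M[int]_r := \matrix_(i, j) K i j.
(* An integral multiple of M^-1 applied to the vector of ones, chosen so that every entry of
   [M *m x] is the positive number [\det M ^+ 2]. *)
pose x : 'cV[int]_r := \det M *: (\adj M *m const_mx 1).
have Mx i : (M *m x) i 0 = \det M ^+ 2.
  by rewrite -scalemxAr mulmxA mul_mx_adj mul_scalar_mx !mxE mulr1 expr2.
have D0 : 0 < \det M ^+ 2 by rewrite exprn_even_gt0 //= cartan_form_det_neq0.
have xge0 j : 0 <= x j 0.
  (* [n] and [p] are the negative and positive parts of [x]. The product of [n] with [M *m x] is
     nonnegative, while the off-diagonal signs make it at most minus the square norm of [n]; hence
     [n] is 0. *)
  pose n i := if x i 0 < 0 then - x i 0 else 0; pose p i := x i 0 + n i.
  have n0 i : 0 <= n i by rewrite /n; case: ifP => // /ltW; rewrite oppr_ge0.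
  have p0 i : 0 <= p i by rewrite /p /n; case: ltP => ?; rewrite ?subrr ?addr0.
  have np i : n i * p i = 0.
    by rewrite /p /n; case: ifP => ?; rewrite ?subrr ?mulr0 ?mul0r.
  have h1 : 0 <= \sum_i n i * (M *m x) i 0.
    by apply: sumr_ge0 => i _; rewrite Mx mulr_ge0 // ltW.
  have h2 : \sum_i n i * (M *m x) i 0 =
      \sum_i \sum_k n i * K i k * p k - \sum_a (\sum_i n i * w a 0 i) ^+ 2.
    have -> : \sum_a (\sum_i n i * w a 0 i) ^+ 2 = \sum_i \sum_k n i * K i k * n k.
      under eq_bigr => a _ do rewrite expr2 mulr_suml.
      rewrite exchange_big; apply: eq_bigr => i _ /=.
      under eq_bigr => a _ do rewrite mulr_sumr.
      rewrite exchange_big; apply: eq_bigr => k _ /=.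
      rewrite /K /cartan_form mulr_sumr mulr_suml; apply: eq_bigr => a _.
      by ring.
    rewrite -sumrB; apply: eq_bigr => i _; rewrite -sumrB mxE mulr_sumr.
    by apply: eq_bigr => k _; rewrite mxE /p; ring.
  have h3 : \sum_i \sum_k n i * K i k * p k <= 0.
    apply: sumr_le0 => i _; apply: sumr_le0 => k _.
    have [->|ik] := eqVneq i k; first by rewrite mulrAC np mul0r.
    by rewrite mulr_le0_ge0 // mulr_ge0_le0 // cartan_form_offdiag.
  have h4 : \sum_a (\sum_i n i * w a 0 i) ^+ 2 = 0.
    apply/eqP; rewrite eq_le sumr_ge0 ?andbT => [|a _]; last exact: sqr_ge0.
    by move: h1; rewrite h2 subr_ge0 => /le_trans; apply.
  have nj : n j = 0.
    apply/eqP; rewrite -(intr_eq0 C); apply/eqP.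
    apply: (faithful (x := fun i => (n i)%:~R)) => a.
    have : (\sum_i n i * w a 0 i) ^+ 2 = 0.
      move/eqP: h4; rewrite psumr_eq0 => [|b _]; last exact: sqr_ge0.
      by move/allP/(_ a (mem_index_enum a))/eqP.
    move/eqP; rewrite expf_eq0 /= => /eqP s0.
    rewrite -[RHS](_ : (\sum_i n i * w a 0 i)%:~R = 0 :> C); last by rewrite s0.
    by rewrite rmorph_sum; apply: eq_bigr => i _; rewrite rmorphM.
  by have := p0 j; rewrite /p nj addr0.
exists (fun j => x j 0); split=> // k; rewrite ltNge; apply/negP => Ax.
have : K k k * \sum_j A k j * x j 0 = 2 * \det M ^+ 2.
  rewrite -(Mx k) mxE !mulr_sumr; apply: eq_bigr => j _.
  by rewrite [M _ _]mxE mulrA -form mulrA.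
have := mulr_ge0_le0 (cartan_form_diag_ge0 k) Ax => + E; rewrite E.
by rewrite leNgt mulr_gt0.
Qed.

End Height.

(** * Leading terms of sums, products and determinants *)

Section TopTerms.
Variables (C : numFieldType) (r : nat) (A : 'I_r -> 'I_r -> int).
Implicit Types (f g : ('I_r -> C) -> C) (l : 'rV[int]_r) (c : C).

Lemma eq_top l c f g : (forall u, unitv u -> f u = g u) -> top A l c f -> top A l c g.
Proof. by move=> fg [I [k [d [dc E]]]]; exists I, k, d; split=> // u hu; rewrite -fg ?E. Qed.

Lemma topC c : top A 0 c (fun=> c).
Proof.
exists unit, (fun=> 0), (fun=> c); split=> [|u _]; first by rewrite eqxx big_const card_unit /= addr0.
by rewrite big_const card_unit /= addr0 root_comb0 subr0 mon0 mulr1.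
Qed.

Lemma topM l l' c c' f g : top A l c f -> top A l' c' g ->
  top A (l + l') (c * c') (fun u => f u * g u).
Proof.
move=> [I1 [k1 [d1 [c1 E1]]]] [I2 [k2 [d2 [c2 E2]]]].
exists (I1 * I2)%type, (fun i => k1 i.1 + k2 i.2), (fun i => d1 i.1 * d2 i.2); split.
  rewrite -c1 -c2 mulr_suml (eq_bigl (fun i => (k1 i.1 == 0) && (k2 i.2 == 0))).
    by rewrite -(pair_big (fun i => k1 i == 0) (fun j => k2 j == 0) (fun i j => d1 i * d2 j)) /=;
      apply: eq_bigr => i _; rewrite mulr_sumr.
  move=> [i j] /=; apply/eqP/andP => [h|[/eqP -> /eqP ->]]; last by rewrite addr0.
  split; apply/eqP/ffunP => a; move/ffunP/(_ a): h; rewrite !ffunE => /eqP;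
    by rewrite -[_ + _ == _]/((k1 i a + k2 j a)%N == 0%N) addn_eq0 => /andP[/eqP + /eqP].
move=> u hu; rewrite E1 // E2 // mulr_suml.
rewrite -(pair_bigA _ (fun i j => d1 i * d2 j * mon u (l + l' - root_comb A (k1 i + k2 j)))) /=.
apply: eq_bigr => i _; rewrite mulr_sumr; apply: eq_bigr => j _.
by rewrite root_combD opprD addrACA [in RHS]monD // mulrACA.
Qed.

Lemma topD l c c' f g : top A l c f -> top A l c' g ->
  top A l (c + c') (fun u => f u + g u).
Proof.
move=> [I1 [k1 [d1 [c1 E1]]]] [I2 [k2 [d2 [c2 E2]]]].
exists (I1 + I2)%type, (fun i => match i with inl i => k1 i | inr i => k2 i end),
  (fun i => match i with inl i => d1 i | inr i => d2 i end).
by split=> [|u hu]; rewrite big_sumType /= ?c1 ?c2 // E1 // E2.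
Qed.

Lemma topZ l a c f : top A l c f -> top A l (a * c) (fun u => a * f u).
Proof. by move=> h; have := topM (topC a) h; rewrite add0r. Qed.

Lemma top_sum (J : Type) (s : seq J) l (c : J -> C) (f : J -> ('I_r -> C) -> C) :
  (forall j, top A l (c j) (f j)) ->
  top A l (\sum_(j <- s) c j) (fun u => \sum_(j <- s) f j u).
Proof.
move=> h; elim: s => [|j s ih].
  rewrite big_nil; exists void, (of_void _), (of_void _).
  by split=> [|u _]; rewrite ?big_nil big1 // => -[].
rewrite big_cons; apply: eq_top (topD (h j) ih) => u _.
by rewrite big_cons.
Qed.

Lemma top_prod (J : Type) (s : seq J) (l : J -> 'rV[int]_r) (c : J -> C)
    (f : J -> ('I_r -> C) -> C) : (forall j, top A (l j) (c j) (f j)) ->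
  top A (\sum_(j <- s) l j) (\prod_(j <- s) c j) (fun u => \prod_(j <- s) f j u).
Proof.
move=> h; elim: s => [|j s ih].
  by rewrite !big_nil; apply: eq_top (topC 1) => u _; rewrite big_nil.
rewrite !big_cons; apply: eq_top (topM (h j) ih) => u _.
by rewrite big_cons.
Qed.

Lemma topX l f n : top A l 1 f -> top A (l *+ n) 1 (fun u => f u ^+ n).
Proof.
move=> h; elim: n => [|n ih]; first by rewrite mulr0n; apply: topC.
rewrite mulrS -[1]mulr1; apply: eq_top (topM h ih) => u _.
by rewrite exprS.
Qed.

Lemma top_det n (l : 'I_n -> 'rV[int]_r) (c : 'I_n -> 'I_n -> C)
    (f : 'I_n -> 'I_n -> ('I_r -> C) -> C) :
  (forall i j, top A (l i) (c i j) (f i j)) ->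
  top A (\sum_i l i) (\det (\matrix_(i, j) c i j)) (fun u => \det (\matrix_(i, j) f i j u)).
Proof.
move=> h; rewrite /determinant.
have := top_sum (index_enum 'S_n) (fun s : 'S_n => topZ ((-1) ^+ s)
  (top_prod (index_enum 'I_n) (fun i => h i (s i)))).
set c1 := (X in top _ _ X _); set f1 := (X in top _ _ _ X) => h1.
set c2 := (X in top _ _ X _); have -> : c2 = c1.
  by apply: eq_bigr => s _; congr (_ * _); apply: eq_bigr => i _; rewrite mxE.
apply: eq_top h1 => u _; apply: eq_bigr => s _; congr (_ * _).
by apply: eq_bigr => i _; rewrite mxE.
Qed.

End TopTerms.

Lemma mon_indep_seq (C : numFieldType) (r : nat) (s : seq (C * 'rV[int]_r)) :
  (forall u, unitv u -> \sum_(x <- s) x.1 * mon u x.2 = 0) ->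
  forall m, \sum_(x <- s | x.2 == m) x.1 = 0.
Proof.
move=> h m; rewrite big_tnth; apply: (@mon_indep _ _ _ (fun i => (tnth (in_tuple s) i).2)).
by move=> u /h; rewrite big_tnth.
Qed.

Lemma mon_group (C : numFieldType) (r : nat) (s : seq (C * 'rV[int]_r)) u :
  \sum_(x <- s) x.1 * mon u x.2 =
  \sum_(m <- undup [seq x.2 | x <- s]) (\sum_(x <- s | x.2 == m) x.1) * mon u m.
Proof.
under [RHS]eq_bigr do rewrite mulr_suml.
rewrite [RHS](exchange_big_dep xpredT) //= !big_seq; apply: eq_bigr => x xs.
rewrite big_mkcond (bigD1_seq x.2) ?undup_uniq ?mem_undup ?map_f //=.
by rewrite eqxx big1 ?addr0 // => m' /negPf ne; rewrite eq_sym ne.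
Qed.

(** * Divisibility of functions that change sign under simple reflections *)

Section AntiInvariants.
Variables (C : numFieldType) (r : nat) (A : 'I_r -> 'I_r -> int) (x : 'I_r -> int).
Hypotheses (Adiag : forall i, A i i = 2) (x0 : forall j, 0 <= x j)
  (xA : forall k, 0 < \sum_j A k j * x j).
Implicit Types (u : 'I_r -> C) (m l : 'rV[int]_r) (f : ('I_r -> C) -> C)
  (s : seq (C * 'rV[int]_r)).

(** A linear height: positive on simple roots by [xA], nonnegative on dominant weights by [x0]. *)
Definition ht m : int := \sum_j m 0 j * x j.

Lemma htB m l : ht (m - l) = ht m - ht l.
Proof. by rewrite /ht -sumrB; apply: eq_bigr => j _; rewrite !mxE mulrBl. Qed.

Lemma htZ a m : ht (a *: m) = a * ht m.
Proof. by rewrite /ht mulr_sumr; apply: eq_bigr => j _; rewrite mxE mulrA. Qed.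

Lemma ht_root i : 0 < ht (rootv A i).
Proof. by rewrite (_ : ht _ = \sum_j A i j * x j) //; apply: eq_bigr => j _; rewrite mxE. Qed.

Lemma ht_root_comb k : k != 0 -> 0 < ht (root_comb A k).
Proof.
move=> k0; have -> : ht (root_comb A k) = \sum_i (k i)%:Z * ht (rootv A i).
  rewrite /ht; under [RHS]eq_bigr do rewrite mulr_sumr.
  rewrite exchange_big; apply: eq_bigr => j _ /=; rewrite summxE mulr_suml.
  by apply: eq_bigr => i _; rewrite mxE mulrA.
have [i ki] : exists i, k i != 0%N.
  apply/existsP; apply: contraT; rewrite negb_exists => /forallP e; case/eqP: k0.
  by apply/ffunP => i; apply/eqP; rewrite ffunE; move: (e i); rewrite negbK.
rewrite (bigD1 i) //= ltr_wpDr ?mulr_gt0 ?ht_root //; last by rewrite ltz_nat lt0n.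
by apply: sumr_ge0 => j _; rewrite mulr_ge0 // ltW // ht_root.
Qed.

Lemma ht_ge0 m : (forall j, 0 <= m 0 j) -> 0 <= ht m.
Proof. by move=> m0; apply: sumr_ge0 => j _; rewrite mulr_ge0. Qed.

Lemma reflK i : involutive (refl A i).
Proof.
move=> m; rewrite /refl; apply/rowP => j; rewrite !mxE Adiag.
by ring.
Qed.

Definition low_ht (M : int) f := exists s, (forall y, y \in s -> ht y.2 < M) /\
  forall u, unitv u -> f u = \sum_(y <- s) y.1 * mon u y.2.

Lemma low_htD M f g : low_ht M f -> low_ht M g -> low_ht M (fun u => f u + g u).
Proof.
move=> [s [sM E]] [s' [sM' E']]; exists (s ++ s'); split=> [y|u hu].
  by rewrite mem_cat => /orP[/sM|/sM'].
by rewrite big_cat E ?E'.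
Qed.

Lemma low_ht0 M : low_ht M (fun=> 0).
Proof. by exists [::]; split=> // u _; rewrite big_nil. Qed.

Lemma low_htZ M a f : low_ht M f -> low_ht M (fun u => a * f u).
Proof.
move=> [s [sM E]]; exists [seq (a * y.1, y.2) | y <- s]; split=> [_ /mapP[y ys ->]|u hu] /=.
  exact: sM.
by rewrite big_map E // mulr_sumr; apply: eq_bigr => y _; rewrite mulrA.
Qed.

Lemma low_ht_sum M (J : eqType) (s : seq J) (f : J -> ('I_r -> C) -> C) :
  (forall j, j \in s -> low_ht M (f j)) -> low_ht M (fun u => \sum_(j <- s) f j u).
Proof.
elim: s => [_|j s ih h].
  by have [s [h E]] := low_ht0 M; exists s; split=> // u hu; rewrite big_nil; apply: E.
have hj : low_ht M (f j) by apply: h; rewrite inE eqxx.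
have [s' [h' E]] := low_htD hj (ih (fun i hi => h i (mem_behead (s := j :: s) hi))).
by exists s'; split=> // u hu; rewrite big_cons; apply: E.
Qed.

Lemma top_low_ht l c f : top A l c f -> low_ht (ht l) (fun u => f u - c * mon u l).
Proof.
move=> [I [k [d [dc E]]]].
exists [seq (d i, l - root_comb A (k i)) | i <- [seq i <- index_enum I | k i != 0]]; split.
  move=> _ /mapP[i + ->]; rewrite mem_filter => /andP[ki _] /=.
  by rewrite htB ltrBlDr ltrDl ht_root_comb.
move=> u hu; rewrite E // (bigID (fun i => k i == 0)) /= -dc mulr_suml big_map big_filter.
rewrite addrAC (_ : \sum_(i | k i == 0) d i * mon u (l - root_comb A (k i)) =
  \sum_(i | k i == 0) d i * mon u l) ?subrr ?add0r //.
by apply: eq_bigr => i /eqP ->; rewrite root_comb0 subr0.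
Qed.

Definition anti f := forall i u, unitv u -> f (srefl A i u) = - f u.

Lemma anti_coef f s i m : anti f ->
  (forall u, unitv u -> f u = \sum_(y <- s) y.1 * mon u y.2) ->
  \sum_(y <- s | y.2 == refl A i m) y.1 = - \sum_(y <- s | y.2 == m) y.1.
Proof.
move=> fA fE; have := @mon_indep_seq C r ([seq (y.1, refl A i y.2) | y <- s] ++ s).
move=> h; have {h} := h _ (refl A i m) => h.
apply/eqP; rewrite -addr_eq0 addrC; apply/eqP; rewrite -[RHS]h => [|u hu].
  rewrite big_cat big_map /=; congr (_ + _); apply: eq_bigl => y.
  by rewrite (inj_eq (inv_inj (reflK i))).
rewrite big_cat big_map /= -fE //; apply/eqP; rewrite addrC addr_eq0 -eqr_opp opprK; apply/eqP.
rewrite -(fA i) // fE; last exact: srefl_unit.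
by apply: eq_bigr => y _; rewrite mon_srefl.
Qed.

(** The reflected exponent also occurs, with the opposite coefficient. If the i-th coordinate were
    negative, reflecting would raise the height; if it were 0, the exponent would be fixed and its
    coefficient equal to its own opposite. *)
Lemma anti_top_dominant f s m : anti f ->
  (forall u, unitv u -> f u = \sum_(y <- s) y.1 * mon u y.2) ->
  \sum_(y <- s | y.2 == m) y.1 != 0 ->
  (forall m', \sum_(y <- s | y.2 == m') y.1 != 0 -> ht m' <= ht m) -> forall i, 1 <= m 0 i.
Proof.
move=> fA fE cm mx i; have ci := anti_coef i m fA fE.
have mi0 : 0 <= m 0 i.
  have : ht (refl A i m) <= ht m by apply: mx; rewrite ci oppr_eq0.
  by rewrite /refl htB htZ lerBlDr lerDl pmulr_lge0 // ht_root.
rewrite -gtz0_ge1 lt_neqAle mi0 andbT; apply: contra cm => /eqP mi.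
move: ci; rewrite /refl -mi scale0r subr0 => /eqP.
by rewrite -addr_eq0 -mulr2n mulrn_eq0.
Qed.

Variables (chi : 'I_r -> ('I_r -> C) -> C) (J : ('I_r -> C) -> C).
Hypotheses (chi_top : forall i, top A (delta_mx 0 i) 1 (chi i))
  (chi_inv : forall i k u, unitv u -> chi i (srefl A k u) = chi i u)
  (J_top : top A (\sum_i delta_mx 0 i) 1 J) (J_anti : anti J).

Definition chi_poly (t : seq (C * {ffun 'I_r -> nat})) u : C :=
  \sum_(y <- t) y.1 * \prod_i chi i u ^+ y.2 i.

Lemma chi_poly_inv t k u : unitv u -> chi_poly t (srefl A k u) = chi_poly t u.
Proof.
move=> hu; apply: eq_bigr => y _; congr (_ * _); apply: eq_bigr => i _.
by rewrite chi_inv.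
Qed.

(** All heights in the support are pushed below every negative integer: an exponent of the largest
    height still allowed would be dominant by [anti_top_dominant], hence of nonnegative height. *)
Lemma low_ht0_anti f : anti f -> low_ht 0 f -> forall u, unitv u -> f u = 0.
Proof.
move=> fA [s [s0 fE]] u hu; rewrite fE // mon_group big1_seq // => m /= _.
suff -> : \sum_(y <- s | y.2 == m) y.1 = 0 by rewrite mul0r.
apply/eqP; apply: contraT => cm.
have key (j : nat) m' : \sum_(y <- s | y.2 == m') y.1 != 0 -> ht m' < - j%:Z.
  elim: j m' => [|j ih] m' cm'.
    rewrite oppr0; have [y ys /eqP <-] : exists2 y, y \in s & y.2 == m'; last exact: s0.
    apply/hasP; apply: contraT => /hasPn h; case/eqP: cm'.
    by rewrite big1_seq // => y /andP[e ys]; rewrite (negPf (h y ys)) in e.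
  have h1 := ih _ cm'; rewrite ltNge; apply/negP => h2.
  have hm : ht m' = - j.+1%:Z by lia.
  have hd : forall i, 1 <= m' 0 i.
    apply: (anti_top_dominant fA fE cm') => m'' /ih; lia.
  have : 0 <= ht m' by apply: ht_ge0 => i; apply: le_trans (hd i).
  by lia.
by have := key (absz (ht m)) m cm; lia.
Qed.

(* Subtract multiples of [J] by monomials in the [chi i] to lower the height. *)
Theorem anti_divisible f (M : nat) : anti f -> low_ht M f ->
  exists t, forall u, unitv u -> f u = J u * chi_poly t u.
Proof.
elim: M f => [|M ih] f fA.
  move=> f0; exists [::] => u hu; rewrite (low_ht0_anti fA f0 hu).
  by rewrite /chi_poly big_nil mulr0.
move=> [s [sM fE]]; pose c m := \sum_(y <- s | y.2 == m) y.1.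
pose S := undup [seq y.2 | y <- s].
(* [J] already has leading exponent (1, ..., 1), so the monomial in the characters has to contribute
   m - (1, ..., 1), which [anti_top_dominant] makes nonnegative. *)
pose ex m : {ffun 'I_r -> nat} := [ffun i => absz (m 0 i - 1)%R].
pose t := [seq (c m, ex m) | m <- [seq m <- S | ht m == M%:Z]].
pose g u := f u - J u * chi_poly t u.
have gA : anti g.
  by move=> k u hu; rewrite /g fA // J_anti // chi_poly_inv // mulNr opprB opprK addrC.
have SM m : m \in S -> ht m < M.+1 by rewrite mem_undup => /mapP[y /sM ? ->].
have gE u : unitv u -> g u = \sum_(m <- S) (if ht m == M%:Z then
    c m * mon u m - c m * (J u * \prod_i chi i u ^+ ex m i) else c m * mon u m).
  move=> hu; rewrite /g fE // mon_group -/S /chi_poly big_map big_filter mulr_sumr.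
  rewrite [X in _ - X]big_mkcond -sumrB; apply: eq_bigr => m _.
  by case: ifP => _; rewrite ?subr0 // mulrCA.
have glow : low_ht M g.
  suff [s' [h E]] : low_ht M (fun u => \sum_(m <- S) (if ht m == M%:Z then
      c m * mon u m - c m * (J u * \prod_i chi i u ^+ ex m i) else c m * mon u m)).
    by exists s'; split=> // u hu; rewrite gE // E.
  apply: low_ht_sum => m mS; case: eqP => [hm|hm]; last first.
    exists [:: (c m, m)]; split=> [y|u _]; last by rewrite big_seq1.
    by rewrite inE => /eqP -> /=; have := SM _ mS; move: hm; lia.
  have [cm|cm] := eqVneq (c m) 0.
    have [s' [h E]] := low_ht0 M; exists s'; split=> // u hu.
    by rewrite cm !mul0r subr0 -E.
  have md : forall i, 1 <= m 0 i.
    apply: (anti_top_dominant fA fE cm) => m' cm'; rewrite hm.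
    have [y ys /eqP <-] : exists2 y, y \in s & y.2 == m'; last by have := sM _ ys; lia.
    apply/hasP; apply: contraT => /hasPn h; case/eqP: cm'.
    by rewrite big1_seq // => y /andP[e ys]; rewrite (negPf (h y ys)) in e.
  have tp : top A m 1 (fun u => J u * \prod_i chi i u ^+ ex m i).
    have := topM J_top (top_prod (index_enum 'I_r) (fun i => topX (ex m i) (chi_top i))).
    have mE : \sum_i delta_mx 0 i + \sum_i (delta_mx 0 i *+ ex m i) = m.
      rewrite -big_split; apply/rowP => j; rewrite summxE (bigD1 j) //= big1 => [|i /negPf ij].
        by rewrite addr0 mxE mulmxnE mxE !eqxx /= ffunE -[true%:R]/(1 : int) natz gez0_abs ?subr_ge0 ?md // addrC subrK.
      by rewrite mxE mulmxnE mxE eqxx eq_sym ij /= mul0rn addr0.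
    by rewrite mE big1 // mulr1.
  have [s' [h E]] := low_htZ (- c m) (top_low_ht tp); exists s'; split=> [y ys|u hu].
    by rewrite -hm; apply: h.
  by rewrite -E // mul1r; ring.
have [t' tE] := ih g gA glow; exists (t ++ t') => u hu.
rewrite /chi_poly big_cat mulrDr -/(chi_poly t u) -/(chi_poly t' u) -tE //.
by rewrite /g addrC subrK.
Qed.

End AntiInvariants.

(** * Cramer's rule and the matrix of a reflection *)

Section Determinants.
Variables (K : comNzRingType) (n : nat).
Implicit Types (M : 'M[K]_n) (v : 'rV[K]_n).

Definition set_row i v M : 'M[K]_n := \matrix_(a, b) (if a == i then v 0 b else M a b).

Lemma det_set_row i v M : \det (set_row i v M) = (v *m \adj M) 0 i.
Proof.
rewrite (expand_det_row _ i) mxE; apply: eq_bigr => j _; rewrite !mxE eqxx; congr (_ * _).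
rewrite /cofactor; congr (_ * \det _); apply/matrixP => a b; rewrite !mxE.
by rewrite eq_sym (negPf (neq_lift i a)).
Qed.

Lemma cramer_rows v M : \sum_i \det (set_row i v M) *: row i M = \det M *: v.
Proof.
have -> : \det M *: v = v *m \adj M *m M by rewrite -mulmxA mul_adj_mx mul_mx_scalar.
by rewrite [RHS]mulmx_sum_row; apply: eq_bigr => i _; rewrite det_set_row.
Qed.

Lemma set_row_mul i v M S : set_row i (v *m S) (M *m S) = set_row i v M *m S.
Proof.
apply/matrixP => a b; rewrite !mxE; case: ifP => ai; rewrite ?mxE;
  by apply: eq_bigr => c _; rewrite !mxE ai.
Qed.

(* The matrix of a reflection on the coordinates [B(_, H_j)]. *)
Definition reflmx k (a : 'I_n -> K) : 'M[K]_n :=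
  \matrix_(i, j) ((i == j)%:R - (i == k)%:R * a j).

Lemma det_reflmx k a : a k = 2 -> \det (reflmx k a) = -1.
Proof.
move=> ak; have -> : reflmx k a = set_row k (\row_j ((k == j)%:R - a j)) 1%:M.
  apply/matrixP => i j; rewrite !mxE; case: (i =P k) => [->|_]; first by rewrite mul1r.
  by rewrite mul0r subr0.
have adj1 : \adj 1%:M = 1%:M :> 'M[K]_n by rewrite -[LHS]mul1mx mul_mx_adj det1.
rewrite det_set_row adj1 mulmx1 mxE eqxx ak.
by rewrite -[2]/(1 + 1) opprD addrA subrr sub0r.
Qed.

Lemma mul_reflmx k a v j : (v *m reflmx k a) 0 j = v 0 j - v 0 k * a j.
Proof.
rewrite mxE; under eq_bigr do rewrite mxE mulrBr.
rewrite sumrB (bigD1 j) //= eqxx mulr1 big1 ?addr0 => [|i /negPf ->]; last by rewrite mulr0.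
congr (_ - _); rewrite (bigD1 k) //= eqxx mul1r big1 ?addr0 // => i /negPf ->.
by rewrite mul0r mulr0.
Qed.

End Determinants.

(** * Determinants and nonvanishing of Laurent polynomials *)

Section LaurentDeterminants.
Variables (C : numFieldType) (r : nat).

Lemma laurent_det n (f : 'I_n -> 'I_n -> ('I_r -> C) -> C) :
  (forall i j, laurent (f i j)) -> laurent (fun u => \det (\matrix_(i, j) f i j u)).
Proof.
move=> h; apply: (@eq_laurent _ _ (fun u => \sum_(s : 'S_n) (-1) ^+ s * \prod_i f i (s i) u)).
  by move=> u _; apply: eq_bigr => s _; congr (_ * _); apply: eq_bigr => i _; rewrite mxE.
apply: laurent_sum => s; apply: laurentM; first exact: laurentC.
exact: laurent_prod.
Qed.

Lemma laurent_low_ht x (f : ('I_r -> C) -> C) : laurent f -> exists M : nat, low_ht x M%:Z f.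
Proof.
move=> [I [l [c E]]]; exists (\max_i absz (ht x (l i))).+1.
exists [seq (c i, l i) | i <- index_enum I]; split=> [_ /mapP[i _ ->]|u hu] /=.
  by have : (absz (ht x (l i)) <= \max_i absz (ht x (l i)))%N by [exact: leq_bigmax]; lia.
by rewrite big_map E.
Qed.

(** A nonzero combination of simple roots has positive height, so only the terms of index 0 have
    exponent [l]; therefore [c] is the full coefficient of that monomial. *)
Lemma top_neq0 (A : 'I_r -> 'I_r -> int) (x : 'I_r -> int) l c (f : ('I_r -> C) -> C) :
  (forall k, 0 < \sum_j A k j * x j) -> top A l c f -> c != 0 ->
  exists2 u, unitv u & f u != 0.
Proof.
move=> xA [I [k [d [dc E]]]] c0; apply: contrapT => nf.
have f0 u : unitv u -> f u = 0.
  by move=> hu; apply/eqP; apply: contrapT => /negP fu; apply: nf; exists u.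
have := @mon_indep _ _ _ (fun i => l - root_comb A (k i)) d.
move=> /(_ _ l) h; case/eqP: c0; rewrite -dc -[RHS]h => [|u hu]; last by rewrite -E ?f0.
apply: eq_bigl => i; apply/eqP/eqP => [->|]; first by rewrite root_comb0 subr0.
move/(congr1 (fun m => l - m)); rewrite opprB addrC subrK subrr => rk.
apply/eqP; apply: contraT => /(ht_root_comb xA).
by rewrite rk /ht big1 ?ltxx // => j _; rewrite mxE mul0r.
Qed.

End LaurentDeterminants.

(** * Gradients of the fundamental characters as a module basis *)

Section ModuleBasis.
Variables (C : numClosedFieldType) (N : nat) (Gs : 'M[C]_N -> Prop).
Variables (h : {vspace 'M[C]_N}) (r : nat) (al : 'I_r -> 'M[C]_N -> C).
Variables (B : 'M[C]_N -> 'M[C]_N -> C) (P : 'M[C]_N) (w : 'I_N -> 'rV[int]_r).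
Variables (ex ey : 'I_r -> 'M[C]_N) (A : 'I_r -> 'I_r -> int).
Hypotheses (GsG : alg_group Gs) (hL : forall H, H \in h -> lieA Gs H)
  (hself : forall X, lieA Gs X -> (forall Y, Y \in h -> br X Y \in h) -> X \in h)
  (hG1 : forall g, Gs g -> G1 Gs g) (alL : forall i, is_linfun (al i))
  (alfree : forall c : 'I_r -> C,
     (forall H, H \in h -> \sum_i c i * al i H = 0) -> forall i, c i = 0)
  (BL : forall Z, is_linfun (B^~ Z)) (BR : forall Z, is_linfun (B Z))
  (Binv : forall g X Y, Gs g -> lieA Gs X -> lieA Gs Y ->
     B (g *m X *m invmx g) (g *m Y *m invmx g) = B X Y).
Hypothesis RD : root_datum Gs h al B P w ex ey A.
Implicit Types (X Y H g : 'M[C]_N) (u : 'I_r -> C) (e : rexp C N)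
  (F : 'I_N -> 'I_N -> rexp C N).

Definition class_expr e :=
  forall x y, Gs x -> Gs y -> pev e (x *m y *m invmx x) = pev e y.

Definition equivariant_expr F := (forall y, Gs y -> lieA Gs (mev F y)) /\
  forall x y, Gs x -> Gs y -> mev F (x *m y *m invmx x) = x *m mev F y *m invmx x.

Let uP := rd_unit RD.
Let T := tor P w.
(** The coordinates of an equivariant map on the torus, in which the problem becomes linear algebra
    over Laurent polynomials. *)
Let eta F u j := B (mev F (T u)) (Hj P w j).

Let HjL j : lieA Gs (Hj P w j). Proof. exact: hL (Hj_in RD j). Qed.
Let T_in u : unitv u -> Gs (T u). Proof. exact: tor_in. Qed.

Lemma class_expr_torus e : class_expr e -> (forall u, unitv u -> pev e (T u) = 0) ->
  vanish Gs e.
Proof.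
move=> he e0; apply: (torus_conj_dense GsG uP HjL hG1); first exact: torus_root_span RD.
by move=> g u gG hu; rewrite he ?e0 //; apply: T_in.
Qed.

Lemma equivariant_expr_torus F : equivariant_expr F ->
  (forall u, unitv u -> mev F (T u) = 0) -> forall y, Gs y -> mev F y = 0.
Proof.
move=> [_ hF] F0 y yG; apply/matrixP => i j; rewrite mxE [RHS]mxE; move: y yG.
apply: (torus_conj_dense GsG uP HjL hG1); first exact: torus_root_span RD.
move=> g u gG hu; have := hF _ _ gG (T_in hu); rewrite F0 // mulmx0 mul0mx.
by move/matrixP/(_ i j); rewrite !mxE.
Qed.

(** The torus is commutative, so equivariance makes the value at a torus point commute with the
    whole torus. *)
Lemma equivariant_torus_in F u : equivariant_expr F -> unitv u -> mev F (T u) \in h.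
Proof.
move=> [FL hF] hu; have TuG := T_in hu; apply: (h_of_torus_comm hself RD) => [|v hv].
  exact: FL.
have TvG := T_in hv; have ut := ag_unit GsG TvG.
have := hF _ _ TvG TuG; have -> : T v *m T u *m invmx (T v) = T u.
  by apply: (canLR (mulmxK ut)); rewrite !torM //; apply: eq_tor => j; rewrite mulrC.
by move=> E; rewrite [in RHS]E mulmxKV.
Qed.

Lemma eta_laurent F j : laurent (fun u => eta F u j).
Proof.
have [I [l [c [E _]]]] := pev_tor w uP (linE (B^~ (Hj P w j)) F) (unitmx1 C N).
by exists I, l, c => u hu; rewrite -E // mul1mx pev_linE.
Qed.

(** Equivariance under the group element representing the reflection moves that element to the
    argument of [B]; invariance of [B] moves it on to the coroot. *)
Lemma eta_srefl F k u j : equivariant_expr F -> unitv u ->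
  eta F (srefl A k u) j = eta F u j - eta F u k * (A k j)%:~R.
Proof.
move=> hF hu; have [g gG [gh gt]] := weyl_torus GsG RD k.
have ug := ag_unit GsG gG; have := hF => -[FL Fc].
have TE : T (srefl A k u) = g *m T u *m invmx g by rewrite /T gt.
rewrite /eta TE Fc //; last exact: T_in.
have aH : al k (Hj P w k) = 2 by rewrite (rd_al RD) (rd_diag RD).
have Hk := Hj_in RD k; have Hj' := Hj_in RD j.
have sH : Hj P w j - (A k j)%:~R *: Hj P w k \in h by rewrite memvB ?memvZ.
have HE : Hj P w j = g *m (Hj P w j - (A k j)%:~R *: Hj P w k) *m invmx g.
  rewrite gh // linfunD // -scaleNr linfunZ // aH (rd_al RD).
  apply/matrixP => a b; rewrite !mxE.
  by ring.
rewrite [X in B _ X]HE Binv //; [|exact: FL (T_in hu)|exact: hL].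
by rewrite linfunD // -scaleNr linfunZ // mulNr mulrC.
Qed.

Variables (chi : 'I_r -> rexp C N) (Gr : 'I_r -> 'I_N -> 'I_N -> rexp C N).
Hypotheses (chi_class : forall i, class_expr (chi i))
  (chi_top : forall i, top A (delta_mx 0 i) 1 (fun u => pev (chi i) (T u)))
  (chi_dtop : forall i j,
     top A (delta_mx 0 i) (i == j)%:R (fun u => pev (dd 0 (Hj P w j) (chi i)) (T u)))
  (GrE : forall i, equivariant_expr (Gr i))
  (Gr_grad : forall i y X, Gs y -> lieA Gs X ->
     B (mev (Gr i) y) X = pdir (chi i) y (y *m X)).

(** By [Gr_grad] the entries are the derivatives of the i-th character along the j-th coroot. The
    determinant [J] plays the role of the Weyl denominator. *)
Let M u : 'M[C]_r := \matrix_(i, j) eta (Gr i) u j.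
Let J u := \det (M u).

Lemma J_top : top A (\sum_i delta_mx 0 i) 1 J.
Proof.
have := top_det chi_dtop; rewrite [\det _](_ : _ = 1); last first.
  by rewrite -[RHS](det1 C r); congr (\det _); apply/matrixP => i j; rewrite !mxE.
apply: eq_top => u hu; congr (\det _); apply/matrixP => i j; rewrite !mxE.
have ut := ag_unit GsG (T_in hu).
by rewrite pev_dd // mul0mx add0r /eta Gr_grad //; apply: T_in.
Qed.

Lemma M_srefl k u : unitv u -> M (srefl A k u) = M u *m reflmx k (fun j => (A k j)%:~R).
Proof.
move=> hu; apply/row_matrixP => i; rewrite row_mul; apply/rowP => j.
by rewrite mul_reflmx !mxE eta_srefl.
Qed.

Let det_reflA k : \det (reflmx k (fun j => (A k j)%:~R : C)) = -1.
Proof. by apply: det_reflmx; rewrite (rd_diag RD). Qed.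

Lemma J_anti : anti A J.
Proof. by move=> k u hu; rewrite /J M_srefl // det_mulmx det_reflA mulrN1. Qed.

Lemma J_laurent : laurent J.
Proof. by apply: laurent_det => i j; apply: eta_laurent. Qed.

Lemma chi_srefl i k u : unitv u -> pev (chi i) (T (srefl A k u)) = pev (chi i) (T u).
Proof.
move=> hu; have [g gG [_ gt]] := weyl_torus GsG RD k.
have -> : T (srefl A k u) = g *m T u *m invmx g by rewrite /T gt.
by rewrite chi_class //; apply: T_in.
Qed.

(** This extends the coefficients from the torus to the group: found there as polynomials in the
    characters, they make sense as class functions everywhere. *)
Lemma poly_expr (t : seq (C * {ffun 'I_r -> nat})) : exists a, class_expr a /\
  forall y, pev a y = \sum_(z <- t) z.1 * \prod_i pev (chi i) y ^+ z.2 i.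
Proof.
suff [a aE] : exists a, forall y,
    pev a y = \sum_(z <- t) z.1 * \prod_i pev (chi i) y ^+ z.2 i.
  exists a; split=> // x y xG yG; rewrite !aE; apply: eq_bigr => z _; congr (_ * _).
  by apply: eq_bigr => i _; rewrite chi_class.
have powE e n : exists a, forall y, pev a y = pev e y ^+ n.
  elim: n => [|n [a aE]]; first by exists (PC 1) => y; rewrite expr0.
  by exists (PMul e a) => y; rewrite exprS -aE.
have prodE (n : {ffun 'I_r -> nat}) (s : seq 'I_r) :
    exists a, forall y, pev a y = \prod_(i <- s) pev (chi i) y ^+ n i.
  elim: s => [|i s [a aE]]; first by exists (PC 1) => y; rewrite big_nil.
  by have [b bE] := powE (chi i) (n i); exists (PMul b a) => y; rewrite big_cons -aE -bE.
elim: t => [|z t [a aE]]; first by exists (PC 0) => y; rewrite big_nil.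
have [b bE] := prodE z.2 (index_enum _).
by exists (PAdd (PScale z.1 b) a) => y; rewrite big_cons -aE -bE.
Qed.

Lemma height_datum : exists x : 'I_r -> int,
  (forall j, 0 <= x j) /\ forall k, 0 < \sum_j A k j * x j.
Proof. exact: height_exists (rd_offdiag RD) (rd_form RD) (rd_faithful RD). Qed.

Lemma J_cancel f : laurent f -> (forall u, unitv u -> J u * f u = 0) ->
  forall u, unitv u -> f u = 0.
Proof.
move=> hf h0; apply: (laurent_domain hf J_laurent) => [u hu|].
  by rewrite mulrC h0.
have [x [_ xA]] := height_datum.
exact: top_neq0 xA J_top (oner_neq0 _).
Qed.

(** Cramer's rule on the torus, division of the numerators by [J], and density of the conjugates of
    the torus applied to the difference of the two sides. *)
Theorem gradients_span F : equivariant_expr F -> exists2 a : 'I_r -> rexp C N,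
  (forall i, class_expr (a i)) & forall y, Gs y -> mev F y = \sum_i pev (a i) y *: mev (Gr i) y.
Proof.
move=> hF; have [x [x0 xA]] := height_datum.
(* Numerators of Cramer's rule. A reflection multiplies all rows, including the replaced one, by the
   same matrix of determinant -1. *)
pose D i u := \det (set_row i (\row_j eta F u j) (M u)).
have D_laurent i : laurent (D i).
  apply: laurent_det => a b; case: (a == i); first by
    apply: eq_laurent (eta_laurent F b) => u _; rewrite mxE.
  by apply: eq_laurent (eta_laurent (Gr a) b) => u _; rewrite mxE.
have D_anti i : anti A (D i).
  move=> k u hu; rewrite /D M_srefl //.
  have -> : \row_j eta F (srefl A k u) j =
      \row_j eta F u j *m reflmx k (fun j => (A k j)%:~R).
    by apply/rowP => j; rewrite mul_reflmx !mxE eta_srefl.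
  by rewrite set_row_mul det_mulmx det_reflA mulrN1.
have /fin_all_exists[t tE] i : exists t, forall u, unitv u ->
    D i u = J u * chi_poly (fun i u => pev (chi i) (T u)) t u.
  have [m hm] := laurent_low_ht x (D_laurent i).
  by have := anti_divisible (rd_diag RD) x0 xA chi_top chi_srefl J_top J_anti (D_anti i) hm.
have /fin_all_exists[a aE] i := poly_expr (t i).
exists a => [i|]; first by case: (aE i).
have aT i u : pev (a i) (T u) = chi_poly (fun i u => pev (chi i) (T u)) (t i) u.
  by case: (aE i) => _ ->.
pose S := fun k l => PAdd (F k l) (psum (index_enum 'I_r) (fun i => PScale (-1) (PMul (a i) (Gr i k l)))).
have SE y : mev S y = mev F y - \sum_i pev (a i) y *: mev (Gr i) y.
  apply/matrixP => k l; rewrite !mxE /= pev_sum summxE -sumrN; congr (_ + _).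
  by apply: eq_bigr => i _; rewrite !mxE /= mulN1r.
have hS : equivariant_expr S.
  have [FL Fc] := hF; split=> [y yG|z y zG yG].
    rewrite SE; apply: lieAD; first exact: FL.
    apply/lieAN/lieA_sum => i _; apply: lieAZ; have [GL _] := GrE i.
    exact: GL.
  rewrite !SE Fc // mulmxBr mulmxBl mulmx_sumr mulmx_suml; congr (_ - _).
  apply: eq_bigr => i _; have [_ GC] := GrE i; have [aC _] := aE i.
  by rewrite GC // aC // -scalemxAr -scalemxAl.
suff S0 : forall y, Gs y -> mev S y = 0.
  by move=> y yG; apply/eqP; rewrite -subr_eq0 -SE S0.
apply: equivariant_expr_torus => // u hu.
(* The value of the difference lies in [h], where pairing with the coroots detects 0; each pairing
   is then shown to vanish after multiplication by [J]. *)
apply: (rd_B RD); first exact: equivariant_torus_in.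
move=> j; pose f u := eta F u j - \sum_i pev (a i) (T u) * eta (Gr i) u j.
have -> : B (mev S (T u)) (Hj P w j) = f u.
  have linB := BL (Hj P w j); rewrite SE -scaleN1r addrC (linB (-1)) mulN1r addrC; congr (_ - _).
  rewrite (linfun_sum _ _ linB); apply: eq_bigr => i _.
  exact: (linfunZ _ _ linB).
move: u hu; apply: J_cancel => [|u hu].
  have hs : laurent (fun u => \sum_i pev (a i) (T u) * eta (Gr i) u j).
    apply: laurent_sum => i; apply: laurentM; last exact: eta_laurent.
    have [I [l [c [E _]]]] := pev_tor w uP (a i) (unitmx1 C N).
    by exists I, l, c => u hu; rewrite -E // mul1mx.
  apply: eq_laurent (laurentD (eta_laurent F j) (laurentM (laurentC r (-1)) hs)) => u hu.
  by rewrite mulN1r.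
have := cramer_rows (\row_j eta F u j) (M u); move/rowP/(_ j); rewrite summxE => cr.
rewrite /f mulrBr; apply/eqP; rewrite subr_eq0; apply/eqP.
transitivity ((\det (M u) *: \row_j eta F u j) 0 j); first by rewrite [RHS]mxE; congr (_ * _); rewrite mxE.
rewrite -cr mulr_sumr; apply: eq_bigr => i _; rewrite !mxE -/(D i u) tE // aT.
by rewrite mulrA.
Qed.

(** On the torus the relation says that the row of coefficients times [M] is 0. Multiplying by the
    adjugate leaves [J] times each coefficient, and [J] cancels. *)
Theorem gradients_free (a : 'I_r -> rexp C N) : (forall i, class_expr (a i)) ->
  (forall y, Gs y -> \sum_i pev (a i) y *: mev (Gr i) y = 0) ->
  forall i, vanish Gs (a i).
Proof.
move=> ha h0 i; apply: class_expr_torus => //; apply: J_cancel => [|u hu].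
  have [I [l [c [E _]]]] := pev_tor w uP (a i) (unitmx1 C N).
  by exists I, l, c => u hu; rewrite -E // mul1mx.
pose v := \row_i pev (a i) (T u).
have vM : v *m M u = 0.
  apply/rowP => j; rewrite !mxE; have linB := BL (Hj P w j).
  transitivity (B (\sum_i pev (a i) (T u) *: mev (Gr i) (T u)) (Hj P w j)).
    rewrite (linfun_sum _ _ linB); apply: eq_bigr => k _.
    by rewrite (linfunZ _ _ linB) !mxE.
  by rewrite h0 ?(linfun0 linB) //; apply: T_in.
have : (\det (M u) *: v) 0 i = 0.
  by rewrite -mul_mx_scalar -mul_mx_adj mulmxA vM mul0mx mxE.
by rewrite !mxE.
Qed.

End ModuleBasis.

(** * Polynomials with powers of the determinant versus formal expressions *)

Section RegularFunctions.
Variables (R : realType) (N : nat).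
Local Notation C := R[i]%C.
Implicit Types (e : rexp C N) (F : 'M[C]_N -> C).

Definition polyf F := exists p, forall M, F M = evalmx p M.

Lemma polyfC c : polyf (fun=> c).
Proof. by exists (mpoly.mpolyC _ c) => M; rewrite /evalmx mpoly.mevalC. Qed.

Lemma polyfX i j : polyf (fun M => M i j).
Proof.
by exists (mpoly.mpolyX _ (mpoly.mnm1 (mxvec_index i j))) => M; rewrite /evalmx mpoly.mevalXU mxvecE.
Qed.

Lemma polyfD F F' : polyf F -> polyf F' -> polyf (fun M => F M + F' M).
Proof. by move=> [p pE] [q qE]; exists (p + q) => M; rewrite /evalmx mpoly.mevalD pE qE. Qed.

Lemma polyfM F F' : polyf F -> polyf F' -> polyf (fun M => F M * F' M).
Proof. by move=> [p pE] [q qE]; exists (p * q) => M; rewrite /evalmx mpoly.mevalM pE qE. Qed.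

Lemma eq_polyf F F' : F =1 F' -> polyf F -> polyf F'.
Proof. by move=> FF [p pE]; exists p => M; rewrite -FF. Qed.

Lemma polyf_sum (I : Type) (s : seq I) (F : I -> 'M[C]_N -> C) :
  (forall i, polyf (F i)) -> polyf (fun M => \sum_(i <- s) F i M).
Proof.
move=> h; elim: s => [|i s ih]; first by apply: eq_polyf (polyfC 0) => M; rewrite big_nil.
by apply: eq_polyf (polyfD (h i) ih) => M; rewrite big_cons.
Qed.

Lemma polyf_prod (I : Type) (s : seq I) (F : I -> 'M[C]_N -> C) :
  (forall i, polyf (F i)) -> polyf (fun M => \prod_(i <- s) F i M).
Proof.
move=> h; elim: s => [|i s ih]; first by apply: eq_polyf (polyfC 1) => M; rewrite big_nil.
by apply: eq_polyf (polyfM (h i) ih) => M; rewrite big_cons.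
Qed.

Lemma polyf_exp F k : polyf F -> polyf (fun M => F M ^+ k).
Proof.
move=> hF; elim: k => [|k ih]; first by apply: eq_polyf (polyfC 1) => M; rewrite expr0.
by apply: eq_polyf (polyfM hF ih) => M; rewrite exprS.
Qed.

Lemma polyf_det n (S : 'M[C]_N -> 'M[C]_n) : (forall i j, polyf (fun M => S M i j)) ->
  polyf (fun M => \det (S M)).
Proof.
move=> h; apply: polyf_sum => s; apply: polyfM; first exact: polyfC.
by apply: polyf_prod => i; apply: h.
Qed.

Lemma polyf_rexp F : polyf F -> exists e, forall M, F M = pev e M.
Proof.
move=> [p pE]; have /fin_all_exists[x xE] (k : 'I_(N * N)) :
    exists e : rexp C N, forall M, pev e M = mxvec M ord0 k.
  by case/mxvec_indexP: k => i j; exists (PX i j) => M; rewrite mxvecE.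
have powE e n : exists a : rexp C N, forall M, pev a M = pev e M ^+ n.
  elim: n => [|n [a aE]]; first by exists (PC 1) => M; rewrite expr0.
  by exists (PMul e a) => M; rewrite exprS -aE.
have prodE (n : 'I_(N * N) -> nat) (s : seq 'I_(N * N)) :
    exists a : rexp C N, forall M, pev a M = \prod_(k <- s) mxvec M ord0 k ^+ n k.
  elim: s => [|k s [a aE]]; first by exists (PC 1) => M; rewrite big_nil.
  by have [b bE] := powE (x k) (n k); exists (PMul b a) => M; rewrite big_cons -aE -xE -bE.
suff [e eE] : exists e : rexp C N, forall M, pev e M = \sum_(m <- mpoly.msupp p)
    mpoly.mcoeff m p * \prod_k mxvec M ord0 k ^+ mpoly.fun_of_multinom m k.
  by exists e => M; rewrite pE /evalmx mpoly.mevalE eE.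
elim: (mpoly.msupp p) => [|m s [e eE]]; first by exists (PC 0) => M; rewrite big_nil.
have [a aE] := prodE (mpoly.fun_of_multinom m) (index_enum _).
by exists (PAdd (PScale (mpoly.mcoeff m p) a) e) => M; rewrite big_cons -eE -aE.
Qed.

Lemma rexp_regularGL e : exists (p : 'M[C]_N -> C) (k : nat), polyf p /\
  forall M, M \in unitmx -> pev e M = p M / \det M ^+ k.
Proof.
have hdet : polyf (fun M : 'M[C]_N => \det M) by apply: polyf_det => i j; apply: polyfX.
elim: e => [c|i j|i j|e1 [p1 [k1 [h1 E1]]] e2 [p2 [k2 [h2 E2]]]
    |e1 [p1 [k1 [h1 E1]]] e2 [p2 [k2 [h2 E2]]]|c e [p [k [h E]]]].
- by exists (fun=> c), 0; split=> [|M _] /=; [exact: polyfC|rewrite expr0 divr1].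
- by exists (fun M => M i j), 0; split=> [|M _] /=; [exact: polyfX|rewrite expr0 divr1].
- exists (fun M => \adj M i j), 1; split=> [|M uM] /=.
    apply: (@eq_polyf (fun M => (-1) ^+ (j + i) * \det (row' j (col' i M)))) => [M|].
      by rewrite mxE.
    apply: polyfM; first exact: polyfC.
    apply: polyf_det => a b; apply: (eq_polyf _ (polyfX (lift j a) (lift i b))) => M.
    by rewrite !mxE.
  by rewrite /invmx uM mxE mulrC expr1.
- exists (fun M => p1 M * \det M ^+ k2 + p2 M * \det M ^+ k1), (k1 + k2)%N; split=> [|M uM] /=.
    by apply: polyfD; apply: polyfM => //; apply: polyf_exp.
  have d0 : \det M != 0 by move: uM; rewrite unitmxE unitfE.
  by rewrite E1 // E2 // exprD; field; rewrite !expf_neq0.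
- exists (fun M => p1 M * p2 M), (k1 + k2)%N; split=> [|M uM] /=; first exact: polyfM.
  have d0 : \det M != 0 by move: uM; rewrite unitmxE unitfE.
  by rewrite E1 // E2 // exprD; field; rewrite !expf_neq0.
exists (fun M => c * p M), k; split=> [|M uM] /=; last by rewrite E // mulrA.
by apply: polyfM => //; apply: polyfC.
Qed.

Lemma regularGL_rexp F : regularGL F <-> exists e, forall M, M \in unitmx -> F M = pev e M.
Proof.
split=> [[p [k pE]]|[e eE]]; last first.
  have [q [k [[p pE] qE]]] := rexp_regularGL e.
  by exists p, k => M uM; rewrite eE // qE // pE.
have [ep epE] : exists e : rexp C N, forall M, evalmx p M = pev e M by apply: polyf_rexp; exists p.
have [ed edE] : exists e : rexp C N, forall M : 'M[C]_N, \det M = pev e M.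
  by apply: polyf_rexp; apply: polyf_det => i j; apply: polyfX.
have [ei eiE] : exists e : rexp C N, forall M : 'M[C]_N, M \in unitmx -> pev e M = (\det M ^+ k)^-1.
  have ps : pev (psub PV PX ed) =1 fun M => pev ed (invmx M).
    by move=> M; rewrite pev_sub !mevE ?invmxK.
  elim: k {pE} => [|k [ei eiE]]; first by exists (PC 1) => M _; rewrite expr0 invr1.
  exists (PMul (psub PV PX ed) ei) => M uM /=.
  by rewrite ps -edE det_inv eiE // exprS invfM.
by exists (PMul ep ei) => M uM /=; rewrite pE // epE eiE.
Qed.

End RegularFunctions.

(** * Analytic derivatives, the archimedean property and path connectedness *)

Section LinesAndPaths.
Variables (R : realType) (N : nat).
Local Open Scope classical_set_scope.
Local Notation C := R[i]%C.
Implicit Types (e : rexp C N) (F : 'M[C]_N -> C).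

Lemma derive1_quadratic (f : C -> C) (d K b : C) : 0 < b ->
  (forall t, `|t| <= b -> `|f t - f 0 - t * d| <= K * `|t| ^+ 2) -> derive1 f 0 = d.
Proof.
move=> b0 hf; have K0 : 0 <= K.
  have := hf b; rewrite gtr0_norm // lexx => /(_ isT) /(le_trans (normr_ge0 _)).
  by rewrite pmulr_lge0 // exprn_gt0.
rewrite /derive1; apply: cvg_lim => //.
apply/cvgrPdist_le => eps eps0.
pose q := K + 1.
have q0 : 0 < q by rewrite ltr_wpDl.
near=> t.
have t0 : t != 0 by near: t; exact: nbhs_dnbhs_neq.
have tb : `|t| <= b by near: t; apply: dnbhs0_le.
have te : `|t| <= eps / q by near: t; apply: dnbhs0_le; rewrite divr_gt0.
rewrite addr0 distrC -[_ *: _]/(t^-1 * (f t - f 0)) -[d](mulKf t0) -mulrBr normrM normfV.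
rewrite ler_pdivrMl ?normr_gt0 // (le_trans (hf t tb)) // expr2 mulrCA mulrC.
rewrite [leLHS]mulrC ler_wpM2l // (le_trans (ler_wpM2l K0 te)) //.
by rewrite mulrCA ger_pMr // ler_pdivrMr // mul1r /q lerDl.
Unshelve. all: by end_near. Qed.

Lemma derive1_line F e A V : A \in unitmx -> (forall M, M \in unitmx -> F M = pev e M) ->
  derive1 (fun t : C => F (A + t *: V)) 0 = pdir e A V.
Proof.
move=> uA FE; have [K [K0 _ hK]] := taylor e uA.
have b0 : 0 < (K * nrm V + 1)^-1 by rewrite invr_gt0 ltr_wpDl // mulr_ge0 ?nrm_ge0.
apply: (derive1_quadratic (b := _) (K := K * nrm V ^+ 2) b0) => t tb.
have small : K * nrm (t *: V) <= 1.
  rewrite nrmZ mulrCA; have := ler_wpM2r (mulr_ge0 K0 (nrm_ge0 V)) tb => /le_trans; apply.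
  rewrite mulrC ler_pdivrMr; last by rewrite ltr_wpDl // mulr_ge0 ?nrm_ge0.
  by rewrite mul1r lerDl.
have [uAV _ _ h] := hK _ small.
rewrite scale0r addr0 !FE // -pdirZ (le_trans h) // nrmZ exprMn.
by rewrite mulrCA mulrC.
Qed.

Lemma archi_pow2 (x : C) : 0 < x -> exists n : nat, (2 ^- n : C) < x.
Proof.
case: x => a b; rewrite ltcE /= => /andP[/eqP b0 a0].
have [n hn] : exists n : nat, a^-1 < n%:R.
  by exists (Num.truncn a^-1).+1; rewrite truncnS_gt.
exists n; have -> : (2 ^- n : C) = ((2 ^- n)%:C)%C.
  by rewrite (fmorphV (@real_complex R)) (rmorphXn (@real_complex R)) (rmorph_nat (@real_complex R)).
rewrite ltcE /= -b0 eqxx /= invf_plt ?posrE ?exprn_gt0 //.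
rewrite (lt_le_trans hn) // -natrX ler_nat ltnW // ltn_expl //.
Qed.


Lemma nbhs_mx_nrm (M : 'M[C]_N) (d : C) : 0 < d ->
  nbhs M [set M' : 'M[C]_N | nrm (M' - M) <= d].
Proof.
move=> d0; pose q : C := (N * N)%:R + 1.
have q0 : 0 < q by rewrite ltr_wpDl.
apply/nbhs_ballP; exists (d / q); first by rewrite /= divr_gt0.
move=> M' [_ hM] /=; apply: (@le_trans _ _ ((N * N)%:R * (d / q))).
  apply: nrm_le_entries => i j; have := hM i j; rewrite -ball_normE /= distrC => /ltW.
  by rewrite !mxE.
by rewrite mulrCA ger_pMr // ler_pdivrMr // mul1r lerDl.
Qed.

(** Pull the property back along a path from 1: its truth set is nonempty, open and closed in the
    segment, hence the whole segment. *)
Lemma path_connected_nrm (Gs : set 'M[C]_N) :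
  (forall x y, Gs x -> Gs y -> exists p : R -> 'M[C]_N,
     [/\ {within `[0, 1], continuous p}, (p @` `[0, 1] `<=` Gs),
         p 0 = x & p 1 = y]) ->
  Gs 1%:M -> connectedA Gs.
Proof.
move=> hp G1 Q g gG Q1 hQ; have [p [pc pG p0 p1]] := hp _ _ G1 gG.
have loc t : `[0, 1] t -> exists2 e : R, 0 < e &
    forall s, `[0, 1] s -> `|s - t| < e -> (Q (p t) <-> Q (p s)).
  move=> t01; have [|d d0 hd] := hQ (p t); first by apply: pG; exists t.
  move/subspace_continuousP: pc => /(_ t t01) /(_ _ (nbhs_mx_nrm (p t) d0)).
  rewrite nbhs_filterE /= /within /= => /nbhs_ballP[e e0 he]; exists e => // s s01 st.
  apply: hd; first by apply: pG; exists s.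
  by apply: he => //; rewrite -ball_normE /= distrC.
(* The union of balls centred at points of [S] within which the property is constant on the segment.
   It is open in the whole line although the path is controlled only on the segment. *)
pose O (S : R -> Prop) : set R := [set s : R | exists (t : R) (e : R), [/\ `[0, 1] t, S t, 0 < e,
  `|s - t| < e & forall s', `[0, 1] s' -> `|s' - t| < e -> (Q (p t) <-> Q (p s'))]].
have O_open S : open (O S).
  rewrite openE => s [t [e [t01 St e0 st h]]]; apply/nbhs_ballP.
  exists (e - `|s - t|); first by rewrite /= subr_gt0.
  move=> s'; rewrite -ball_normE /= => hs; exists t, e; split=> //.
  rewrite -(subrK s s') -addrA (le_lt_trans (ler_normD _ _)) //.
  by rewrite -ltrBrDr distrC.
have itv0 : `[0 : R, 1] 0 by rewrite /= in_itv /= lexx ler01.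
have itv1 : `[0 : R, 1] 1 by rewrite /= in_itv /= lexx ler01.
have Oin (S : R -> Prop) t : `[0, 1] t -> S t -> O S t.
  by move=> t01 St; have [e e0 he] := loc t t01; exists t, e; split=> //; rewrite subrr normr0.
pose U := [set t : R | `[0, 1] t /\ Q (p t)].
have -> : g = p 1 by rewrite p1.
suff : U = `[0, 1] by move/seteqP => [_ /(_ 1 itv1)] [].
apply: (@segment_connected R 0 1).
- by exists 0; split=> //; rewrite p0.
- exists (O (Q \o p)); first exact: O_open.
  apply/seteqP; split=> t [t01 h]; split=> //; first exact: Oin.
  by case: h => s [e [s01 Qs e0 ts /(_ t t01 ts)]] [] h _; apply: h.
exists (~` O (fun t => ~ Q (p t))); first by apply: open_closedC; apply: O_open.
apply/seteqP; split=> t [t01 h]; split=> //.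
  by move=> [s [e [s01 Qs e0 ts /(_ t t01 ts)]]] [] _ h'; apply: Qs; apply: h'.
by apply: contrapT => nQ; apply: h; apply: Oin.
Qed.

End LinesAndPaths.

(** * Groups, regular functions and invariant fields of the statement as formal expressions *)

Section FrozenGroups.
Variables (R : realType) (N : nat) (G : linAlgGroup R N).
Local Notation C := R[i]%C.
Let Gs : 'M[C]_N -> Prop := lag_set G.
Implicit Types (e : rexp C N) (f : G -> C) (g y : G) (X : 'M[C]_N).

Lemma lag_alg_group : alg_group Gs.
Proof.
split; [exact: lag_unit|exact: lag_one|exact: lag_mul|exact: lag_inv|].
move=> g ug hg; have [I hI] := lag_closed G; apply/(hI g ug) => p Ip.
have [e eE] : exists e, forall M : 'M[C]_N, evalmx p M = pev e M by apply: polyf_rexp; exists p.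
rewrite eE; apply: hg => x xG; rewrite -eE.
by have [h _] := hI x (lag_unit xG); apply: h xG p Ip.
Qed.
Let GsG := lag_alg_group.

Definition mkG (x : 'M[C]_N) (xG : Gs x) : G := exist _ x (mem_set xG).

Lemma Gs_val g : Gs (val g). Proof. exact: set_valP. Qed.

Lemma unit_val g : val g \in unitmx. Proof. exact: lag_unit (Gs_val g). Qed.

Lemma regular_rexp f : regular f <-> exists e, forall g, f g = pev e (val g).
Proof.
split=> [[F /regularGL_rexp[e eE] Ff]|[e eE]].
  by exists e => g; rewrite -Ff eE // unit_val.
exists (pev e); last by move=> g; rewrite eE.
by apply/regularGL_rexp; exists e.
Qed.

Lemma ext_rexp f : regular f -> exists e, (forall M, M \in unitmx -> ext f M = pev e M) /\
  forall g, f g = pev e (val g).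
Proof.
move=> [F hF Ff]; have [/regularGL_rexp[e eE] ef] :
    [set F | regularGL F /\ extends F f]%classic (ext f) by apply: xgetPex; exists F.
by exists e; split=> // g; rewrite -ef eE // unit_val.
Qed.

(** Clear denominators: a regular function vanishing on the group is a polynomial divided by a power
    of the determinant. The product rule at 1, where that power is 1 and the function is 0,
    identifies the two differentials. *)
Lemma lie_lieA X : lie G X <-> lieA Gs X.
Proof.
split=> [hX e he|hX p hp]; last first.
  have [e eE] : exists e, forall M : 'M[C]_N, evalmx p M = pev e M.
    by apply: polyf_rexp; exists p.
  rewrite (@derive1_line _ _ _ e) ?unitmx1 //; apply: hX => x xG.
  by rewrite -eE; apply: (hp (mkG xG)).
have [q [k [[p pE] qE]]] := rexp_regularGL e.
have [ed edE] : exists e, forall M : 'M[C]_N, \det M ^+ k = pev e M.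
  by apply/polyf_rexp/polyf_exp/polyf_det => i j; apply: polyfX.
have [ep epE] : exists e, forall M : 'M[C]_N, evalmx p M = pev e M.
  by apply: polyf_rexp; exists p.
have eqE : eqv (PMul e ed) ep.
  move=> M uM /=; rewrite qE // -edE -epE pE mulfVK //.
  by rewrite expf_neq0 // -unitfE -unitmxE.
have : pdir ep 1%:M X = 0.
  rewrite -(@derive1_line _ _ (evalmx p)) ?unitmx1 //; apply: hX => g.
  rewrite epE -eqE ?unit_val //=.
  by rewrite he ?mul0r //; apply: Gs_val.
rewrite -(pdir_unique X eqE (unitmx1 _ _)) /= -edE det1 expr1n mulr1 he ?mul0r ?addr0 //.
exact: (ag_one GsG).
Qed.

Lemma pdir_agree e e' g X : (forall g, pev e (val g) = pev e' (val g)) -> lieA Gs X ->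
  pdir e (val g) (val g *m X) = pdir e' (val g) (val g *m X).
Proof.
move=> ee' hX; apply/eqP; rewrite -subr_eq0 -mulN1r; apply/eqP.
have hv : vanish Gs (PAdd e (PScale (-1) e')).
  by move=> x xG /=; rewrite mulN1r (ee' (mkG xG)) subrr.
exact: (vanish_pdir GsG hv (Gs_val g) hX).
Qed.

Lemma differentialE f e g X : (forall g, f g = pev e (val g)) -> lieA Gs X ->
  differential f g X = pdir e (val g) (val g *m X).
Proof.
move=> fE hX; have [|e' [eE' fE']] := @ext_rexp f; first by apply/regular_rexp; exists e.
rewrite (@pdir_agree e e') => [|g'|//]; last by rewrite -fE.
rewrite -(derive1_line _ (unit_val g) eE'); congr (derive1 _ 0); apply/funext => t.
by rewrite mulmxDr mulmx1 -scalemxAr.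
Qed.

Lemma field_ofE Phi f e y : (forall g, f g = pev e (val g)) -> lieA Gs (Phi y) ->
  field_of Phi f y = pdir e (val y) (val y *m Phi y).
Proof.
move=> fE hX; have [|e' [eE' fE']] := @ext_rexp f; first by apply/regular_rexp; exists e.
rewrite (@pdir_agree e e') => [|g'|//]; last by rewrite -fE.
by rewrite -(derive1_line _ (unit_val y) eE').
Qed.

Lemma pdir_expr (W : 'I_N -> 'I_N -> rexp C N) e :
  exists e', forall A, pev e' A = pdir e A (mev W A).
Proof.
elim: e => [c|i j|i j|e1 [a1 h1] e2 [a2 h2]|e1 [a1 h1] e2 [a2 h2]|c e [a h]] /=.
- by exists (PC 0).
- by exists (W i j) => A; rewrite mxE.
- exists (PScale (-1) (mulE (mulE PV W) PV i j)) => A; rewrite [LHS]mulN1r; congr (- _).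
  transitivity (mev (mulE (mulE PV W) PV) A i j); first by rewrite mxE.
  by rewrite !mevE.
- by exists (PAdd a1 a2) => A /=; rewrite h1 h2.
- by exists (PAdd (PMul a1 e2) (PMul e1 a2)) => A /=; rewrite h1 h2.
by exists (PScale c a) => A /=; rewrite h.
Qed.

Lemma equivariant_map_expr F : equivariant_expr Gs F ->
  equivariant_map (fun y : G => mev F (val y)).
Proof.
move=> [FL Fc]; split=> [y|i j|x y].
- by apply/lie_lieA/FL/Gs_val.
- by apply/regular_rexp; exists (F i j) => g; rewrite mxE.
by rewrite /= Fc //; apply: Gs_val.
Qed.

Lemma class_expr_val e : class_expr Gs e <-> class_function (fun g : G => pev e (val g)).
Proof.
split=> h x y; first by apply: h; apply: Gs_val.
by move=> xG yG; apply: (h (mkG xG) (mkG yG)).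
Qed.

Lemma conj_expr e (x : G) : forall y : G,
  pev e (val (conjG x y)) = pev (ptrans (val x) (invmx (val x)) e) (val y).
Proof. by move=> y; rewrite pev_trans ?unitmx_inv ?unit_val. Qed.

Lemma field_of_inv Phi F : (forall y : G, Phi y = mev F (val y)) -> equivariant_expr Gs F ->
  inv_vector_field (field_of Phi).
Proof.
move=> PhiE [FL Fc]; have PL y : lieA Gs (Phi y) by rewrite PhiE; apply/FL/Gs_val.
split; first split.
- move=> f /regular_rexp[e eE]; apply/regular_rexp.
  have [e' e'E] := pdir_expr (mulE PX F) e.
  by exists e' => g; rewrite (field_ofE eE) // e'E mev_mul mev_X PhiE.
- move=> a f1 f2 /regular_rexp[e1 E1] /regular_rexp[e2 E2]; apply/funext => y.
  rewrite (@field_ofE _ _ (PAdd (PScale a e1) e2)) //= => [|g]; last by rewrite -E1 -E2.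
  by rewrite -(field_ofE E1) // -(field_ofE E2).
- move=> f1 f2 /regular_rexp[e1 E1] /regular_rexp[e2 E2]; apply/funext => y.
  rewrite (@field_ofE _ _ (PMul e1 e2)) //= => [|g]; last by rewrite -E1 -E2.
  by rewrite -(field_ofE E1) // -(field_ofE E2) // -E1 -E2.
move=> x f /regular_rexp[e eE]; apply/funext => y.
rewrite (@field_ofE _ _ (ptrans (val x) (invmx (val x)) e)) //; last first.
  by move=> g; rewrite /= eE conj_expr.
rewrite pdir_trans ?unitmx_inv ?unit_val //= (field_ofE eE) //= !PhiE /= Fc //; try exact: Gs_val.
congr (pdir _ _ _); rewrite !mulmxA mulmxKV ?unit_val //.
Qed.

(* An invariant field is recovered from its values on the matrix entries. *)
Lemma inv_field_expr D : inv_vector_field D -> exists F, equivariant_expr Gs F /\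
  forall f, regular f -> D f = field_of (fun y : G => mev F (val y)) f.
Proof.
move=> [[Dreg Dlin DM] Dinv].
pose r e : G -> C := fun g => pev e (val g).
have rreg e : regular (r e) by apply/regular_rexp; exists e.
have rP f : regular f -> exists e, f = r e.
  by move=> /regular_rexp[e eE]; exists e; apply/funext.
have Dzero : D 0 = 0.
  have h0 : regular (0 : G -> C) by apply/regular_rexp; exists (PC 0).
  have := Dlin 1 0 0 h0 h0; rewrite !scale1r addr0 => /eqP.
  by rewrite -subr_eq0 opprD addrA subrr add0r oppr_eq0 => /eqP.
have DD e1 e2 : D (r (PAdd e1 e2)) = D (r e1) + D (r e2).
  rewrite -[X in X + _]scale1r -Dlin //; congr (D _); apply/funext => g.
  by rewrite /r /= scale1r.
have DZ c e : D (r (PScale c e)) = c *: D (r e).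
  rewrite -[RHS]addr0 -Dzero -Dlin //; last by apply/regular_rexp; exists (PC 0).
  by congr (D _); rewrite addr0.
have DMr e1 e2 : D (r (PMul e1 e2)) = D (r e1) * r e2 + r e1 * D (r e2) by rewrite -DM.
have D1 : D (r (PC 1)) = 0.
  have := DMr (PC 1) (PC 1); have -> : r (PMul (PC 1) (PC 1)) = r (PC 1).
    by apply/funext => g; rewrite /r /= mulr1.
  have -> : r (PC 1) = 1 by apply/funext.
  by rewrite mulr1 mul1r => /eqP; rewrite -subr_eq0 opprD addrA subrr add0r oppr_eq0 => /eqP.
have DC c : D (r (PC c)) = 0.
  have -> : r (PC c) = r (PScale c (PC 1)) by apply/funext => g; rewrite /r /= mulr1.
  by rewrite DZ D1 scaler0.
have Dsum (s : seq 'I_N) (a : 'I_N -> rexp C N) : D (r (psum s a)) = \sum_(k <- s) D (r (a k)).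
  by elim: s => [|k s ih]; rewrite ?big_nil ?big_cons /= ?DC // DD ih.
have /fin_all_exists[E EE] i : exists E : 'I_N -> rexp C N, forall j g,
    D (r (PX i j)) g = pev (E j) (val g).
  have /fin_all_exists[E EE] j : exists e, forall g, D (r (PX i j)) g = pev e (val g).
    by apply/regular_rexp/Dreg.
  by exists E.
pose V (g : G) := mev E (val g).
have VE g i j : D (r (PX i j)) g = V g i j by rewrite EE mxE.
(* The derivation applied to the constant entries of the product of a matrix with its inverse
   determines it on inverse entries. *)
have DV g i j : D (r (PV i j)) g = - (invmx (val g) *m V g *m invmx (val g)) i j.
  pose W : 'M[C]_N := \matrix_(i, j) D (r (PV i j)) g.
  suff : V g *m invmx (val g) + val g *m W = 0.
    move/(congr1 (mulmx (invmx (val g)))); rewrite mulmx0 mulmxDr mulKmx ?unit_val // mulmxA.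
    by move/eqP; rewrite addrC addr_eq0 => /eqP/matrixP/(_ i j); rewrite mxE [RHS]mxE.
  apply/matrixP => a b; rewrite [RHS]mxE.
  have : D (r (mulE PX PV a b)) = 0.
    rewrite -(DC ((a == b)%:R)); congr (D _); apply/funext => x; rewrite /r.
    transitivity (mev (mulE PX PV) (val x) a b); first by rewrite mxE.
    by rewrite !mevE mulmxV ?unit_val // mxE.
  move=> h; transitivity (D (r (mulE PX PV a b)) g); last by rewrite h.
  rewrite Dsum fct_sumE !mxE -big_split; apply: eq_bigr => k _.
  by rewrite DMr -VE [W _ _]mxE.
have DE e g : D (r e) g = pdir e (val g) (V g).
  elim: e => [c|i j|i j|e1 h1 e2 h2|e1 h1 e2 h2|c e h] /=.
  - by rewrite DC.
  - exact: VE.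
  - by rewrite DV.
  - by rewrite DD -h1 -h2.
  - by rewrite DMr -h1 -h2.
  by rewrite DZ -h.
have Vinv x g : V (conjG x g) = val x *m V g *m invmx (val x).
  apply/matrixP => i j; rewrite -VE.
  have := congr1 (fun q => q g) (Dinv x (r (PX i j)) (rreg _)) => /= <-.
  have -> : r (PX i j) \o conjG x = r (ptrans (val x) (invmx (val x)) (PX i j)).
    by apply/funext => y; rewrite /r /= -conj_expr.
  rewrite DE pdir_trans ?unitmx_inv ?unit_val //.
(* Left trivialization: the tangent vector [V g] at g is g times an element of the Lie algebra. *)
pose F := mulE PV E.
have FE (g : G) : mev F (val g) = invmx (val g) *m V g by rewrite mev_mul mev_V.
have FL : forall y : G, lieA Gs (mev F (val y)).
  move=> g e he; have ux := unit_val g; rewrite FE.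
  pose e' := ptrans (invmx (val g)) 1%:M e.
  have -> : pdir e 1%:M (invmx (val g) *m V g) = pdir e' (val g) (V g).
    by rewrite pdir_trans ?unitmx_inv ?unitmx1 // !mulmx1 mulVmx.
  rewrite -DE; have -> : r e' = 0; last by rewrite Dzero.
  apply/funext => x; rewrite /r pev_trans ?unitmx_inv ?unitmx1 ?unit_val // mulmx1.
  by apply: he; apply: lag_mul; [apply: lag_inv|]; apply: Gs_val.
exists F; split; [split|].
- by move=> y yG; apply: (FL (mkG yG)).
- move=> x y xG yG; have := Vinv (mkG xG) (mkG yG).
  have uy := lag_unit yG; have ux := lag_unit xG.
  rewrite (FE (mkG yG)) (FE (conjG (mkG xG) (mkG yG))) => -> /=.
  by rewrite !invmxM ?unitmx_mul ?unitmx_inv ?ux ?uy // invmxK !mulmxA mulmxKV.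
move=> f /rP[e ->]; apply/funext => y; rewrite (@field_ofE _ _ e) //.
by rewrite DE FE mulKVmx ?unit_val.
Qed.

End FrozenGroups.

(** * Gradients are regular and equivariant *)

Section Gradients.
Variables (C : numClosedFieldType) (N : nat) (Gs : 'M[C]_N -> Prop).
Variable B : 'M[C]_N -> 'M[C]_N -> C.
Hypotheses (GsG : alg_group Gs)
  (BL : forall Z, is_linfun (B^~ Z)) (BR : forall Z, is_linfun (B Z))
  (Bnd : forall X, lieA Gs X -> (forall Y, lieA Gs Y -> B X Y = 0) -> X = 0)
  (Binv : forall g X Y, Gs g -> lieA Gs X -> lieA Gs Y ->
     B (g *m X *m invmx g) (g *m Y *m invmx g) = B X Y).
Implicit Types (X Y : 'M[C]_N) (e : rexp C N).

Lemma lieA_vspace : exists U : {vspace 'M[C]_N}, forall X, lieA Gs X <-> X \in U.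
Proof.
apply: vspace_of_pred => [|a X Y hX hY]; first exact: lieA0.
by apply: lieAD => //; apply: lieAZ.
Qed.

Lemma gradient_unique X X' : lieA Gs X -> lieA Gs X' ->
  (forall Y, lieA Gs Y -> B X Y = B X' Y) -> X = X'.
Proof.
move=> hX hX' h; apply/eqP; rewrite -subr_eq0; apply/eqP; apply: Bnd => [|Y hY].
  by apply: lieAD => //; apply: lieAN.
by rewrite addrC -scaleN1r (BL Y (-1)) h // mulN1r addNr.
Qed.

(** Inverting the constant Gram matrix of [B] on a basis of the Lie algebra writes the gradient with
    left-invariant derivatives of [e] as coefficients, which are regular. *)
Lemma gradient_expr e : exists F : 'I_N -> 'I_N -> rexp C N, forall y, Gs y ->
  lieA Gs (mev F y) /\ forall X, lieA Gs X -> B (mev F y) X = pdir e y (y *m X).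
Proof.
have [U hU] := lieA_vspace; pose X := vbasis U; set d := \dim U in X *.
have XU (k : 'I_d) : lieA Gs X`_k by apply/hU/vbasis_mem/mem_nth; rewrite size_tuple.
pose g : 'M[C]_d := \matrix_(k, l) B X`_k X`_l.
have fX : free X by case/andP: (vbasisP U).
have ug : g \in unitmx.
  rewrite -row_free_unit -kermx_eq0; apply/rowV0P => v /sub_kermxP vg.
  have : \sum_k v 0 k *: X`_k = 0.
    apply: Bnd => [|Y /hU YU]; first by apply: lieA_sum => k _; apply: lieAZ.
    rewrite (coord_vbasis YU) (linfun_sum _ _ (BR _)) big1 // => l _.
    rewrite (linfunZ _ _ (BR _)) (linfun_sum _ _ (BL _)).
    suff -> : \sum_k B (v 0 k *: X`_k) X`_l = 0 by rewrite mulr0.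
    rewrite -[RHS](_ : (v *m g) 0 l = 0); last by rewrite vg mxE.
    by rewrite mxE; apply: eq_bigr => k _; rewrite (linfunZ _ _ (BL _)) mxE.
  by move/(freeP fX) => v0; apply/rowP => k; rewrite v0 mxE.
pose F i j : rexp C N := psum (index_enum 'I_d) (fun k => PScale (X`_k i j)
  (psum (index_enum 'I_d) (fun l => PScale (invmx g l k) (dd 0 X`_l e)))).
exists F => y yG; have uy := ag_unit GsG yG.
pose df : 'rV[C]_d := \row_l pdir e y (y *m X`_l).
have FE : mev F y = \sum_k (df *m invmx g) 0 k *: X`_k.
  apply/matrixP => i j; rewrite summxE mxE pev_sum; apply: eq_bigr => k _ /=.
  rewrite !mxE pev_sum mulrC; congr (_ * _); apply: eq_bigr => l _ /=.
  by rewrite pev_dd // mul0mx add0r mulrC mxE.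
split=> [|Y /hU YU]; first by rewrite FE; apply: lieA_sum => k _; apply: lieAZ.
have B1 (l : 'I_d) : B (mev F y) X`_l = pdir e y (y *m X`_l).
  have <- : (df *m invmx g *m g) 0 l = pdir e y (y *m X`_l) by rewrite mulmxKV // mxE.
  rewrite FE (linfun_sum _ _ (BL _)) [RHS]mxE; apply: eq_bigr => k _.
  by rewrite (linfunZ _ _ (BL _)) [g _ _]mxE.
rewrite [in LHS](coord_vbasis YU) [in RHS](coord_vbasis YU) (linfun_sum _ _ (BR _)).
rewrite mulmx_sumr pdir_sumr; apply: eq_bigr => l _.
by rewrite (linfunZ _ _ (BR _)) B1 -scalemxAr pdirZ.
Qed.

(** Both sides have the same pairings with the Lie algebra: use invariance of [B] on one side, the
    derivative of the invariance of [e] on the other. *)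
Lemma gradient_equivariant e F : class_expr Gs e ->
  (forall y, Gs y -> lieA Gs (mev F y) /\
     forall X, lieA Gs X -> B (mev F y) X = pdir e y (y *m X)) ->
  equivariant_expr Gs F.
Proof.
move=> he hF; split=> [y /hF[]//|x y xG yG]; have [FL FB] := hF _ yG.
have xiG := ag_inv GsG xG; have ux := ag_unit GsG xG.
have xyG : Gs (x *m y *m invmx x) by do 2?[apply: (ag_mul GsG) => //].
have [FL' FB'] := hF _ xyG.
apply: gradient_unique => // [|X hX]; first exact: lieA_Ad.
have hZ : lieA Gs (invmx x *m X *m invmx (invmx x)) by apply: lieA_Ad.
rewrite invmxK in hZ; set Z := invmx x *m X *m x in hZ.
have -> : X = x *m Z *m invmx x by rewrite /Z !mulmxA mulmxK // mulmxV // mul1mx.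
rewrite Binv // FB // FB' ; last exact: lieA_Ad.
have hv : vanish Gs (PAdd (ptrans x (invmx x) e) (PScale (-1) e)).
  move=> z zG; rewrite /= pev_trans ?unitmx_inv ?(ag_unit GsG zG) // he //.
  by rewrite mulN1r subrr.
have /= := vanish_pdir GsG hv yG hZ; rewrite pdir_trans ?unitmx_inv ?(ag_unit GsG yG) //.
move/eqP; rewrite mulN1r subr_eq0 => /eqP <-; congr (pdir _ _ _).
by rewrite !mulmxA mulmxKV.
Qed.

End Gradients.

(** * Cartan subalgebra, simple roots and form of the statement in matrix terms *)

Section SemisimpleData.
Variables (R : realType) (N : nat) (G : linAlgGroup R N).
Local Notation C := R[i]%C.
Let Gs : 'M[C]_N -> Prop := lag_set G.
Let GsG : alg_group Gs := lag_alg_group G.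
Variables (h : {vspace 'M[C]_N}) (r : nat) (Delta : r.-tuple (weight h)).
Variable B : 'M[C]_N -> 'M[C]_N -> C.
Hypotheses (G_sc : @simply_connected R 'M[C]_N G) (h_cartan : cartan (lie G) h)
  (rank_r : \dim h = r) (Delta_base : root_base (lie G) Delta) (B_inv : invariant_form G B).
Implicit Types (X Y H g : 'M[C]_N).

Lemma lag_connectedA : connectedA Gs.
Proof. by case: G_sc => _ hp _; apply: path_connected_nrm (lag_one G) => x y; apply: hp. Qed.

Definition simple_root (i : 'I_r) X : C := tnth Delta i (vsproj h X).

Lemma simple_root_val i (H : subvs_of h) : simple_root i (vsval H) = tnth Delta i H.
Proof. by rewrite /simple_root vsvalK. Qed.

Lemma simple_root_linear i : is_linfun (simple_root i).
Proof. by move=> a X Y; rewrite /simple_root !linearP. Qed.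

Lemma simple_root_free (c : 'I_r -> C) :
  (forall H, H \in h -> \sum_i c i * simple_root i H = 0) -> forall i, c i = 0.
Proof.
move=> hc; have [bD _ _] := Delta_base; have /andP[_ fD] := bD.
apply: (freeP fD); apply/lfunP => x; rewrite sum_lfunE zero_lfunE -[RHS](hc _ (subvsP x)).
by apply: eq_bigr => i _; rewrite scale_lfunE simple_root_val (tnth_nth 0).
Qed.

Lemma weight_of (f : subvs_of h -> C) : (forall a x y, f (a *: x + y) = a * f x + f y) ->
  exists beta : weight h, forall x, beta x = f x.
Proof.
move=> fL; have fL' : linear (f : subvs_of h -> C^o) by [].
pose f' : {linear subvs_of h -> C^o} := HB.pack (f : subvs_of h -> C^o)
  (GRing.isLinear.Build _ _ _ _ (f : subvs_of h -> C^o) fL').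
by exists (linfun f') => x; rewrite lfunE.
Qed.

Lemma simple_root_sep H : H \in h -> (forall i, simple_root i H = 0) -> H = 0.
Proof.
move=> hH h0; have [bD _ _] := Delta_base.
have all0 (f : weight h) : f (vsproj h H) = 0.
  rewrite (coord_basis bD (memvf f)) sum_lfunE big1 // => i _.
  rewrite scale_lfunE -(tnth_nth 0 Delta i) -/(simple_root i H) h0.
  by rewrite scaler0.
rewrite -(vsprojK hH); suff -> : vsproj h H = 0 by rewrite linear0.
rewrite (coord_vbasis (memvf (vsproj h H))) big1 // => i _.
have [|f fE] := @weight_of (coord (vbasis {:subvs_of h}) i); first by move=> a x y; rewrite linearP.
by rewrite -fE all0 scale0r.
Qed.

Lemma root_space_vec beta X : root_space (lie G) beta X -> X != 0 ->
  root_vec Gs h (fun H => beta (vsproj h H)) X.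
Proof.
move=> [hX hb] X0; split=> // [|H hH]; first exact/lie_lieA.
by have := hb (vsproj h H); rewrite vsprojK.
Qed.

Lemma simple_root_posneg (b : 'M[C]_N -> C) : is_linfun b -> (exists2 H, H \in h & b H != 0) ->
  (exists X, root_vec Gs h b X) -> exists c : 'I_r -> nat,
    (forall H, H \in h -> b H = \sum_i (c i)%:R * simple_root i H) \/
    (forall H, H \in h -> b H = - \sum_i (c i)%:R * simple_root i H).
Proof.
move=> bL [H1 hH1 b1] [X [hX X0 bX]].
have [|beta betaE] := @weight_of (fun x => b (vsval x)).
  by move=> a x y; rewrite linearP bL.
have comb (c : 'I_r -> nat) H : H \in h ->
    (\sum_i tnth Delta i *+ c i) (vsproj h H) = \sum_i (c i)%:R * simple_root i H.
  move=> hH; rewrite sum_lfunE; apply: eq_bigr => i _.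
  by rewrite -scaler_nat scale_lfunE.
have [_ _ pn] := Delta_base; have [|[c cE]|[c cE]] := pn beta.
- split.
    apply: contraNneq b1 => b0; have := betaE (vsproj h H1).
    by rewrite b0 zero_lfunE vsprojK // => <-.
  exists X => //; split; first exact/lie_lieA.
  by move=> H; rewrite betaE; apply: bX; apply: subvsP.
- by exists c; left=> H hH; rewrite -comb // -cE betaE vsprojK.
exists c; right=> H hH.
by rewrite -comb // -cE opp_lfunE opprK betaE vsprojK.
Qed.

(** The given form is bilinear only on the Lie algebra; composing with a projection onto it yields a
    form bilinear on all matrices, so that it can be evaluated inside formal expressions. *)
Lemma form_extension : exists B' : 'M[C]_N -> 'M[C]_N -> C,
  [/\ forall Z, is_linfun (B'^~ Z), forall Z, is_linfun (B' Z)
    & forall X Y, lieA Gs X -> lieA Gs Y -> B' X Y = B X Y].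
Proof.
have [U hU] := lieA_vspace Gs; have [Bl Br _ _] := B_inv.
have pU X : lie G (projv U X) by apply/lie_lieA/hU/memv_proj.
exists (fun X Y => B (projv U X) (projv U Y)); split=> [Z a X Y|Z a X Y|X Y /hU XU /hU YU].
- by rewrite linearP; apply: Bl; apply: pU.
- by rewrite linearP; apply: Br; apply: pU.
by rewrite !projv_id.
Qed.

End SemisimpleData.

(** * Leading terms of the fundamental characters *)

Section FundamentalRepresentations.
Variables (R : realType) (N : nat) (G : linAlgGroup R N).
Local Notation C := R[i]%C.
Let Gs : 'M[C]_N -> Prop := lag_set G.
Let GsG : alg_group Gs := lag_alg_group G.
Variables (h : {vspace 'M[C]_N}) (r : nat) (Delta : r.-tuple (weight h)).
Hypotheses (h_cartan : cartan (lie G) h) (Delta_base : root_base (lie G) Delta).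
Let al := simple_root Delta.
Variables (B : 'M[C]_N -> 'M[C]_N -> C) (P : 'M[C]_N) (w : 'I_N -> 'rV[int]_r).
Variables (ex ey : 'I_r -> 'M[C]_N) (A : 'I_r -> 'I_r -> int).
Hypotheses (RD : root_datum Gs h al B P w ex ey A) (hG1 : forall g, Gs g -> G1 Gs g).

Lemma cartan_lieA H : H \in h -> lieA Gs H.
Proof. by case: h_cartan => hL _ _ _ /hL /lie_lieA. Qed.

Lemma Hj_coroot j : is_coroot (lie G) (tnth Delta j) (vsproj h (Hj P w j)).
Proof.
have Hh := Hj_in RD j; split; first by have := rd_al RD j j; rewrite (rd_diag RD).
exists (ex j), (ey j); rewrite vsprojK // -(rd_exy RD); split=> //; split.
- by apply/lie_lieA/(rd_exL RD).
- by move=> x; rewrite -simple_root_val; apply: (rd_ex RD); apply: subvsP.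
- by apply/lie_lieA/(rd_eyL RD).
by move=> x; rewrite opp_lfunE -simple_root_val; apply: (rd_ey RD); apply: subvsP.
Qed.

Lemma fundamental_character (i : 'I_r) n (rho : G -> 'M[C]_n) : fundamental_rep Delta i rho ->
  exists chi : rexp C N, [/\ forall g, character rho g = pev chi (val g), class_expr Gs chi,
    top A (delta_mx 0 i) 1 (fun u => pev chi (tor P w u))
  & forall j, top A (delta_mx 0 i) (i == j)%:R
      (fun u => pev (dd 0 (Hj P w j) chi) (tor P w u))].
Proof.
move=> [[rreg r1 rM] [n0 irr] [om om_fund [v [v0 v_wt v_high]]]].
have /fin_all_exists[E EE] a : exists E : 'I_n -> rexp C N, forall b g, rho g a b = pev (E b) (val g).
  have /fin_all_exists[E EE] b : exists e, forall g, rho g a b = pev e (val g).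
    exact/regular_rexp.
  by exists E.
have rhoE g : rho g = mev E (val g) by apply/matrixP => a b; rewrite mxE EE.
have m1 : mev E 1%:M = 1%:M by rewrite -r1 rhoE.
have mM g k : Gs g -> Gs k -> mev E (g *m k) = mev E g *m mev E k.
  by move=> gG kG; have := rM (mkG gG) (mkG kG); rewrite !rhoE.
have drE X : lieA Gs X -> drep rho X = mdir E 1%:M X.
  move=> hX; apply/matrixP => a b; rewrite !mxE.
  by rewrite (@differentialE _ _ _ _ (E a b)) //= mul1mx.
have irr' (U : {vspace 'cV[C]_n}) :
    (forall g x, Gs g -> x \in U -> mev E g *m x \in U) -> U = 0%VS \/ U = fullv.
  by move=> hU; apply: irr => g x xU; rewrite rhoE; apply: hU => //; apply: Gs_val.
have v_wt' j : mdir E 1%:M (Hj P w j) *m v = (i == j)%:R *: v.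
  rewrite -drE; last by apply: cartan_lieA; apply: Hj_in RD j.
  have := v_wt (vsproj h (Hj P w j)); rewrite vsprojK ?(Hj_in RD) // => ->.
  by rewrite (om_fund j) //; apply: Hj_coroot.
have v_high' X (k : 'I_r -> nat) : lieA Gs X -> X != 0 -> (exists i, k i != 0%N) ->
    (forall H, H \in h -> br H X = (\sum_i (k i)%:R * al i H) *: X) ->
    mdir E 1%:M X *m v = 0.
  move=> hX X0 [l kl] hk; rewrite -drE //.
  pose beta : weight h := \sum_i tnth Delta i *+ k i.
  have betaE x : beta x = \sum_i (k i)%:R * al i (vsval x).
    rewrite sum_lfunE; apply: eq_bigr => a _.
    by rewrite -scaler_nat scale_lfunE /al simple_root_val.
  have hs : root_space (lie G) beta X.
    split; first exact/lie_lieA.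
    by move=> x; rewrite betaE; apply: hk; apply: subvsP.
  apply: (v_high beta) => //; last by exists k.
  split; last by exists X.
  apply: contra kl => /eqP b0; rewrite -(eqr_nat C); apply/eqP.
  apply: (simple_root_free Delta_base (c := fun i => (k i)%:R)) => H hH.
  by rewrite -{1}(vsprojK hH) -betaE b0 zero_lfunE.
have [t1 t2] := character_torus GsG cartan_lieA hG1 RD m1 mM irr' v0 v_wt' v_high'.
exists (charE E); split=> // [g|x y xG yG]; first by rewrite pev_charE -rhoE.
exact: (charE_class GsG m1 mM).
Qed.

End FundamentalRepresentations.

(** * Assembly of the basis and flatness statements *)

Local Open Scope complex_scope.

Theorem theorem4p1 (R : realType) (N : nat) (G : linAlgGroup R N)
    (G_sc : @simply_connected R 'M[R[i]]_N G)
    (G_ss : lie_semisimple (lie G))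
    (h : {vspace 'M[R[i]]_N}) (h_cartan : cartan (lie G) h)
    (r : nat) (rank_r : \dim h = r)
    (Delta : r.-tuple (weight h)) (Delta_base : root_base (lie G) Delta)
    (B : 'M[R[i]]_N -> 'M[R[i]]_N -> R[i]) (B_inv : invariant_form G B)
    (n : 'I_r -> nat) (rho : forall i : 'I_r, G -> 'M[R[i]]_(n i))
    (rho_fund : forall i, fundamental_rep Delta i (rho i)) :
  inv_basis (fun i => field_of (grad B (character (rho i)))) /\
  (forall D : (G -> R[i]) -> G -> R[i], inv_vector_field D -> flat D).
Proof.
have GsG := lag_alg_group G; set Gs : 'M[R[i]]_N -> Prop := lag_set G in GsG.
split; last first.
  move=> D /inv_field_expr[F [FE DE]]; exists (fun y : G => mev F (val y)).
  have FM := equivariant_map_expr FE; split=> // y; have [_ _ h1] := FM.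
  (* Flatness: conjugating [y] by itself gives [y] back. *)
  rewrite -h1; congr (mev F _) => /=; exact: mulmxK (unit_val y) _.
have [B' [BL BR BB]] := form_extension B_inv.
have [_ _ Bnd0 Binv0] := B_inv.
have Bnd X : lieA Gs X -> (forall Y, lieA Gs Y -> B' X Y = 0) -> X = 0.
  move=> hX h0; apply: Bnd0 => [|Y /lie_lieA hY]; first exact/lie_lieA.
  by rewrite -BB // h0.
have Binv g X Y : Gs g -> lieA Gs X -> lieA Gs Y ->
    B' (g *m X *m invmx g) (g *m Y *m invmx g) = B' X Y.
  move=> gG hX hY; rewrite !BB //; try exact: lieA_Ad.
  by apply: (Binv0 (mkG gG)); apply/lie_lieA.
have hL := cartan_lieA h_cartan; have [_ hbr _ hself0] := h_cartan.
have hself X : lieA Gs X -> (forall Y, Y \in h -> br X Y \in h) -> X \in h.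
  by move=> /lie_lieA; apply: hself0.
pose al := simple_root Delta; have alL := simple_root_linear Delta.
have alfree := simple_root_free Delta_base.
have alroot i : exists X, root_vec Gs h (al i) X.
  have [_ hr _] := Delta_base; have [_ [X hX X0]] := hr i; exists X.
  exact: root_space_vec.
have [P [w [ex [ey [A RD]]]]] := root_datum_exists GsG hL hbr hself alL alfree
  (simple_root_sep Delta_base) rank_r alroot (simple_root_posneg Delta_base) BL BR Bnd Binv.
have hG1 := G1_all GsG (@archi_pow2 R) (lag_connectedA G_sc) (rd_nil RD).
have /fin_all_exists[chi chiP] i := fundamental_character h_cartan Delta_base RD hG1 (rho_fund i).
have /fin_all_exists[Gr GrP] i := gradient_expr GsG BL BR Bnd (chi i).
have GrE i : equivariant_expr Gs (Gr i).
  by apply: (gradient_equivariant GsG BL Bnd Binv _ (GrP i)); case: (chiP i).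
(* Existence of a gradient makes [grad] a true gradient instead of its default value 0; uniqueness
   identifies it with the regular one. *)
have gradE i : grad B (character (rho i)) = fun y => mev (Gr i) (val y).
  apply/funext => y; have [GL GB] := GrP i _ (Gs_val y); have [cE _ _ _] := chiP i.
  have dE X : lieA Gs X -> B (mev (Gr i) (val y)) X = differential (character (rho i)) y X.
    by move=> hX; rewrite -BB // GB // (differentialE _ cE).
  have [/lie_lieA gL gB] : [set Y | lie G Y /\
      forall X, lie G X -> B Y X = differential (character (rho i)) y X]%classic
      (grad B (character (rho i)) y).
    apply: xgetPex; exists (mev (Gr i) (val y)); split; first exact/lie_lieA.
    by move=> X /lie_lieA /dE.
  apply: (gradient_unique BL Bnd gL GL) => X hX.
  by rewrite !BB // dE // gB //; apply/lie_lieA.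
have XE i f e y : (forall g, f g = pev e (val g)) ->
    field_of (grad B (character (rho i))) f y = pdir e (val y) (val y *m mev (Gr i) (val y)).
  move=> fE; have [GL _] := GrE i; rewrite gradE (field_ofE fE) //.
  by apply: GL; apply: Gs_val.
have chi_class i : class_expr Gs (chi i) by case: (chiP i).
have chi_top i : top A (delta_mx 0 i) 1 (fun u => pev (chi i) (tor P w u)) by case: (chiP i).
have chi_dtop i j : top A (delta_mx 0 i) (i == j)%:R
    (fun u => pev (dd 0 (Hj P w j) (chi i)) (tor P w u)) by case: (chiP i).
have Gr_grad i y X : Gs y -> lieA Gs X -> B' (mev (Gr i) y) X = pdir (chi i) y (y *m X).
  by move=> yG; case: (GrP i y yG) => _; apply.
split=> [i|D /inv_field_expr[F [FE DE]]|a ha h0 i].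
- by apply: (field_of_inv _ (GrE i)) => y; rewrite gradE.
- have [a aC aE] := gradients_span GsG hL hself hG1 alL alfree BL BR Binv RD chi_class
    chi_top chi_dtop GrE Gr_grad FE.
  exists (fun i g => pev (a i) (val g)) => [i|f fr].
    by split; [apply/regular_rexp; exists (a i)|apply/class_expr_val].
  have [e eE] := (regular_rexp f).1 fr; apply/funext => y; have [FL _] := FE.
  rewrite DE // (field_ofE eE); last by apply: FL; apply: Gs_val.
  rewrite aE; last exact: Gs_val.
  rewrite mulmx_sumr pdir_sumr fct_sumE; apply: eq_bigr => i _.
  by rewrite -scalemxAr pdirZ -(XE i f e y eE).
have /fin_all_exists[b bE] j : exists b, forall g, a j g = pev b (val g).
  by apply/regular_rexp; case: (ha j).
have bC j : class_expr Gs (b j).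
  apply/class_expr_val => x y; rewrite -!bE.
  by case: (ha j).
suff hv : vanish Gs (b i).
  by apply/funext => g; rewrite bE hv //; apply: Gs_val.
apply: (gradients_free GsG hL hG1 alL alfree BL RD chi_dtop Gr_grad bC) => y yG.
(* A combination of fields that is zero on functions is tested on the matrix entries, which recover
   the entries of y times the combination of gradients. *)
have uy := lag_unit yG; apply: (can_inj (mulKmx uy)); rewrite mulmx0.
apply/matrixP => k l; rewrite [RHS]mxE.
pose f (g : G) := pev (PX k l) (val g).
have fr : regular f by apply/regular_rexp; exists (PX k l).
transitivity ((\sum_j a j * field_of (grad B (character (rho j))) f) (mkG yG)).
  rewrite fct_sumE mulmx_sumr summxE; apply: eq_bigr => j _.
  by rewrite -[RHS]/(a j (mkG yG) * _) (XE j f (PX k l) (mkG yG)) //= bE -scalemxAr mxE.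
by rewrite h0.
Qed.
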